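(* Let $n=2$. There exist constants $C_1, C_2>0$ (depending only on the space dimension, hence absolute constants, independent of the initial data and of $t$) such that for every $[u_0,u_1]\in H^1(\mathbf{R}^2)\times L^2(\mathbf{R}^2)$ the weak solution $u(t,x)$ of the Cauchy problem $$u_{tt}-\Delta u=0 \ \text{ in } (0,\infty)\times\mathbf{R}^2,\qquad u(0,x)=u_0(x),\quad u_t(0,x)=u_1(x),$$ satisfies the following: (i) if $[u_0,u_1]\in L^1(\mathbf{R}^2)\times L^1(\mathbf{R}^2)$, then $$\|u(t,\cdot)\|\le C_1 I_{0,2}\sqrt{\log t}\qquad\text{for } t\gg 1;$$ (ii) if $[u_0,u_1]\in L^1(\mathbf{R}^2)\times L^{1,1}(\mathbf{R}^2)$, then $$C_2\left|\int_{\mathbf{R}^2}u_1(x)\,dx\right|\sqrt{\log t}\le\|u(t,\cdot)\|\qquad\text{for } t\gg 1.$$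
   Context: $\|\cdot\|$ denotes the usual $L^2(\mathbf{R}^2)$-norm. $L^{1,1}(\mathbf{R}^2)$ is the space of $f\in L^1(\mathbf{R}^2)$ with $\|f\|_{L^{1,1}}:=\int_{\mathbf{R}^2}(1+|x|)|f(x)|\,dx<\infty$. $$I_{0,2}:=\|u_0\|+\|u_0\|_{L^1(\mathbf{R}^2)}+\|u_1\|+\|u_1\|_{L^1(\mathbf{R}^2)}.$$ For $[u_0,u_1]\in H^1(\mathbf{R}^2)\times L^2(\mathbf{R}^2)$ the Cauchy problem has a unique weak solution $u\in C([0,\infty);H^1(\mathbf{R}^2))\cap C^1([0,\infty);L^2(\mathbf{R}^2))$; its spatial Fourier transform (with convention $\hat f(\xi)=\int e^{-ix\cdot\xi}f(x)\,dx$ and its $L^2$ extension) is $\hat u(t,\xi)=\frac{\sin(t|\xi|)}{|\xi|}\hat u_1(\xi)+\cos(t|\xi|)\hat u_0(\xi)$. ''For $t\gg1$'' means: there is $t_0>1$, possibly depending on the initial data, such that the inequality holds for all $t\ge t_0$. *)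

(* Defs.v *)
From mathcomp Require Import all_boot all_order all_algebra.
From mathcomp Require Import all_classical all_reals all_analysis.

Set Implicit Arguments.
Unset Strict Implicit.
Unset Printing Implicit Defensive.

Import Order.TTheory GRing.Theory Num.Theory.
Import numFieldNormedType.Exports.

Local Open Scope classical_set_scope.
Local Open Scope ring_scope.

(* Elements of the Lebesgue spaces over the plane are represented by Borel
   functions [R * R -> R]; all functions are real valued. *)
Notation leb2 R := (@lebesgue_measure R \x @lebesgue_measure R)%E.

Section plane.
Context {R : realType}.
Implicit Types (f g phi : R * R -> R) (w : R -> R * R -> R).

Definition L1 : set (R * R -> R) := [set f | f \in Lfun (leb2 R) 1%:E].

Definition L2 : set (R * R -> R) := [set f | f \in Lfun (leb2 R) 2%:E].

Definition norm1 f : \bar R := 'N[leb2 R]_1%:E[EFin \o f]%E.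

Definition norm2 f : \bar R := 'N[leb2 R]_2%:E[EFin \o f]%E.

(* The norm provided by the library on [R * R] is the sup norm. *)
Definition euclid (x : R * R) : R := Num.sqrt (x.1 ^+ 2 + x.2 ^+ 2).

Definition L11 : set (R * R -> R) :=
  [set f | L1 f /\
    (\int[leb2 R]_x ((1 + euclid x) * `|f x|)%:E < +oo)%E].

Definition e1 : R * R := (1, 0).
Definition e2 : R * R := (0, 1).

Fixpoint Ck (k : nat) phi : Prop :=
  continuous phi /\
  if k is k'.+1 then
    [/\ forall x, derivable phi x e1, forall x, derivable phi x e2,
        Ck k' ('D_e1 phi) & Ck k' ('D_e2 phi)]
  else True.

Definition test_function phi : Prop :=
  (forall k, Ck k phi) /\
  exists M : R, forall x, M < euclid x -> phi x = 0.

Definition weak_partial (e : R * R) f g : Prop :=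
  forall phi, test_function phi ->
    (\int[leb2 R]_x (f x * 'D_e phi x) = - \int[leb2 R]_x (g x * phi x))%R.

Definition weak_grad f g1 g2 : Prop :=
  [/\ L2 g1, L2 g2, weak_partial e1 f g1 & weak_partial e2 f g2].

Definition H1 : set (R * R -> R) :=
  [set f | L2 f /\ exists g1 g2, weak_grad f g1 g2].

(* w belongs to C([0, oo); L^2); values at negative times are irrelevant. *)
Definition continuous_L2 w : Prop :=
  forall t, 0 <= t ->
    L2 (w t) /\
    norm2 (w s \- w t) @[s --> within `[0, +oo[ (nbhs t)] --> 0%E.

(* w' is the strong derivative of w in L^2 on [0, oo), one-sided at 0. *)
Definition derivative_L2 w w' : Prop :=
  forall t, 0 <= t ->
    norm2 (fun x => (s - t)^-1 * (w s x - w t x) - w' t x)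
      @[s --> within `[0, +oo[ t^'] --> 0%E.

(* ut is the time derivative of u, and (ux, uy) its spatial weak gradient.
   Continuity of u in H^1 is that of u, ux and uy in L^2. The equation is
   d/dt (u_t, v) + (grad u, grad v) = 0 on (0, oo) for every v in H^1. *)
Record wave_solution_with (u0 u1 : R * R -> R) (u ut ux uy : R -> R * R -> R)
    : Prop := {
  wave_grad : forall t, 0 <= t -> weak_grad (u t) (ux t) (uy t) ;
  wave_cont : continuous_L2 u ;
  wave_cont_x : continuous_L2 ux ;
  wave_cont_y : continuous_L2 uy ;
  wave_deriv : derivative_L2 u ut ;
  wave_cont_t : continuous_L2 ut ;
  wave_init0 : u 0 = u0 %[ae leb2 R] ;
  wave_init1 : ut 0 = u1 %[ae leb2 R] ;
  wave_eq : forall v v1 v2, L2 v -> weak_grad v v1 v2 -> forall t : R, 0 < t ->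
    is_derive t (1 : R) (fun s => (\int[leb2 R]_x (ut s x * v x))%R)
      (- (\int[leb2 R]_x (ux t x * v1 x + uy t x * v2 x))%R)
}.

Definition weak_wave_solution (u0 u1 : R * R -> R) (u : R -> R * R -> R)
    : Prop :=
  exists ut ux uy, wave_solution_with u0 u1 u ut ux uy.

Definition I02 (u0 u1 : R * R -> R) : \bar R :=
  (norm2 u0 + norm1 u0 + norm2 u1 + norm1 u1)%E.

End plane.

(* Main.v *)
(** With [b] a smooth bump and [rho = sqrt (|x|^2 + xi^2)], the spherical wave
    [b (s - rho) / rho] of R^3 integrated over [xi] is a smooth compactly
    supported wave [w] of the plane (method of descent). No Fourier transform is
    used: a weak solution [u] is paired with [w].

    For waves [u], [w], the quantity [(u_t(s), w(T - s)) + (u(s), w_t(T - s))] is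
    constant on [0 <= s <= T]. For [s = t], [T = 2t] this reads
    [d/dt (u(t), w(t)) = (u_1, w(2t)) + (u_0, w_t(2t))]. The time integral of [w]
    is a potential equal to [2 log t] up to [O(1 + |x|)], so [(u(t), w(t))] grows
    like [log t] times the mean of [u_1]. For [u = w] this gives
    [|w(t)| <= C sqrt (log t)], and Cauchy-Schwarz then yields the lower bound.

    For the upper bound the duality at [T = t] expresses [(u(t), w_t(0, . - y))]
    through the data, [w(t)] and [w_t(t)]. Averaging over [y] against a test
    function [phi] bounds [(w_t(0) * u(t), phi)] by
    [C (|u_1|_1 |w(t)| + |u_0|_1 |w_t(t)| + |u_t(t)|) |phi|]. The kernel [w_t(0)]
    has mass [c > 0], and [w_t(0) * u(t) - c u(t)] is controlled by the gradient of
    [u(t)], hence by the conserved energy. *)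

From HB Require Import structures.
Require Import Defs.
From mathcomp Require Import all_boot all_order all_algebra.
From mathcomp Require Import all_classical all_reals all_analysis.
From mathcomp Require Import measurable_realfun ring lra.
Import Order.TTheory GRing.Theory Num.Theory.
Import numFieldNormedType.Exports.
Local Open Scope classical_set_scope.
Local Open Scope ring_scope.
Set Implicit Arguments.
Unset Strict Implicit.
Unset Printing Implicit Defensive.

(** * The L2 inner product *)

Section L2.
Context {R : realType}.
Implicit Types (f g h : R * R -> R).

(** In a weak solution [u_t] is only continuous in L2, so nothing quadratic in [u_t] can be
    differentiated directly. Every identity differentiates a pairing in which one factor is
    differentiable in L2 and the other is tested against a fixed H^1 function. The energy is reached
    by translating time in a bilinear form.

    The logarithm is that of the integral of [1 / rho] along a line: a spherical wave of R^3 decays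
    like [1 / rho], and descent sums it over the additional axis. The bump lives on
    [|s - rho| <= 1], so the singularity of [1 / rho] is never met for [s > 2]; test waves therefore
    start at [s = 3].

    In the bound [A (|u_0|_1 + |u_1|_1) sqrt (log t) + D] only [A] has to be absolute. [D] is made
    of the energy, which [I_{0,2}] does not control; it is absorbed because [sqrt (log t)] is
    unbounded, from a time that depends on the data. This asks for [I_{0,2} > 0], and vanishing data
    are treated apart. *)

Definition ip f g : R := (\int[leb2 R]_x (f x * g x))%R.
Definition n2 f : R := Num.sqrt (ip f f).

Lemma L2_measurable f : L2 f -> measurable_fun setT f.
Proof. by rewrite /L2/= inE => /andP[/[!inE]]. Qed.

Lemma norm2_sqr f : (\int[leb2 R]_x (`|f x| `^ 2)%:E)%E = (\int[leb2 R]_x (f x ^+ 2)%:E)%E.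
Proof.
by apply: eq_integral => x _; rewrite powR_mulrn// -normrX ger0_norm// sqr_ge0.
Qed.

Lemma norm2_def f : norm2 f = ((\int[leb2 R]_x (f x ^+ 2)%:E) `^ 2^-1)%E.
Proof.
rewrite /norm2 unlock /Lnorm /=; congr (_ `^ _)%E.
by rewrite -norm2_sqr; apply: eq_integral => x _.
Qed.

Lemma L2P f : measurable_fun setT f ->
  (leb2 R).-integrable setT (EFin \o (fun x => f x ^+ 2)) -> L2 f.
Proof.
move=> mf if2; rewrite /L2/= inE; apply/andP; split; rewrite inE//=.
rewrite /finite_norm -[X in (X < _)%E]/(norm2 f) norm2_def.
apply: poweR_lty.
case/integrableP : if2 => _; apply: le_lt_trans.
rewrite ge0_le_integral//=.
- by move=> x _; rewrite lee_fin sqr_ge0.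
- by apply/measurable_EFinP; exact: measurable_funX.
- by apply/measurable_EFinP/measurableT_comp => //; exact: measurable_funX.
- by move=> x _; rewrite lee_fin ler_norm.
Qed.

Lemma L2_mul_integrable f g : L2 f -> L2 g ->
  (leb2 R).-integrable setT (EFin \o (fun x => f x * g x)).
Proof. by move=> hf hg; apply/Lfun1_integrable; exact: Lfun2_mul_Lfun1. Qed.

Lemma ip_ge0 f : 0 <= ip f f.
Proof. by apply: Rintegral_ge0 => x _; rewrite -expr2 sqr_ge0. Qed.

Lemma norm2E f : L2 f -> norm2 f = (n2 f)%:E.
Proof.
move=> hf; rewrite norm2_def.
have -> : (\int[leb2 R]_x (f x ^+ 2)%:E)%E = (ip f f)%:E.
  rewrite /ip /Rintegral fineK; last first.
    by apply: integrable_fin_num => //; exact: L2_mul_integrable.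
  by apply: eq_integral => x _; rewrite expr2.
by rewrite /= powR12_sqrt ?ip_ge0.
Qed.

Lemma ipC f g : ip f g = ip g f.
Proof. by apply: eq_Rintegral => x _; rewrite mulrC. Qed.

Lemma n2_ge0 f : 0 <= n2 f. Proof. exact: sqrtr_ge0. Qed.

Lemma n2_sqr f : n2 f ^+ 2 = ip f f.
Proof. by rewrite sqr_sqrtr// ip_ge0. Qed.

Lemma L2D f g : L2 f -> L2 g -> L2 (fun x => f x + g x).
Proof.
move=> hf hg; exact: (Lfun_addr_closed (leb2 R) (lee1n 2)).2.
Qed.

Lemma L2Z a f : L2 f -> L2 (fun x => a * f x).
Proof.
move=> hf.
have -> : (fun x => a * f x) = a \o* f by apply/funext => x /=; rewrite mulrC.
by apply: Lfun_scale => //; rewrite ler1n.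
Qed.

Lemma L2B f g : L2 f -> L2 g -> L2 (fun x => f x - g x).
Proof.
move=> hf hg.
rewrite (_ : (fun _ => _) = (fun x => f x + (-1) * g x)).
  by apply: L2D => //; exact: L2Z.
by apply/funext => x; rewrite mulN1r.
Qed.

Lemma ipDl f g h : L2 f -> L2 g -> L2 h ->
  ip (fun x => f x + g x) h = ip f h + ip g h.
Proof.
move=> hf hg hh; rewrite /ip -RintegralD//; [|exact: L2_mul_integrable..].
by apply: eq_Rintegral => x _; rewrite mulrDl.
Qed.

Lemma ipZl a f h : L2 f -> L2 h -> ip (fun x => a * f x) h = a * ip f h.
Proof.
move=> hf hh; rewrite /ip -RintegralZl//; [|exact: L2_mul_integrable..].
by apply: eq_Rintegral => x _; rewrite mulrA.
Qed.

Lemma ipBl f g h : L2 f -> L2 g -> L2 h ->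
  ip (fun x => f x - g x) h = ip f h - ip g h.
Proof.
move=> hf hg hh; rewrite /ip -RintegralB//; [|exact: L2_mul_integrable..].
by apply: eq_Rintegral => x _; rewrite mulrBl.
Qed.

Lemma ipBr f g h : L2 f -> L2 g -> L2 h ->
  ip h (fun x => f x - g x) = ip h f - ip h g.
Proof. by move=> *; rewrite ipC ipBl// !(ipC h). Qed.

Lemma ipDr f g h : L2 f -> L2 g -> L2 h ->
  ip h (fun x => f x + g x) = ip h f + ip h g.
Proof. by move=> *; rewrite ipC ipDl// !(ipC h). Qed.

Lemma ipZr a f h : L2 f -> L2 h -> ip h (fun x => a * f x) = a * ip h f.
Proof. by move=> *; rewrite ipC ipZl// !(ipC h). Qed.

Lemma ip_CS f g : L2 f -> L2 g -> `|ip f g| <= n2 f * n2 g.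
Proof.
move=> hf hg.
have := @hoelder _ _ _ (leb2 R) f g 2 2 (L2_measurable hf) (L2_measurable hg).
move=> /(_ (ltr0n _ 2) (ltr0n _ 2)).
rewrite -[('N[_]_2%:E[_])%E]/(norm2 f) -[X in (_ <= _ * X)%E]/(norm2 g).
rewrite !norm2E// => /(_ _)/wrap[]; first by rewrite [RHS]splitr !div1r.
rewrite -EFinM -lee_fin => H; apply: le_trans H.
have ifg := L2_mul_integrable hf hg.
rewrite Lnorm1 EFin_normr_Rintegral//.
exact: le_abse_integral (measurable_int _ ifg).
Qed.

Lemma n2Z a f : L2 f -> n2 (fun x => a * f x) = `|a| * n2 f.
Proof.
move=> hf; rewrite /n2 ipZl//; last exact: L2Z.
by rewrite ipZr// mulrA -expr2 sqrtrM ?sqr_ge0// sqrtr_sqr.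
Qed.

Lemma n2_triangle f g : L2 f -> L2 g -> n2 (fun x => f x + g x) <= n2 f + n2 g.
Proof.
move=> hf hg; rewrite -ler_sqr ?nnegrE ?addr_ge0 ?n2_ge0//.
rewrite n2_sqr ipDl//; last exact: L2D.
rewrite !ipDr// (ipC g f) sqrrD !n2_sqr.
have := le_trans (ler_norm _) (ip_CS hf hg).
lra.
Qed.

End L2.

(** * Lebesgue measure on the plane *)

Section plane_measure.
Context {R : realType}.
Implicit Types (f g : R * R -> R).

(** The measurable structure of the plane is the product one, so open sets have to be shown
    measurable: an open set is the countable union of the rational boxes it contains. *)
Lemma open2_measurable (A : set (R * R)) : open A ->
  @measurable _ (measurableTypeR R * measurableTypeR R)%type A.
Proof.
move=> oA.
pose box (i : rat * rat * (rat * rat)) : set (R * R) :=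
  `](ratr i.1.1 : R), (ratr i.1.2 : R)[%classic `*` `](ratr i.2.1 : R), (ratr i.2.2 : R)[%classic.
have -> : A = \bigcup_i (if `[< box i `<=` A >] then box i else set0).
  apply/seteqP; split; last first.
    by move=> x [i _]; case: ifPn => // /asboolP; apply.
  move=> [x y] Axy; have : nbhs (x, y) A by exact: open_nbhs_nbhs.
  move=> /nbhs_ballP[e /= e0 He].
  have [a] : exists a, ratr a \in `]x - e, x[ by apply: rat_in_itvoo; rewrite ltrBlDr ltrDl.
  rewrite in_itv/= => /andP[a1 a2].
  have [b] : exists b, ratr b \in `]x, x + e[ by apply: rat_in_itvoo; rewrite ltrDl.
  rewrite in_itv/= => /andP[b1 b2].
  have [c] : exists c, ratr c \in `]y - e, y[ by apply: rat_in_itvoo; rewrite ltrBlDr ltrDl.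
  rewrite in_itv/= => /andP[c1 c2].
  have [d] : exists d, ratr d \in `]y, y + e[ by apply: rat_in_itvoo; rewrite ltrDl.
  rewrite in_itv/= => /andP[d1 d2].
  exists ((a, b), (c, d)) => //; rewrite ifT.
    by rewrite /box/=; split; rewrite /= in_itv/= ?a2 ?c2.
  apply/asboolP => -[x' y'] [/=]; rewrite !in_itv/= => /andP[x1 x2] /andP[y1 y2].
  by apply: He; split; rewrite /ball/= ltr_norml; apply/andP; split; lra.
apply: countable_bigcupT_measurable => //.
move=> i; case: ifP => // _.
by apply: measurableX; exact: measurable_itv.
Qed.

Lemma continuous2_measurable f : continuous f -> measurable_fun setT f.
Proof.
move=> cf; apply: (measurability _ (RGenOpens.measurableE R)).
move=> _ [_ [a [b ->]] <-]; rewrite setTI; apply: open2_measurable.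
by move/continuousP : cf; apply; exact: interval_open.
Qed.

Lemma measurable_shift (a : R) :
  measurable_fun setT (fun x : measurableTypeR R => x + a : measurableTypeR R).
Proof.
by apply: continuous_measurable_fun => x; apply: cvgD; [exact: cvg_id|exact: cvg_cst].
Qed.

(** The image of Lebesgue measure under the translation agrees with it on half-open intervals, and
    these determine it. *)
Lemma lebesgue_measure_shift (a : R) (A : set (measurableTypeR R)) : measurable A ->
  @lebesgue_measure R ((fun x => x + a) @^-1` A) = lebesgue_measure A.
Proof.
move=> mA; apply/esym.
pose ms := isMeasurableFun.Build _ _ _ _ _ (measurable_shift a).
pose sh : {mfun measurableTypeR R >-> measurableTypeR R} :=
  HB.pack (fun x : measurableTypeR R => x + a : measurableTypeR R) ms.
rewrite (@lebesgue_measure_unique R (pushforward (@lebesgue_measure R) sh))//.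
move=> _ [[c d] /= _ <-]; rewrite /pushforward.
have -> : sh @^-1` `]c, d] = `]c - a, d - a]%classic.
  by apply/seteqP; split => x /=; rewrite !in_itv/= ltrBlDr lerBrDr.
rewrite !lebesgue_measure_itv/= !lte_fin ltrD2r.
by case: ifP => // _; rewrite -!EFinB; congr (_%:E); ring.
Qed.

Lemma measurable_shift2 (h : R * R) :
  measurable_fun setT (fun x : measurableTypeR R * measurableTypeR R =>
    (x : R * R) + h : measurableTypeR R * measurableTypeR R).
Proof.
apply/measurable_fun_pairP; split => /=.
  exact: measurableT_comp (measurable_shift h.1) measurable_fst.
exact: measurableT_comp (measurable_shift h.2) measurable_snd.
Qed.

Lemma leb2_shift (h : R * R) (A : set (measurableTypeR R * measurableTypeR R)) :
  measurable A -> leb2 R ((fun x : R * R => x + h) @^-1` A) = leb2 R A.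
Proof.
move=> mA; apply/esym.
pose ms := isMeasurableFun.Build _ _ _ _ _ (measurable_shift2 h).
pose sh : {mfun (measurableTypeR R * measurableTypeR R)%type >->
  (measurableTypeR R * measurableTypeR R)%type} := HB.pack
  (fun x : measurableTypeR R * measurableTypeR R =>
    (x : R * R) + h : measurableTypeR R * measurableTypeR R) ms.
rewrite (@product_measure_unique _ _ _ _ _ lebesgue_measure lebesgue_measure
  (pushforward (leb2 R) sh))// => B C mB mC.
rewrite /pushforward.
transitivity (leb2 R (((fun x => x + h.1) @^-1` B) `*` ((fun x => x + h.2) @^-1` C))).
  by [].
rewrite product_measure1E; first by congr (_ * _)%E; exact: lebesgue_measure_shift.
  by rewrite -[X in measurable X]setTI; exact: measurable_shift.
by rewrite -[X in measurable X]setTI; exact: measurable_shift.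
Qed.

Lemma integral_shift (h : R * R) (f : R * R -> \bar R) : measurable_fun setT f ->
  (\int[leb2 R]_x f ((x : R * R) + h)%R = \int[leb2 R]_x f x)%E.
Proof.
have ge0 (g : R * R -> \bar R) : measurable_fun setT g -> (forall x, 0 <= g x)%E ->
    (\int[leb2 R]_x g ((x : R * R) + h)%R = \int[leb2 R]_x g x)%E.
  move=> mg g0.
  pose ms := isMeasurableFun.Build _ _ _ _ _ (measurable_shift2 h).
  pose sh : {mfun (measurableTypeR R * measurableTypeR R)%type >->
    (measurableTypeR R * measurableTypeR R)%type} := HB.pack
  (fun x : measurableTypeR R * measurableTypeR R =>
    (x : R * R) + h : measurableTypeR R * measurableTypeR R) ms.
  transitivity (\int[pushforward (leb2 R) sh]_x g x)%E.
    by rewrite (ge0_integral_pushforward (measurable_shift2 h)).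
  by apply: eq_measure_integral => A mA _; exact: leb2_shift.
move=> mf; rewrite integralE [RHS]integralE; congr (_ - _)%E.
  rewrite -[RHS]ge0//; last exact: measurable_funepos.
  by apply: eq_integral => x _; rewrite !funeposE.
rewrite -[RHS](ge0 f^\-%E)//; last exact: measurable_funeneg.
by apply: eq_integral => x _; rewrite !funenegE.
Qed.

Lemma Rintegral_shift (h : R * R) f : measurable_fun setT f ->
  (\int[leb2 R]_x f ((x : R * R) + h) = \int[leb2 R]_x f x)%R.
Proof.
move=> mf; congr fine; apply: (@integral_shift h (EFin \o f)).
exact/measurable_EFinP.
Qed.

End plane_measure.

(** * Weak solutions, duality and energy *)

Section calculus.
Context {R : realType}.

Lemma is_deriveP (f : R -> R) (a l : R) :
  is_derive a 1 f l <->
  forall e : R, 0 < e -> exists2 d : R, 0 < d &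
    forall h : R, h != 0 -> `|h| < d -> `|h^-1 * (f (a + h) - f a) - l| <= e.
Proof.
split.
- move=> [df <-] e e0; have : h^-1 *: (f (h *: 1 + a) - f a) @[h --> 0^'] --> 'D_1 f a.
    exact: df.
  move/cvgrPdist_le => /(_ _ e0)/=; rewrite /dnbhs near_withinE near_simpl.
  move/nbhs_ballP => [d /= d0 H]; exists d => // h h0 hd.
  have := H h; rewrite /ball/= sub0r normrN => /(_ hd h0).
  by rewrite distrC /GRing.scale/= mulr1 (addrC a).
- move=> H.
  have E : h^-1 *: (f (h *: 1 + a) - f a) @[h --> 0^'] --> l.
    apply/cvgrPdist_le => e e0; have [d d0 Hd] := H e e0.
    rewrite /dnbhs near_withinE near_simpl; apply/nbhs_ballP; exists d => //= h.
    rewrite /ball/= sub0r normrN => hd h0.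
    by rewrite distrC /GRing.scale/= mulr1 (addrC h); exact: Hd.
  by apply: DeriveDef; [apply/cvg_ex; exists l|exact/cvg_lim].
Qed.

Lemma continuous_within_eps (f : R -> R) (a b : R) :
  (forall t, a <= t <= b -> forall e : R, 0 < e -> exists2 d : R, 0 < d &
    forall s, a <= s <= b -> `|s - t| < d -> `|f s - f t| <= e) ->
  {within `[a, b], continuous f}.
Proof.
move=> H; apply/subspace_continuousP => t; rewrite /= in_itv/= => tab.
apply/cvgrPdist_le => e e0; have [d d0 Hd] := H t tab e e0.
rewrite near_withinE; apply/nbhs_ballP; exists d => //= s.
rewrite /ball/= distrC => sd; rewrite in_itv/= => sab.
by rewrite distrC; exact: Hd.
Qed.

(** Continuity is asked from inside [[a, b]] only, because waves are controlled at nonnegative times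
    only. *)
Lemma derive0_cst (f : R -> R) (a b : R) : a <= b ->
  (forall t, a < t < b -> is_derive t 1 f 0) ->
  (forall t, a <= t <= b -> forall e : R, 0 < e -> exists2 d : R, 0 < d &
    forall s, a <= s <= b -> `|s - t| < d -> `|f s - f t| <= e) ->
  f b = f a.
Proof.
rewrite le_eqVlt => /predU1P[->//|ab df cf].
have df' x : x \in `]a, b[ -> is_derive x 1 f ((fun=> 0) x).
  by rewrite in_itv => /df.
have [c _] := MVT ab df' (continuous_within_eps cf).
by rewrite mul0r => /subr0_eq.
Qed.

End calculus.

(** * Differentiation in time of L2 pairings *)

Section bilinear.
Context {R : realType}.
Implicit Types (f g v : R * R -> R) (a b w : R -> R * R -> R).

(* [D] is the set of admissible times. *)
Definition contL2 (D : set R) w t := forall e : R, 0 < e -> exists2 d : R, 0 < d &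
  forall s, D s -> `|s - t| < d -> n2 (fun x => w s x - w t x) <= e.

Definition derL2 (D : set R) w v t := forall e : R, 0 < e -> exists2 d : R, 0 < d &
  forall s, D s -> s != t -> `|s - t| < d ->
    n2 (fun x => (s - t)^-1 * (w s x - w t x) - v x) <= e.

Lemma contL2_ip (D : set R) a b t : D t ->
  (forall s, D s -> L2 (a s)) -> (forall s, D s -> L2 (b s)) ->
  contL2 D a t -> contL2 D b t ->
  forall e : R, 0 < e -> exists2 d : R, 0 < d & forall s, D s -> `|s - t| < d ->
    `|ip (a s) (b s) - ip (a t) (b t)| <= e.
Proof.
move=> Dt La Lb ca cb e e0.
pose A := n2 (a t) + 1; pose B := n2 (b t) + 1.
have A0 : 0 < A by rewrite ltr_wpDl ?n2_ge0.
have B0 : 0 < B by rewrite ltr_wpDl ?n2_ge0.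
have eA : 0 < e / 2 / B by rewrite !divr_gt0.
have eB : 0 < Num.min 1 (e / 2 / A) by rewrite lt_min ltr01 !divr_gt0.
have [d1 d10 H1] := ca _ eA.
have [d2 d20 H2] := cb _ eB.
exists (Num.min d1 d2); first by rewrite lt_min d10.
move=> s Ds; rewrite lt_min => /andP[/(H1 _ Ds){}H1 /(H2 _ Ds){}H2].
have -> : ip (a s) (b s) - ip (a t) (b t) =
    ip (fun x => a s x - a t x) (b s) + ip (a t) (fun x => b s x - b t x).
  by rewrite ipBl ?ipBr; [ring|auto..].
have La' : L2 (fun x => a s x - a t x) by apply: L2B; auto.
have Lb' : L2 (fun x => b s x - b t x) by apply: L2B; auto.
have nbs : n2 (b s) <= B.
  have -> : b s = (fun x => b t x + (b s x - b t x)).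
    by apply/funext => x; ring.
  apply: (le_trans (n2_triangle _ _)); auto.
  by rewrite lerD2l (le_trans H2)// ge_min lexx.
apply: (le_trans (ler_normD _ _)).
rewrite (splitr e) lerD//.
- apply: (le_trans (ip_CS _ _)); auto.
  apply: (@le_trans _ _ (e / 2 / B * B)); last by rewrite divfK ?gt_eqF.
  by rewrite ler_pM ?n2_ge0.
- apply: (le_trans (ip_CS _ _)); auto.
  apply: (@le_trans _ _ (A * (e / 2 / A))); last by rewrite mulrC divfK ?gt_eqF.
  rewrite ler_pM ?n2_ge0//; first by rewrite lerDl.
  by rewrite (le_trans H2)// ge_min lexx orbT.
Qed.

Lemma ip_is_derive (D : set R) a b v t (l : R) : nbhs t D ->
  (forall s, D s -> L2 (a s)) -> (forall s, D s -> L2 (b s)) -> L2 v ->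
  contL2 D a t -> derL2 D b v t ->
  is_derive t 1 (fun s => ip (a s) (b t)) l ->
  is_derive t 1 (fun s => ip (a s) (b s)) (l + ip (a t) v).
Proof.
move=> tD La Lb Lv ca db /is_deriveP dl; apply/is_deriveP => e e0.
have Dt : D t by exact: nbhs_singleton.
have [r /= r0 rD] := (nbhs_ballP _ _).1 tD.
pose A := n2 (a t) + 1.
have A0 : 0 < A by rewrite ltr_wpDl ?n2_ge0.
pose V := n2 v + 1.
have V0 : 0 < V by rewrite ltr_wpDl ?n2_ge0.
have e3 : 0 < e / 3 by rewrite divr_gt0.
have [d1 d10 H1] := dl _ e3.
have eA : 0 < Num.min 1 (e / 3 / V) by rewrite lt_min ltr01 !divr_gt0.
have [d2 d20 H2] := ca _ eA.
have eB : 0 < e / 3 / A by rewrite !divr_gt0.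
have [d3 d30 H3] := db _ eB.
exists (Num.min r (Num.min d1 (Num.min d2 d3))).
  by rewrite !lt_min r0 d10 d20.
move=> h h0; rewrite !lt_min => /and4P[hr hd1 hd2 hd3].
have Ds : D (t + h) by apply: rD; rewrite /ball/= opprD addNKr normrN.
have sth : t + h - t = h by rewrite addrC addKr.
have {}H1 := H1 _ h0 hd1.
have {}H2 := H2 (t + h) Ds; rewrite sth in H2; have {}H2 := H2 hd2.
have {}H3 := H3 (t + h) Ds; rewrite sth in H3.
have {}H3 : n2 (fun x => h^-1 * (b (t + h) x - b t x) - v x) <= e / 3 / A.
  by apply: H3 => //; rewrite -subr_eq0 sth.
set s := t + h in Ds H1 H2 H3 sth *.
set q := fun x => h^-1 * (b s x - b t x) - v x.
have Lq : L2 q by apply: L2B => //; apply: L2Z; apply: L2B; auto.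
have Lq1 : L2 (fun x => b s x - b t x) by apply: L2B; auto.
have La' : L2 (fun x => a s x - a t x) by apply: L2B; auto.
have E : h^-1 * (ip (a s) (b s) - ip (a t) (b t)) - (l + ip (a t) v) =
   (h^-1 * (ip (a s) (b t) - ip (a t) (b t)) - l) +
   ip (a s) q + ip (fun x => a s x - a t x) v.
  rewrite /q (ipBr (h := a s) (f := fun x => h^-1 * (b s x - b t x)))//; auto; last by apply: L2Z.
  rewrite ipZr; auto. rewrite ipBr; auto. rewrite ipBl; auto; ring.
have nas : n2 (a s) <= A.
  have -> : a s = (fun x => a t x + (a s x - a t x)).
    by apply/funext => x; ring.
  apply: (le_trans (n2_triangle _ _)); auto.
  by rewrite lerD2l (le_trans H2)// ge_min lexx.
rewrite E.
have -> : e = e / 3 + e / 3 + e / 3 by field.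
apply: (le_trans (ler_normD _ _)); apply: lerD.
  apply: (le_trans (ler_normD _ _)); apply: lerD => //.
  apply: (le_trans (ip_CS _ _)); auto.
  apply: (@le_trans _ _ (A * (e / 3 / A))); last by rewrite mulrC divfK ?gt_eqF.
  by rewrite ler_pM ?n2_ge0.
apply: (le_trans (ip_CS _ _)); auto.
apply: (@le_trans _ _ (e / 3 / V * V)); last by rewrite divfK ?gt_eqF.
rewrite ler_pM ?n2_ge0//; first by rewrite (le_trans H2)// ge_min lexx orbT.
by rewrite lerDl.
Qed.

Lemma derL2_is_derive (D : set R) b v t g : nbhs t D ->
  (forall s, D s -> L2 (b s)) -> L2 v -> L2 g -> derL2 D b v t ->
  is_derive t 1 (fun s => ip g (b s)) (ip g v).
Proof.
move=> tD Lb Lv Lg db; rewrite -[ip g v]add0r.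
apply: (@ip_is_derive D (fun=> g) b v t 0) => //; last exact: is_derive_cst.
move=> e e0; exists 1 => // s _ _.
have -> : (fun x => g x - g x) = (fun x => 0 * g x).
  by apply/funext => x; rewrite subrr mul0r.
by rewrite n2Z// normr0 mul0r ltW.
Qed.

Section affine_time.
Variables (c k : R) (D : set R).
Hypothesis k1 : k = 1 \/ k = -1.

Let absk : `|k| = 1. Proof. by case: k1 => ->; rewrite ?normrN normr1. Qed.
Let k2 : k * k = 1. Proof. by case: k1 => ->; rewrite ?mulrNN mulr1. Qed.
Let subk (s t : R) : c + k * s - (c + k * t) = k * (s - t). Proof. by ring. Qed.

(** Slope 1 is a translation of time, needed for the energy; slope -1 is the reflection
    [s |-> T - s] of the duality. As [|k| = 1], the moduli of continuity do not change. *)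
Lemma contL2_affine w (t : R) : contL2 D w (c + k * t) ->
  contL2 [set s | D (c + k * s)] (fun s => w (c + k * s)) t.
Proof.
move=> cw e e0; have [d d0 H] := cw e e0; exists d => // s Ds st.
by apply: H => //; rewrite subk normrM absk mul1r.
Qed.

Lemma derL2_affine w v (t : R) : D (c + k * t) -> (forall s, D s -> L2 (w s)) -> L2 v ->
  derL2 D w v (c + k * t) ->
  derL2 [set s | D (c + k * s)] (fun s => w (c + k * s)) (fun x => k * v x) t.
Proof.
move=> Dt Lw Lv dw e e0; have [d d0 H] := dw e e0; exists d => // s Ds nst st.
have kst : c + k * s - (c + k * t) != 0.
  by rewrite subk -normr_gt0 normrM absk mul1r normr_gt0 subr_eq0.
have {H} := H _ Ds _ _; rewrite -(subr_eq0 (c + k * s)) => /(_ kst).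
rewrite subk normrM absk mul1r => /(_ st); apply: le_trans.
set f := (X in _ <= n2 X).
have Lf : L2 f by apply: L2B => //; apply: L2Z; apply: L2B; exact: Lw.
rewrite (_ : (fun x => _) = (fun x => k * f x)) ?n2Z ?absk ?mul1r//.
apply/funext => x; rewrite /f invfM [RHS]mulrBr; congr (_ - _).
have ki : k^-1 = k by case: k1 => ->; rewrite ?invrN ?invr1.
by rewrite ki !mulrA k2 mul1r.
Qed.

Lemma is_derive_affine (f : R -> R) (t l : R) : is_derive (c + k * t) 1 f l ->
  is_derive t 1 (fun s => f (c + k * s)) (k * l).
Proof.
move=> /is_deriveP H; apply/is_deriveP => e e0; have [d d0 Hd] := H e e0.
exists d => // h h0 hd.
have kh0 : k * h != 0 by rewrite -normr_gt0 normrM absk mul1r normr_gt0.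
have := Hd _ kh0; rewrite normrM absk mul1r => /(_ hd).
rewrite (_ : c + k * t + k * h = c + k * (t + h)); last by ring.
have ki : k^-1 = k by case: k1 => ->; rewrite ?invrN ?invr1.
apply: le_trans; rewrite -[leRHS]mul1r -absk -normrM [X in _ <= `|X|]mulrBr invfM ki.
by rewrite !mulrA k2 mul1r.
Qed.

End affine_time.

End bilinear.

(** * Duality between two waves and conservation of energy *)

Section wave.
Context {R : realType}.
Implicit Types (f g v : R * R -> R) (a b u w : R -> R * R -> R).

Definition future : set R := [set s | 0 <= s].

(** Separated from the initial data, the notion covers given solutions and test waves alike, so that
    either may take either role in the duality. Limits are restated as explicit moduli. *)
Record wave (u ut ux uy : R -> R * R -> R) : Prop := Wave {
  wave_L2 : forall t : R, 0 <= t -> L2 (u t) ;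
  wave_L2t : forall t : R, 0 <= t -> L2 (ut t) ;
  wave_L2x : forall t : R, 0 <= t -> L2 (ux t) ;
  wave_L2y : forall t : R, 0 <= t -> L2 (uy t) ;
  wave_wgrad : forall t : R, 0 <= t -> weak_grad (u t) (ux t) (uy t) ;
  wave_contL2 : forall t : R, 0 <= t -> contL2 future u t ;
  wave_contL2t : forall t : R, 0 <= t -> contL2 future ut t ;
  wave_derL2 : forall t : R, 0 <= t -> derL2 future u (ut t) t ;
  wave_weak : forall v v1 v2, L2 v -> weak_grad v v1 v2 -> forall t : R, 0 < t ->
    is_derive t 1 (fun s => ip (ut s) v) (- (ip (ux t) v1 + ip (uy t) v2)) }.

Lemma nbhs_future (t : R) : 0 < t -> nbhs t future.
Proof.
by move=> t0; near=> s; apply: ltW; near: s; exact: lt_nbhsr.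
Unshelve. all: by end_near. Qed.

Lemma continuous_L2_contL2 w (t : R) : continuous_L2 w -> 0 <= t -> contL2 future w t.
Proof.
move=> cw t0 e e0; have [Lw] := cw t t0.
have Ls s : 0 <= s -> L2 (w s) by move=> /cw[].
move=> /fine_cvgP[_] /cvgrPdist_le /(_ _ e0).
rewrite near_withinE => /nbhs_ballP[d /= d0 H].
exists d => // s s0 st; have := H s.
rewrite /ball/= distrC in_itv/= andbT => /(_ st s0).
rewrite norm2E; last by apply: L2B; exact: Ls.
by rewrite /= sub0r normrN ger0_norm ?n2_ge0.
Qed.

Lemma derivative_L2_derL2 w w' (t : R) : (forall t : R, 0 <= t -> L2 (w t)) ->
  (forall t : R, 0 <= t -> L2 (w' t)) ->
  derivative_L2 w w' -> 0 <= t -> derL2 future w (w' t) t.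
Proof.
move=> Lw Lw' dw t0 e e0; have := dw t t0.
move=> /fine_cvgP[_] /cvgrPdist_le /(_ _ e0).
rewrite near_withinE => /nbhs_ballP[d /= d0 H].
exists d => // s s0 nst st; have := H s.
rewrite /ball/= distrC in_itv/= andbT => /(_ st).
rewrite norm2E; last by apply: L2B; [apply: L2Z; apply: L2B|]; auto.
by rewrite /= sub0r normrN ger0_norm ?n2_ge0//; apply.
Qed.

Lemma wave_of_solution (u0 u1 : R * R -> R) u (ut ux uy : R -> R * R -> R) :
  wave_solution_with u0 u1 u ut ux uy -> wave u ut ux uy.
Proof.
move=> [gr cu cx cy du ct _ _ eq].
have L w t : continuous_L2 w -> 0 <= t -> L2 (w t) by move=> cw /cw[].
split; try by move=> *; auto using continuous_L2_contL2.
- by move=> t; apply: derivative_L2_derL2 => // s; exact: L.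
- move=> v v1 v2 Lv gv t t0; have := eq _ _ _ Lv gv t t0.
  rewrite /ip -RintegralD//; apply: L2_mul_integrable.
  + by apply: (L _ t cx); exact: ltW.
  + by case: gv.
  + by apply: (L _ t cy); exact: ltW.
  + by case: gv.
Qed.

Section duality.
Variables (u ut ux uy w wt wx wy : R -> R * R -> R).
Hypothesis (hu : wave u ut ux uy) (hw : wave w wt wx wy).

(** The weak equation tests [ut] against [w (d + j * t)], frozen and admissible because it has a
    weak gradient; [w] itself is differentiable in L2. Each of the two factors contributes one
    term. *)
Lemma pairing_affine (c d k j t : R) : (k = 1 \/ k = -1) -> (j = 1 \/ j = -1) ->
  0 < c + k * t -> 0 < d + j * t ->
  is_derive t 1 (fun s => ip (ut (c + k * s)) (w (d + j * s)))
    (j * ip (ut (c + k * t)) (wt (d + j * t))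
     - k * (ip (ux (c + k * t)) (wx (d + j * t)) + ip (uy (c + k * t)) (wy (d + j * t)))).
Proof.
move=> k1 j1 ct dt.
pose D := [set s | future (c + k * s)] `&` [set s | future (d + j * s)].
have nD : nbhs t D.
  apply: filterI.
    have : continuous (fun s => c + k * s).
      by move=> s; apply: cvgD; [exact: cvg_cst|exact: cvgMr cvg_id].
    by move=> /(_ t); apply; exact: nbhs_future.
  have : continuous (fun s => d + j * s).
    by move=> s; apply: cvgD; [exact: cvg_cst|exact: cvgMr cvg_id].
  by move=> /(_ t); apply; exact: nbhs_future.
have Lw := wave_L2 hw (ltW dt); have Lwt := wave_L2t hw (ltW dt).
have Lut := wave_L2t hu (ltW ct).
have [gw1 gw2 _ _] := wave_wgrad hw (ltW dt).
rewrite addrC -mulrN -(ipZr j)//.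
apply: (@ip_is_derive _ D (fun s => ut (c + k * s)) (fun s => w (d + j * s))) => //.
- by move=> s [/= cs _]; exact: (wave_L2t hu).
- by move=> s [/= _ ds]; exact: (wave_L2 hw).
- exact: L2Z.
- have := @contL2_affine _ c k future k1 _ _ (wave_contL2t hu (ltW ct)).
  move=> H e e0; have [r r0 Hr] := H e e0; exists r => // s [Ds _]; exact: Hr.
- have := @derL2_affine _ d j future j1 _ _ _ (ltW dt) (wave_L2 hw) Lwt (wave_derL2 hw (ltW dt)).
  move=> H e e0; have [r r0 Hr] := H e e0; exists r => // s [_ Ds]; exact: Hr.
- apply: (@is_derive_affine _ c k k1 (fun s => ip (ut s) (w (d + j * t)))).
  apply: (wave_weak hu) => //; exact: (wave_wgrad hw (ltW dt)).
Qed.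

Lemma pairing_cont (c d k j t : R) : (k = 1 \/ k = -1) -> (j = 1 \/ j = -1) ->
  0 <= c + k * t -> 0 <= d + j * t -> forall e : R, 0 < e -> exists2 r : R, 0 < r &
   forall s, 0 <= c + k * s -> 0 <= d + j * s -> `|s - t| < r ->
    `|ip (ut (c + k * s)) (w (d + j * s)) - ip (ut (c + k * t)) (w (d + j * t))| <= e.
Proof.
move=> k1 j1 ct dt e e0.
pose D := [set s | future (c + k * s)] `&` [set s | future (d + j * s)].
have [] := @contL2_ip _ D (fun s => ut (c + k * s)) (fun s => w (d + j * s)) t _ _ _ _ _ e e0.
- by [].
- by move=> s [/= cs _]; exact: (wave_L2t hu).
- by move=> s [/= _ ds]; exact: (wave_L2 hw).
- have := @contL2_affine _ c k future k1 _ _ (wave_contL2t hu ct).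
  move=> H e' e'0; have [r r0 Hr] := H e' e'0; exists r => // s [Ds _]; exact: Hr.
- have := @contL2_affine _ d j future j1 _ _ (wave_contL2 hw dt).
  move=> H e' e'0; have [r r0 Hr] := H e' e'0; exists r => // s [_ Ds]; exact: Hr.
by move=> r r0 H; exists r => // s cs ds; exact: H.
Qed.

End duality.

(** The clock of [w] runs backwards, so the two applications of [pairing_affine], with the roles of
    [u] and [w] exchanged, have opposite derivatives: both the gradient terms and the terms
    [(u_t, w_t)] cancel. *)
Lemma duality (u ut ux uy w wt wx wy : R -> R * R -> R) (T t : R) :
  wave u ut ux uy -> wave w wt wx wy -> 0 <= t <= T ->
  ip (ut t) (w (T - t)) + ip (u t) (wt (T - t)) = ip (ut 0) (w T) + ip (u 0) (wt T).
Proof.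
move=> hu hw /andP[t0 tT].
pose e (s : R) := ip (ut (0 + 1 * s)) (w (T + -1 * s)) + ip (wt (T + -1 * s)) (u (0 + 1 * s)).
have p1 : (1 : R) = 1 \/ (1 : R) = -1 by left.
have m1 : (-1 : R) = 1 \/ (-1 : R) = -1 by right.
suff : e t = e 0.
  by rewrite /e mulr0 addr0 !mul1r !add0r mulr0 addr0 mulN1r !(ipC (wt _)).
apply: derive0_cst => //.
- move=> s /andP[s0 st].
  have s0' : 0 < 0 + 1 * s by rewrite add0r mul1r.
  have sT : 0 < T + -1 * s by rewrite mulN1r subr_gt0 (lt_le_trans st).
  have D := is_deriveD (pairing_affine hu hw p1 m1 s0' sT) (pairing_affine hw hu m1 p1 sT s0').
  rewrite (ipC (wt _) (ut _)) (ipC (wx _)) (ipC (wy _)) in D.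
  rewrite [X in is_derive _ _ _ X](_ : _ = 0) in D => //.
  by move: (ip (ut _) (wt _)) (ip (ux _) _) (ip (uy _) _) => A B C; rewrite mulN1r !mul1r mulN1r opprK; ring.
- move=> s /andP[s0 st] eps eps0.
  have s0' : 0 <= 0 + 1 * s by rewrite add0r mul1r.
  have sT : 0 <= T + -1 * s by rewrite mulN1r subr_ge0 (le_trans st).
  have e2 : 0 < eps / 2 by rewrite divr_gt0.
  have [r1 r10 H1] := pairing_cont hu hw p1 m1 s0' sT e2.
  have [r2 r20 H2] := pairing_cont hw hu m1 p1 sT s0' e2.
  exists (Num.min r1 r2); first by rewrite lt_min r10.
  move=> x /andP[x0 xt]; rewrite lt_min => /andP[xs1 xs2].
  have x0' : 0 <= 0 + 1 * x by rewrite add0r mul1r.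
  have xT : 0 <= T + -1 * x by rewrite mulN1r subr_ge0 (le_trans xt).
  rewrite /e opprD addrACA (splitr eps) (le_trans (ler_normD _ _))// lerD//.
    exact: H1.
  exact: H2.
Qed.

Lemma pairing_is_derive (u ut ux uy w wt wx wy : R -> R * R -> R) (t : R) :
  wave u ut ux uy -> wave w wt wx wy -> 0 < t ->
  is_derive t 1 (fun s => ip (u s) (w s))
    (ip (ut 0) (w (2 * t)) + ip (u 0) (wt (2 * t))).
Proof.
move=> hu hw t0; have tf := nbhs_future t0; have t0' := ltW t0.
rewrite -(@duality _ _ _ _ _ _ _ _ _ t hu hw); last by apply/andP; split => //; lra.
rewrite (_ : 2 * t - t = t); last by ring.
apply: (@ip_is_derive _ future) => //.
- exact: wave_L2 hu.
- exact: wave_L2 hw.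
- exact: (wave_L2t hw).
- exact: (wave_contL2 hu).
- exact: (wave_derL2 hw).
- rewrite ipC (_ : (fun s => _) = (fun s => ip (w t) (u s))).
    apply: (@derL2_is_derive _ future) => //.
    + exact: wave_L2 hu.
    + exact: (wave_L2t hu).
    + exact: (wave_L2 hw).
    + exact: (wave_derL2 hu).
  by apply/funext => s; rewrite ipC.
Qed.

(** [(u_t, u_t)] cannot be differentiated, but the antisymmetric form
    [M s p = (u_t(s), u(p)) - (u_t(p), u(s))] is invariant under a common translation of both times,
    and its derivative in [s] on the diagonal is minus the energy. Comparing the derivatives at
    [(p, p)] and [(q, q)] gives the conservation. *)
Lemma energy (u ut ux uy : R -> R * R -> R) (p q : R) : wave u ut ux uy -> 0 < p -> 0 < q ->
  ip (ut p) (ut p) + (ip (ux p) (ux p) + ip (uy p) (uy p)) =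
  ip (ut q) (ut q) + (ip (ux q) (ux q) + ip (uy q) (uy q)).
Proof.
move=> hu; wlog : p q / p <= q.
  move=> H p0 q0; have [|/ltW] := leP p q; first by move=> ?; exact: H.
  by move=> ?; apply/esym; exact: H.
move=> pq p0 q0.
have p1 : (1 : R) = 1 \/ (1 : R) = -1 by left.
pose M (s p : R) := ip (ut s) (u p) - ip (ut p) (u s).
have Mshift (s r : R) : 0 <= s -> 0 <= r -> M (s + (q - p)) (r + (q - p)) = M s r.
  move=> s0 r0.
  have qp0 : 0 <= q - p by rewrite subr_ge0.
  suff : M (s + 1 * (q - p)) (r + 1 * (q - p)) = M (s + 1 * 0) (r + 1 * 0).
    by rewrite !mul1r !addr0.
  apply: (@derive0_cst _ (fun x => M (s + 1 * x) (r + 1 * x))) => //.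
  - move=> x /andP[x0 xqp].
    have s0' : 0 < s + 1 * x by rewrite mul1r ltr_wpDl.
    have r0' : 0 < r + 1 * x by rewrite mul1r ltr_wpDl.
    have := is_deriveB (pairing_affine hu hu p1 p1 s0' r0') (pairing_affine hu hu p1 p1 r0' s0').
    rewrite /M (ipC (ut (r + _)) (ut _)) (ipC (ux (r + _))) (ipC (uy (r + _))).
    by rewrite subrr.
  - move=> x /andP[x0 xqp] eps eps0.
    have s0' : 0 <= s + 1 * x by rewrite mul1r addr_ge0.
    have r0' : 0 <= r + 1 * x by rewrite mul1r addr_ge0.
    have e2 : 0 < eps / 2 by rewrite divr_gt0.
    have [r1 r10 H1] := pairing_cont hu hu p1 p1 s0' r0' e2.
    have [r2 r20 H2] := pairing_cont hu hu p1 p1 r0' s0' e2.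
    exists (Num.min r1 r2); first by rewrite lt_min r10.
    move=> y /andP[y0 yt]; rewrite lt_min => /andP[ys1 ys2].
    have s0y : 0 <= s + 1 * y by rewrite mul1r addr_ge0.
    have r0y : 0 <= r + 1 * y by rewrite mul1r addr_ge0.
    have {}H1 := H1 y s0y r0y ys1; have {}H2 := H2 y r0y s0y ys2.
    rewrite (_ : M _ _ - M _ _ = (ip (ut (s + 1 * y)) (u (r + 1 * y)) -
        ip (ut (s + 1 * x)) (u (r + 1 * x))) - (ip (ut (r + 1 * y)) (u (s + 1 * y)) -
        ip (ut (r + 1 * x)) (u (s + 1 * x)))); last by rewrite /M; ring.
    by rewrite (splitr eps) (le_trans (ler_normB _ _))// lerD.
pose E (t : R) := ip (ut t) (ut t) + (ip (ux t) (ux t) + ip (uy t) (uy t)).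
have dM (t : R) : 0 < t -> is_derive t 1 (fun s => M s t) (- E t).
  move=> t0; have t0' := ltW t0.
  have := is_deriveB (wave_weak hu (wave_L2 hu t0') (wave_wgrad hu t0') t0)
    (@derL2_is_derive _ future u _ _ (ut t) (nbhs_future t0) (wave_L2 hu)
      (wave_L2t hu t0') (wave_L2t hu t0') (wave_derL2 hu t0')).
  by rewrite -opprD [_ + ip (ut t) _]addrC.
apply: oppr_inj; rewrite -/(E p) -/(E q).
have d1 := dM _ p0; have d2 := dM _ q0.
have d3 : is_derive p 1 (fun s => M ((q - p) + 1 * s) q) (- E q).
  rewrite -[- E q]mul1r; apply: (@is_derive_affine _ (q - p) 1 p1 (fun s => M s q)).
  by rewrite mul1r subrK.
rewrite -(@derive_val _ _ _ _ _ _ _ d1) -(@derive_val _ _ _ _ _ _ _ d3).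
apply: near_eq_derive; near=> s.
have s0 : 0 <= s by near: s; exact: nbhs_future.
by have := Mshift s p s0 (ltW p0); rewrite (addrC p) subrK (addrC s) mul1r => ->.
Unshelve. all: by end_near. Qed.

End wave.

(** * Smooth bumps *)

Section smooth1.
Context {R : realType}.
Implicit Types (f g : R -> R).

(** Derivatives are exhibited rather than computed, so that closure under products, inverses and
    affine substitutions is a plain induction. *)
Fixpoint Dk (n : nat) f : Prop := if n is n'.+1 then
  exists2 f', (forall x, is_derive x (1 : R) f (f' x)) & Dk n' f' else True.

Lemma Dk_ext n f g : f =1 g -> Dk n f -> Dk n g.
Proof. by move=> /funext ->. Qed.

Lemma DkW n f : Dk n.+1 f -> Dk n f.
Proof.
by elim: n f => // n IH f [f' df Df']; exists f' => //; exact: IH.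
Qed.

Lemma Dk_cst n (c : R) : Dk n (fun=> c).
Proof.
by elim: n c => // n IH c; exists (fun=> 0) => // x; exact: is_derive_cst.
Qed.

Lemma DkD n f g : Dk n f -> Dk n g -> Dk n (fun x => f x + g x).
Proof.
elim: n f g => // n IH f g [f' df Df] [g' dg Dg].
exists (fun x => f' x + g' x); last exact: IH.
by move=> x; exact: is_deriveD.
Qed.

Lemma DkM n f g : Dk n f -> Dk n g -> Dk n (fun x => f x * g x).
Proof.
elim: n f g => // n IH f g [f' df Df] [g' dg Dg].
exists (fun x => f x * g' x + g x * f' x); last first.
  apply: DkD; apply: IH => //; apply: DkW.
    by exists f'.
  by exists g'.
by move=> x; exact: is_deriveM.
Qed.

Lemma DkZ n c f : Dk n f -> Dk n (fun x => c * f x).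
Proof. by move=> Df; apply: DkM => //; exact: Dk_cst. Qed.

Lemma DkV n f : (forall x, f x != 0) -> Dk n f -> Dk n (fun x => (f x)^-1).
Proof.
move=> f0; elim: n f f0 => // n IH f f0 [f' df Df].
exists (fun x => - (f x)^-2 * f' x).
  move=> x; apply: is_deriveV => //; exact: df.
have -> : (fun x => - (f x)^-2 * f' x) =
    (fun x => -1 * ((f x)^-1 * (f x)^-1 * f' x)).
  by apply/funext => x; rewrite -invfM -expr2 mulN1r mulNr.
have DV : Dk n (fun x => (f x)^-1).
  by apply: IH => //; apply: DkW; exists f'.
by apply: DkZ; apply: DkM => //; exact: DkM.
Qed.

Lemma Dk_affine n f (c k : R) : Dk n f -> Dk n (fun x => f (c + k * x)).
Proof.
elim: n f => // n IH f [f' df Df].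
exists (fun x => k * f' (c + k * x)); last by apply: DkZ; exact: IH.
move=> x; have d1 : is_derive x (1 : R) (fun x => c + k * x) k.
  rewrite -[X in is_derive _ _ _ X]add0r; apply: is_deriveD.
  by rewrite -[X in is_derive _ _ _ X]mulr1; apply: is_deriveZ.
have := @is_derive1_comp _ f (fun x => c + k * x) x _ _ (df _) d1.
by rewrite mulrC.
Qed.

Definition smooth f := forall n, Dk n f.

Lemma smooth_is_derive f x : smooth f -> is_derive x (1 : R) f (derive1 f x).
Proof.
move=> /(_ 1%N)[f' df _]; rewrite derive1E.
by have := df x => /@derive_val ->.
Qed.

Lemma smooth_derive1 f : smooth f -> smooth (derive1 f).
Proof.
move=> sf n; have [f' df] := sf n.+1; apply: Dk_ext => x.
by rewrite derive1E; have := df x => /@derive_val ->.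
Qed.

Lemma smooth_derive1n f n : smooth f -> smooth (derive1n n f).
Proof.
by elim: n => [//|n IH] sf; rewrite derive1nS; exact: smooth_derive1 (IH sf).
Qed.

Lemma smooth_continuous f : smooth f -> continuous f.
Proof.
by move=> sf x; apply/differentiable_continuous/derivable1_diffP;
  have [] := smooth_is_derive x sf.
Qed.

(** The inequality [y / n <= expR (y / n)] raised to the power [n]; for [n = 0] the constant is
    [0 ^+ 0 = 1]. *)
Lemma expR_ge_exprn (n : nat) (y : R) : 0 <= y -> y ^+ n <= n%:R ^+ n * expR y.
Proof.
case: n => [y0|n y0]; first by rewrite !expr0 mul1r -expR0 ler_expR.
have n0 : (0 : R) < n.+1%:R by [].
have -> : expR y = expR (y / n.+1%:R) ^+ n.+1.
  by rewrite -expRM_natl mulrC divfK ?gt_eqF.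
rewrite -exprMn; apply: lerXn2r; first by rewrite nnegrE.
  by rewrite nnegrE mulr_ge0// expR_ge0.
rewrite -ler_pdivrMl// mulrC; apply: le_trans (expR_ge1Dx _).
by rewrite lerDr.
Qed.

(** The classical flat function is the case [k = 0]; the powers of [x^-1] make the family stable
    under differentiation. *)
Definition expinv (k : nat) (x : R) := if 0 < x then x^-1 ^+ k * expR (- x^-1) else 0.

Lemma expinv_is_derive k x :
  is_derive x (1 : R) (expinv k) (- k%:R * expinv k.+1 x + expinv k.+2 x).
Proof.
have [x0|x0|->] := ltgtP x 0.
- rewrite /expinv ltNge (ltW x0)/= mulr0 addr0.
  apply: (@near_eq_is_derive _ _ _ (fun=> 0)).
  by near=> y; rewrite ltNge ifF// ltW//; near: y; exact: lt_nbhsl.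
- suff H : is_derive x (1 : R) (fun x : R => x^-1 ^+ k * expR (- x^-1) : R)
      (- k%:R * expinv k.+1 x + expinv k.+2 x).
    apply: near_eq_is_derive H; near=> y.
    by rewrite /expinv ifT//; near: y; exact: lt_nbhsr.
  rewrite /expinv x0.
  have dV : is_derive x (1 : R) (fun y : R => y^-1 : R) (- x^-2).
    have := @is_deriveV R id x 1 1; rewrite /GRing.scale/= mulr1; apply => //.
    by rewrite gt_eqF.
  have dE : is_derive x (1 : R) (fun y : R => expR (- y^-1) : R) (expR (- x^-1) * x^-2).
    apply: (@is_derive1_comp _ expR (fun y : R => - y^-1)).
    by rewrite -[X in is_derive _ _ _ X]opprK; exact: is_deriveN.
  have dX := is_deriveX k dV.
  have := is_deriveM dX dE.
  rewrite (_ : (_ ^+ _ * _)%R = (fun y : R => y^-1 ^+ k * expR (- y^-1) : R)); last first.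
    by apply/funext => y; rewrite [LHS]/GRing.mul/= exprfctE.
  rewrite (_ : _ + _ = - k%:R * (x^-1 ^+ k.+1 * expR (- x^-1)) +
    x^-1 ^+ k.+2 * expR (- x^-1))//.
  rewrite exprfctE /GRing.scale/=.
  by case: (k) => [|m]; rewrite -exprVn ?exprS/=; ring.
- rewrite /expinv ltxx mulr0 addr0; apply/is_deriveP => e e0.
  (* With [y = h^-1], the bound [y ^+ k.+2 <= C * expR y] makes the difference quotient
     [y ^+ k.+1 * expR (- y)] at most [C * h]. *)
  pose C : R := k.+2%:R ^+ k.+2.
  have C0 : 0 < C by rewrite exprn_gt0.
  exists (e / C); first by rewrite divr_gt0.
  move=> h h0 hd; rewrite add0r !subr0.
  have [hneg|hpos|h00] := ltgtP h 0; last by rewrite h00 eqxx in h0.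
    by rewrite ltxx subr0 mulr0 normr0 ltW.
  rewrite ltxx subr0; set y := h^-1.
  have y0 : 0 < y by rewrite invr_gt0.
  rewrite ger0_norm; last first.
    by rewrite mulr_ge0 ?(ltW y0)// mulr_ge0 ?expR_ge0// exprn_ge0// ltW.
  rewrite mulrA -exprS expRN ler_pdivrMr ?expR_gt0//.
  rewrite -(ler_pM2l y0) -exprS.
  apply: (le_trans (expR_ge_exprn _ (ltW y0))).
  rewrite mulrA ler_pM2r ?expR_gt0// -/C -ler_pdivrMr//.
  have hC : C / e <= y.
    rewrite /y -(invf_div e C) lef_pV2 ?posrE ?divr_gt0//.
    by rewrite ltW// (le_lt_trans _ hd)// ler_norm.
  by [].
Unshelve. all: by end_near. Qed.

Lemma expinv_smooth k : smooth (expinv k).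
Proof.
move=> n; elim: n k => // n IH k.
exists (fun x => - k%:R * expinv k.+1 x + expinv k.+2 x).
  by move=> x; exact: expinv_is_derive.
by apply: DkD => //; exact: DkZ.
Qed.

Lemma expinv_ge0 k x : 0 <= expinv k x.
Proof.
rewrite /expinv; case: ifP => // x0.
by rewrite mulr_ge0 ?expR_ge0// exprn_ge0// invr_ge0 ltW.
Qed.

Lemma expinv0_gt0 x : 0 < x -> 0 < expinv 0 x.
Proof. by rewrite /expinv => ->; rewrite expr0 mul1r expR_gt0. Qed.

Lemma expinv0_le1 x : expinv 0 x <= 1.
Proof.
rewrite /expinv; case: ifP => // x0.
by rewrite expr0 mul1r -expR0 ler_expR oppr_le0 invr_ge0 ltW.
Qed.

Lemma expinv_le0 k x : x <= 0 -> expinv k x = 0.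
Proof. by rewrite /expinv ltNge => ->. Qed.

Lemma expinv0_nd x y : x <= y -> expinv 0 x <= expinv 0 y.
Proof.
move=> xy; have [x0|x0] := leP x 0; first by rewrite expinv_le0// expinv_ge0.
have y0 : 0 < y by exact: lt_le_trans xy.
by rewrite /expinv x0 y0 !expr0 !mul1r ler_expR lerN2 lef_pV2.
Qed.

(** A smooth transition from 0 on the left of -1 to 1 on the right of 1; at every point one of the
    two terms of the denominator is positive. *)
Definition step (x : R) : R := expinv 0 (1 + x) / (expinv 0 (1 + x) + expinv 0 (1 - x)).

Let step_den x : 0 < expinv 0 (1 + x) + expinv 0 (1 - x).
Proof.
have [x0|x0] := leP x 0.
  by rewrite ltr_wpDl ?expinv_ge0// expinv0_gt0//; lra.
by rewrite ltr_pwDl ?expinv_ge0// expinv0_gt0//; lra.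
Qed.

Lemma step_smooth : smooth step.
Proof.
move=> n; have D1 : Dk n (fun x => expinv 0 (1 + x)).
  have := @Dk_affine n _ 1 1 (expinv_smooth 0 n).
  by apply: Dk_ext => x; rewrite mul1r.
apply: DkM => //; apply: DkV => [x|]; first by rewrite gt_eqF.
apply: DkD => //; have := @Dk_affine n _ 1 (-1) (expinv_smooth 0 n).
by apply: Dk_ext => x; rewrite mulN1r.
Qed.

Lemma step_le0 x : x <= -1 -> step x = 0.
Proof. by move=> x1; rewrite /step expinv_le0 ?mul0r//; lra. Qed.

Lemma step_ge1 x : 1 <= x -> step x = 1.
Proof.
move=> x1; rewrite /step (@expinv_le0 _ (1 - x)) ?addr0 ?divff//; last by lra.
by rewrite gt_eqF// expinv0_gt0//; lra.
Qed.

Lemma step_ge0 x : 0 <= step x.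
Proof. by rewrite divr_ge0 ?expinv_ge0// ltW. Qed.

Lemma step_le1 x : step x <= 1.
Proof. by rewrite ler_pdivrMr// mul1r lerDl expinv_ge0. Qed.

Lemma step_nd x y : x <= y -> step x <= step y.
Proof.
move=> xy; rewrite /step ler_pdivrMr// mulrAC ler_pdivlMr//.
have : expinv 0 (1 + x) * expinv 0 (1 - y) <= expinv 0 (1 + y) * expinv 0 (1 - x).
  by rewrite ler_pM ?expinv_ge0//; apply: expinv0_nd; lra.
lra.
Qed.

(** The index is shifted by one: [bump 0] is a nonnegative bump of mass 1 whose primitive is [step].
    Having the primitive at hand is what makes the time integral of the test wave explicit. *)
Definition bump (n : nat) : R -> R := derive1n n.+1 step.

Lemma bump_is_derive n x : is_derive x (1 : R) (bump n) (bump n.+1 x).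
Proof.
by have := smooth_is_derive x (smooth_derive1n n.+1 step_smooth); rewrite -derive1nS.
Qed.

Lemma step_is_derive x : is_derive x (1 : R) step (bump 0 x).
Proof. exact: smooth_is_derive step_smooth. Qed.

Lemma bump_continuous n : continuous (bump n).
Proof. by apply/smooth_continuous/smooth_derive1n/step_smooth. Qed.

Lemma derive1_near0 (f : R -> R) (x : R) : (\forall y \near x, f y = 0) ->
  \forall y \near x, derive1 f y = 0.
Proof.
move=> /near_join f0; near=> y; rewrite derive1E.
by rewrite (@near_eq_derive _ _ _ _ (fun=> 0)) ?derive_cst//; near: y.
Unshelve. all: by end_near. Qed.

Lemma bump_out n (x : R) : 1 < `|x| -> bump n x = 0.
Proof.
move=> x1.
have : \forall y \near x, bump n y = 0; last exact: nbhs_singleton.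
rewrite /bump; elim: n => [|n IH]; last by rewrite derive1nS; exact: derive1_near0.
have [c] : exists c, \forall y \near x, step y = c.
  move: x1; rewrite lter_normr => /orP[x1|x1].
    exists 1; near=> y; apply: step_ge1; apply: ltW; near: y; exact: lt_nbhsr.
  exists 0; near=> y; apply: step_le0; apply: ltW; near: y; apply: lt_nbhsl; lra.
move=> /near_join sc; near=> y; rewrite derive1n1 derive1E.
by rewrite (@near_eq_derive _ _ _ _ (fun=> c)) ?derive_cst//; near: y.
Unshelve. all: by end_near. Qed.

Lemma bump_bounded n : exists2 C : R, 0 < C & forall x, `|bump n x| <= C.
Proof.
have cf : {within `[-1, 1], continuous (fun x : R => `|bump n x|)}.
  apply: continuous_subspaceT => x; apply: continuous_comp; first exact: bump_continuous.
  exact: norm_continuous.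
have N11 : (-1 : R) <= 1 by lra.
have [c _ Hc] := EVT_max N11 cf.
exists (`|bump n c| + 1) => [|x]; first by rewrite ltr_wpDl.
have [x1|x1] := leP `|x| 1; last by rewrite bump_out// normr0 addr_ge0.
rewrite (@le_trans _ _ `|bump n c|) ?lerDl// Hc//.
by rewrite in_itv/=; move: x1; rewrite ler_norml.
Qed.

Lemma bump0_ge0 x : 0 <= bump 0 x.
Proof.
rewrite leNgt; apply/negP => b0.
have e0 : 0 < - bump 0 x / 2 by lra.
have /is_deriveP /(_ _ e0) [d d0 H] := step_is_derive x.
have h0 : 0 < d / 2 by rewrite divr_gt0.
have := H (d / 2); rewrite gt_eqF// ger0_norm ?(ltW h0)// => /(_ isT) => E.
have {E} := E (ltac:(lra)); rewrite ler_norml => /andP[_].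
have : 0 <= (d / 2)^-1 * (step (x + d / 2) - step x).
  by rewrite mulr_ge0 ?invr_ge0 ?(ltW h0)// subr_ge0 step_nd// lerDl ltW.
lra.
Qed.

Lemma bump0_gt0 : exists2 x : R, -1 < x < 1 & 0 < bump 0 x.
Proof.
have N11 : (-1 : R) < 1 by lra.
have [||c] := @MVT _ step (bump 0) (-1) 1 N11.
- by move=> x _; exact: step_is_derive.
- exact/continuous_subspaceT/smooth_continuous/step_smooth.
rewrite in_itv/= step_ge1// step_le0// => c1 E; exists c => //.
have : 0 < bump 0 c * (1 - -1) by rewrite -E; lra.
lra.
Qed.

End smooth1.

(** * Functions of class C^k on the plane *)

Section partial_derivatives.
Context {R : realType}.
Implicit Types (f g : R * R -> R) (x h : R * R).

Lemma add_e1 (r : R) x : r *: e1 + x = (r *: (1 : R) + x.1, x.2).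
Proof. by apply: injective_projections => //=; rewrite scaler0 add0r. Qed.

Lemma add_e2 (r : R) x : r *: e2 + x = (x.1, r *: (1 : R) + x.2).
Proof. by apply: injective_projections => //=; rewrite scaler0 add0r. Qed.

Lemma is_derive_e1 f x l :
  is_derive (x.1) (1 : R) (fun a => f (a, x.2)) l -> is_derive x e1 f l.
Proof.
have E : (fun h : R => h^-1 *: (f (h *: e1 + x) - f x)) =
    (fun h : R => h^-1 *: (f (h *: (1 : R) + x.1, x.2) - f (x.1, x.2))).
  by apply/funext => h; rewrite add_e1; case: x.
move=> [d1 <-]; apply: DeriveDef; first by rewrite /derivable E.
by rewrite /derive E.
Qed.

Lemma is_derive_e2 f x l :
  is_derive (x.2) (1 : R) (fun b => f (x.1, b)) l -> is_derive x e2 f l.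
Proof.
have E : (fun h : R => h^-1 *: (f (h *: e2 + x) - f x)) =
    (fun h : R => h^-1 *: (f (x.1, h *: (1 : R) + x.2) - f (x.1, x.2))).
  by apply/funext => h; rewrite add_e2; case: x.
move=> [d1 <-]; apply: DeriveDef; first by rewrite /derivable E.
by rewrite /derive E.
Qed.

Lemma is_derive_slice1 f (a b l : R) : is_derive (a, b) e1 f l ->
  is_derive a (1 : R) (fun a => f (a, b)) l.
Proof.
have E : (fun h : R => h^-1 *: (f (h *: e1 + (a, b)) - f (a, b))) =
    (fun h : R => h^-1 *: (f (h *: (1 : R) + a, b) - f (a, b))).
  by apply/funext => h; rewrite add_e1.
move=> [d1 <-]; apply: DeriveDef; first by move: d1; rewrite /derivable E.
by rewrite /derive E.
Qed.

Lemma is_derive_slice2 f (a b l : R) : is_derive (a, b) e2 f l ->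
  is_derive b (1 : R) (fun b => f (a, b)) l.
Proof.
have E : (fun h : R => h^-1 *: (f (h *: e2 + (a, b)) - f (a, b))) =
    (fun h : R => h^-1 *: (f (a, h *: (1 : R) + b) - f (a, b))).
  by apply/funext => h; rewrite add_e2.
move=> [d1 <-]; apply: DeriveDef; first by move: d1; rewrite /derivable E.
by rewrite /derive E.
Qed.

Lemma CkS k f f1 f2 : continuous f ->
  (forall x, is_derive x e1 f (f1 x)) -> (forall x, is_derive x e2 f (f2 x)) ->
  Ck k f1 -> Ck k f2 -> Ck k.+1 f.
Proof.
move=> cf d1 d2 c1 c2; split => //.
have -> : 'D_e1 f = f1 by apply/funext => x; have := d1 x => /@derive_val.
have -> : 'D_e2 f = f2 by apply/funext => x; have := d2 x => /@derive_val.
by split => // x; have [? _] := d1 x; have [? _] := d2 x.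
Qed.

Lemma Ck_continuous k f : Ck k f -> continuous f.
Proof. by case: k => [|k] []. Qed.

Lemma Ck_inv k f : Ck k.+1 f -> [/\ (forall x, is_derive x e1 f ('D_e1 f x)),
  (forall x, is_derive x e2 f ('D_e2 f x)), Ck k ('D_e1 f) & Ck k ('D_e2 f)].
Proof. by move=> [_ [d1 d2 c1 c2]]; split => // x; exact/derivableP. Qed.

Lemma CkW k f : Ck k.+1 f -> Ck k f.
Proof.
elim: k f => [f [cf _]|k IH f Cf]; first by split.
have [d1 d2 c1 c2] := Ck_inv Cf.
by apply: (CkS (Ck_continuous Cf) d1 d2); exact: IH.
Qed.

Lemma Ck_cst k (c : R) : Ck k (fun=> c : R).
Proof.
elim: k c => [|k IH] c; first by split => //; exact: cst_continuous.
by apply: (@CkS _ _ (fun=> 0) (fun=> 0)) => //; exact: cst_continuous.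
Qed.

Lemma CkD k f g : Ck k f -> Ck k g -> Ck k (fun x => f x + g x).
Proof.
elim: k f g => [|k IH] f g Cf Cg.
  by split => // x; apply: cvgD; [exact: (Ck_continuous Cf)|exact: (Ck_continuous Cg)].
have [df1 df2 cf1 cf2] := Ck_inv Cf; have [dg1 dg2 cg1 cg2] := Ck_inv Cg.
apply: (@CkS _ _ (fun x => 'D_e1 f x + 'D_e1 g x) (fun x => 'D_e2 f x + 'D_e2 g x)).
- by move=> x; apply: cvgD; [exact: (Ck_continuous Cf)|exact: (Ck_continuous Cg)].
- exact: IH.
- exact: IH.
Qed.

Lemma CkM k f g : Ck k f -> Ck k g -> Ck k (fun x => f x * g x).
Proof.
elim: k f g => [|k IH] f g Cf Cg.
  by split => // x; apply: cvgM; [exact: (Ck_continuous Cf)|exact: (Ck_continuous Cg)].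
have [df1 df2 cf1 cf2] := Ck_inv Cf; have [dg1 dg2 cg1 cg2] := Ck_inv Cg.
apply: (@CkS _ _ (fun x => f x * 'D_e1 g x + g x * 'D_e1 f x)
  (fun x => f x * 'D_e2 g x + g x * 'D_e2 f x)).
- by move=> x; apply: cvgM; [exact: (Ck_continuous Cf)|exact: (Ck_continuous Cg)].
- by apply: CkD; apply: IH => //; exact: CkW.
- by apply: CkD; apply: IH => //; exact: CkW.
Qed.

Lemma CkZ k (c : R) f : Ck k f -> Ck k (fun x => c * f x).
Proof. by apply: CkM; exact: Ck_cst. Qed.

Lemma Ck_shift k f h : Ck k f -> Ck k (fun x => f (x + h)).
Proof.
have csh : continuous (fun x => x + h).
  by move=> x; apply: cvgD; [exact: cvg_id|exact: cvg_cst].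
elim: k f => [|k IH] f Cf.
  by split => // x; apply: continuous_comp (csh x) _; exact: Ck_continuous Cf _.
have [d1 d2 c1 c2] := Ck_inv Cf.
have dsh (e x : R * R) l : is_derive (x + h) e f l -> is_derive x e (fun x => f (x + h)) l.
  have E : (fun r : R => r^-1 *: (f (r *: e + (x + h)) - f (x + h))) =
      (fun r : R => r^-1 *: (f (r *: e + x + h) - f (x + h))).
    by apply/funext => r; rewrite addrA.
  move=> [dx <-]; apply: DeriveDef; first by move: dx; rewrite /derivable E.
  by rewrite /derive E.
apply: (@CkS _ _ (fun x => 'D_e1 f (x + h)) (fun x => 'D_e2 f (x + h))).
- by move=> x; apply: continuous_comp (csh x) _; exact: Ck_continuous Cf _.
- exact: (IH _ c1).
- exact: (IH _ c2).
Qed.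

Lemma Ck_fst k (g : R -> R) : Dk k.+1 g -> Ck k (fun x => g x.1).
Proof.
have cg (g' : R -> R) : Dk 1 g' -> continuous (fun x : R * R => g' x.1).
  move=> [g1 dg1 _] x; apply: continuous_comp; first exact: cvg_fst.
  by apply/differentiable_continuous/derivable1_diffP; have [] := dg1 x.1.
elim: k g => [|k IH] g Dg; first by split => //; exact: cg.
have [g1 dg1 Dg1] := Dg.
apply: (@CkS _ _ (fun x => g1 x.1) (fun=> 0)).
- by apply: cg; exists g1.
- by move=> x; apply: is_derive_e1; exact: dg1.
- by move=> x; apply: is_derive_e2 => /=; exact: is_derive_cst.
- exact: IH.
- exact: Ck_cst.
Qed.

Lemma Ck_snd k (g : R -> R) : Dk k.+1 g -> Ck k (fun x => g x.2).
Proof.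
have cg (g' : R -> R) : Dk 1 g' -> continuous (fun x : R * R => g' x.2).
  move=> [g1 dg1 _] x; apply: continuous_comp; first exact: cvg_snd.
  by apply/differentiable_continuous/derivable1_diffP; have [] := dg1 x.2.
elim: k g => [|k IH] g Dg; first by split => //; exact: cg.
have [g1 dg1 Dg1] := Dg.
apply: (@CkS _ _ (fun=> 0) (fun x => g1 x.2)).
- by apply: cg; exists g1.
- by move=> x; apply: is_derive_e1 => /=; exact: is_derive_cst.
- by move=> x; apply: is_derive_e2; exact: dg1.
- exact: Ck_cst.
- exact: IH.
Qed.

Lemma abs1_le_euclid x : `|x.1| <= euclid x.
Proof. by rewrite /euclid -sqrtr_sqr ler_wsqrtr// lerDl sqr_ge0. Qed.

Lemma abs2_le_euclid x : `|x.2| <= euclid x.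
Proof. by rewrite /euclid -sqrtr_sqr ler_wsqrtr// lerDr sqr_ge0. Qed.

Lemma euclid_le x : euclid x <= `|x.1| + `|x.2|.
Proof.
rewrite /euclid -[leRHS]ger0_norm ?addr_ge0// -sqrtr_sqr ler_wsqrtr//.
rewrite sqrrD -!normrX !(ger0_norm (sqr_ge0 _)) lerD2r lerDl.
by rewrite mulrn_wge0// mulr_ge0.
Qed.

End partial_derivatives.

(** * Bounded functions supported in a square *)

Section boxed.
Context {R : realType}.
Implicit Types (f g : R * R -> R) (x h : R * R).

Definition box (B : R) : set (R * R) := `[- B, B]%classic `*` `[- B, B]%classic.

Lemma measurable_box B : @measurable _ (measurableTypeR R * measurableTypeR R)%type (box B).
Proof. by apply: measurableX; exact: measurable_itv. Qed.

Lemma leb2_box B : 0 <= B -> leb2 R (box B) = ((2 * B) ^+ 2)%:E.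
Proof.
move=> B0; have E : lebesgue_measure (`[- B, B]%classic : set R) = (2 * B)%:E.
  rewrite lebesgue_measure_itv/= lte_fin.
  have [|BB] := ltP (- B) B; first by rewrite -EFinB => _; congr (_%:E); ring.
  by congr (_%:E); lra.
rewrite product_measure1E; [|exact: measurable_itv..].
by rewrite expr2 EFinM; congr (_ * _)%E.
Qed.

Definition boxed f (M B : R) := [/\ measurable_fun setT f, 0 <= B,
  forall x, `|f x| <= M & forall x, ~ box B x -> f x = 0].

Lemma boxed_restrict f M B : boxed f M B -> f = f \_ (box B).
Proof.
move=> [_ _ _ fB]; apply/funext => x; rewrite patchE.
by case: ifPn => // /negP xB; apply: fB => /mem_set.
Qed.

Lemma boxed_integrable_in f M B : boxed f M B ->
  (leb2 R).-integrable (box B) (EFin \o f).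
Proof.
move=> [mf B0 fM fB].
apply: measurable_bounded_integrable.
- exact: measurable_box.
- by rewrite [X in (X < _)%E]leb2_box// ltry.
- exact: measurable_funTS.
- exists M; split; first exact: num_real.
  by move=> y My x _; rewrite /= (le_trans (fM x))// ltW.
Qed.

Lemma boxed_integrable f M B : boxed f M B -> (leb2 R).-integrable setT (EFin \o f).
Proof.
move=> bf; have := boxed_integrable_in bf.
move/(integrable_mkcond _ (measurable_box B)); rewrite restrict_EFin.
by rewrite -(boxed_restrict bf).
Qed.

Lemma boxedM f g M M' B B' : boxed f M B -> boxed g M' B' ->
  boxed (fun x => f x * g x) (M * M') B.
Proof.
move=> [mf B0 fM fB] [mg B0' gM gB]; split => //.
- exact: measurable_funM.
- by move=> x; rewrite normrM ler_pM.
- by move=> x /fB ->; rewrite mul0r.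
Qed.

Lemma boxed_L2 f M B : boxed f M B -> L2 f.
Proof.
move=> bf; apply: L2P; first by case: bf.
have := boxed_integrable (boxedM bf bf).
by rewrite (_ : (fun x => f x * f x) = (fun x => f x ^+ 2)).
Qed.

Lemma boxed_integral f M B : boxed f M B ->
  `|(\int[leb2 R]_x f x)%R| <= M * (2 * B) ^+ 2.
Proof.
move=> bf; have mb := measurable_box B; have ib := boxed_integrable_in bf.
rewrite (boxed_restrict bf) -Rintegral_mkcond.
apply: le_trans (le_normr_Rintegral mb ib) _.
have -> : M * (2 * B) ^+ 2 = (\int[leb2 R]_(x in box B) M)%R.
  rewrite Rintegral_cst//; congr (_ * _).
  by rewrite [X in fine X]leb2_box//; case: bf.
have [mf B0 fM _] := bf.
have bM : boxed (fun x => M * \1_(box B) x) M B.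
  split => //.
  - by apply: measurable_funM => //; exact: measurable_indic.
  - move=> x; rewrite indicE normrM.
    have M0 : 0 <= M by exact: le_trans (fM x).
    by rewrite (ger0_norm M0) ler_piMr// ger0_norm// lern1 leq_b1.
  - by move=> x xB; rewrite indicE memNset// mulr0.
apply: le_Rintegral => //.
- by apply: integrable_norm ib.
- apply: measurable_bounded_integrable => //.
    by rewrite [X in (X < _)%E]leb2_box// ltry.
  exists M; split; first exact: num_real.
  by move=> y My x _; rewrite /= ger0_norm ?(le_trans _ (fM x))// ltW.
Qed.

Lemma boxed_ip f M B : boxed f M B -> ip f f <= M ^+ 2 * (2 * B) ^+ 2.
Proof.
by move=> bf; apply: le_trans (ler_norm _) _; exact: boxed_integral (boxedM bf bf).
Qed.

Lemma test_boxed f : test_function f -> exists M B, boxed f M B.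
Proof.
move=> [Cf [M0 fM0]]; pose B := Num.max M0 0.
have cf := Ck_continuous (Cf 0%N).
have cB : compact (box B) by apply: compact_setX; exact: segment_compact.
have B0 : 0 <= B by rewrite le_max lexx orbT.
have nB : box B !=set0 by exists (0, 0); split; rewrite /= in_itv/= oppr_le0 B0.
have cn : {within box B, continuous (fun x => `|f x|)}.
  apply: continuous_subspaceT => x; apply: continuous_comp; first exact: cf.
  exact: norm_continuous.
have [c _ Hc] := compact_EVT_max nB cB cn.
have fB x : ~ box B x -> f x = 0.
  move=> xB; apply: fM0; rewrite ltNge; apply/negP => xM; apply: xB.
  have xB : euclid x <= B by rewrite le_max xM.
  by split; rewrite /= in_itv/= -ler_norml (le_trans _ xB)// ?abs1_le_euclid// abs2_le_euclid.
exists `|f c|, B; split => //; first exact: continuous2_measurable.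
move=> x; have [xB|xB] := pselect (box B x); first by apply: Hc; exact: mem_set.
by rewrite fB// normr0.
Qed.

End boxed.

(** * Density of test functions *)

Import HBNNSimple.

Section density.
Context {R : realType}.
Implicit Types (f g h phi : R * R -> R) (x : R * R).

Definition approx f := L2 f /\ forall e : R, 0 < e ->
  exists2 phi, test_function phi & n2 (fun x => f x - phi x) <= e.

Lemma test_L2 phi : test_function phi -> L2 phi.
Proof. by move=> /test_boxed[M [B]]; exact: boxed_L2. Qed.

Lemma testD f g : test_function f -> test_function g -> test_function (fun x => f x + g x).
Proof.
move=> [Cf [M fM]] [Cg [N gN]]; split; first by move=> k; exact: CkD.
by exists (Num.max M N) => x; rewrite gt_max => /andP[/fM -> /gN ->]; rewrite addr0.
Qed.

Lemma testMl f g : test_function f -> (forall k, Ck k g) -> test_function (fun x => f x * g x).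
Proof.
move=> [Cf [M fM]] Cg; split; first by move=> k; exact: CkM.
by exists M => x /fM ->; rewrite mul0r.
Qed.

Lemma test_approx phi : test_function phi -> approx phi.
Proof.
move=> tphi; split; first exact: test_L2.
move=> e e0; exists phi => //.
have -> : (fun x => phi x - phi x) = (fun x => 0 * phi x).
  by apply/funext => x; rewrite subrr mul0r.
by rewrite n2Z ?normr0 ?mul0r ?ltW//; exact: test_L2.
Qed.

Lemma approxD f g : approx f -> approx g -> approx (fun x => f x + g x).
Proof.
move=> [Lf Af] [Lg Ag]; split; first exact: L2D.
move=> e e0; have e2 : 0 < e / 2 by rewrite divr_gt0.
have [p tp fp] := Af _ e2; have [q tq gq] := Ag _ e2.
exists (fun x => p x + q x); first exact: testD.
rewrite (_ : (fun x => _) = (fun x => (f x - p x) + (g x - q x))); last first.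
  by apply/funext => x; ring.
have Lp := test_L2 tp; have Lq := test_L2 tq.
by rewrite (splitr e) (le_trans (n2_triangle _ _)) ?lerD//; exact: L2B.
Qed.

Lemma approxZ (c : R) f : approx f -> approx (fun x => c * f x).
Proof.
move=> [Lf Af]; split; first exact: L2Z.
move=> e e0; pose C := `|c| + 1.
have C0 : 0 < C by rewrite ltr_wpDl.
have [p tp fp] := Af _ (divr_gt0 e0 C0).
exists (fun x => p x * c); first by apply: testMl => // k; exact: Ck_cst.
rewrite (_ : (fun x => _) = (fun x => c * (f x - p x))); last first.
  by apply/funext => x; ring.
rewrite n2Z; last by apply: L2B => //; exact: test_L2.
rewrite (@le_trans _ _ (C * (e / C)))//; last by rewrite mulrC divfK ?gt_eqF.
by rewrite ler_pM ?n2_ge0// lerDl.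
Qed.

Lemma approx_closed f : L2 f ->
  (forall e : R, 0 < e -> exists2 g, approx g & n2 (fun x => f x - g x) <= e) -> approx f.
Proof.
move=> Lf Af; split => // e e0; have e2 : 0 < e / 2 by rewrite divr_gt0.
have [g [Lg Ag] fg] := Af _ e2; have [p tp gp] := Ag _ e2; exists p => //.
rewrite (_ : (fun x => _) = (fun x => (f x - g x) + (g x - p x))); last first.
  by apply/funext => x; ring.
have Lp := test_L2 tp.
by rewrite (splitr e) (le_trans (n2_triangle _ _)) ?lerD//; exact: L2B.
Qed.

Lemma L2_le f g : measurable_fun setT f -> (forall x, `|f x| <= g x) -> L2 g -> L2 f.
Proof.
move=> mf fg Lg; apply: L2P => //.
have := L2_mul_integrable Lg Lg; apply: le_integrable => //.
  by apply/measurable_EFinP; exact: measurable_funX.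
move=> x _; rewrite /= lee_fin normrX -expr2 normrX lerXn2r ?nnegrE//.
by rewrite (le_trans (fg x))// ler_norm.
Qed.

Lemma L2_dominated (f_ : nat -> R * R -> R) f g :
  (forall n, measurable_fun setT (f_ n)) -> (forall n x, `|f_ n x| <= g x) -> L2 g ->
  (forall x, f_ n x @[n --> \oo] --> f x) ->
  L2 f /\ forall e : R, 0 < e -> exists n, n2 (fun x => f x - f_ n x) <= e.
Proof.
move=> mf_ f_g Lg f_f.
have mf : measurable_fun setT f.
  by apply: (measurable_fun_cvg mf_) => x _; exact: f_f.
have fg x : `|f x| <= g x.
  have H : `|f_ n x| @[n --> \oo] --> `|f x| by exact: cvg_norm (f_f x).
  rewrite -(cvg_lim _ H)//; apply: limr_le.
    by apply/cvg_ex; exists `|f x|.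
  by apply: nearW => n; exact: f_g.
have Lf : L2 f by exact: L2_le Lg.
have Lf_ n : L2 (f_ n) by apply: L2_le Lg.
split => // e e0.
pose k n x := ((f x - f_ n x) * (f x - f_ n x)).
have Lk n : (leb2 R).-integrable setT (EFin \o k n).
  by apply: L2_mul_integrable; exact: L2B.
have [] := @dominated_convergence _ _ _ (leb2 R) setT measurableT (fun n => EFin \o k n)
  (fun=> 0%E) (EFin \o (fun x => (2 * g x) * (2 * g x))).
- by move=> n; exact: measurable_int (Lk n).
- exact: measurable_cst.
- apply: aeW => x _; apply: cvg_EFin; first exact: nearW.
  rewrite /comp/= /k (_ : 0 = 0 * 0); last by rewrite mulr0.
  have H : f x - f_ n x @[n --> \oo] --> 0.
    by rewrite -(subrr (f x)); apply: cvgB => //; exact: cvg_cst.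
  exact: cvgM.
- by apply: L2_mul_integrable; exact: L2Z.
- apply: aeW => x n _; rewrite /= lee_fin normrM.
  have H : `|f x - f_ n x| <= 2 * g x.
    by rewrite mulr_natl mulr2n (le_trans (ler_normB _ _))// lerD.
  by rewrite ler_pM.
move=> _ _; rewrite integral0 => /fine_cvgP[_] /cvgrPdist_le /(_ (e ^+ 2)).
rewrite exprn_gt0// => /(_ isT)[N _ /(_ N (leqnn N))].
rewrite /= sub0r normrN => H; exists N.
rewrite -ler_sqr ?nnegrE ?n2_ge0 ?(ltW e0)// n2_sqr.
by apply: le_trans H; exact: ler_norm.
Qed.

Lemma approx_lim (f_ : nat -> R * R -> R) f g :
  (forall n, approx (f_ n)) -> (forall n x, `|f_ n x| <= g x) -> L2 g ->
  (forall x, f_ n x @[n --> \oo] --> f x) -> approx f.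
Proof.
move=> Af_ f_g Lg f_f.
have [|Lf Ef] := L2_dominated _ f_g Lg f_f.
  by move=> n; apply: L2_measurable; case: (Af_ n).
by apply: approx_closed => // e /Ef[n fn]; exists (f_ n).
Qed.

Lemma approx0 : approx (fun=> 0).
Proof.
apply: test_approx; split; first by move=> k; exact: Ck_cst.
by exists 0.
Qed.

Lemma approx_sum n (F : nat -> R * R -> R) : (forall i, approx (F i)) ->
  approx (fun x => \sum_(i < n) F i x).
Proof.
move=> AF; elim: n => [|n IH].
  by rewrite (_ : (fun x => _) = fun=> 0); [exact: approx0|apply/funext => x; rewrite big_ord0].
rewrite (_ : (fun x => _) = fun x => \sum_(i < n) F i x + F n x); first exact: approxD.
by apply/funext => x; rewrite big_ord_recr.
Qed.

Lemma L2_norm f : L2 f -> L2 (fun x => `|f x|).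
Proof.
move=> Lf; have mf := L2_measurable Lf; apply: L2P.
  exact: measurableT_comp.
have := L2_mul_integrable Lf Lf.
rewrite (_ : (fun x => f x * f x) = (fun x => `|f x| ^+ 2))//.
by apply/funext => x; rewrite -normrX ger0_norm ?sqr_ge0.
Qed.

(** The sets whose cut-off keeps [g] in the closure of the test functions form a Dynkin class:
    complements by subtraction, disjoint unions by dominated convergence. The map [p] lets one
    statement serve both coordinates and the plane. *)
Lemma approx_dynkin d (T : measurableType d) (p : R * R -> T) (G : set (set T)) g :
  measurable_fun setT p -> @measurable _ T = <<s G >> -> setI_closed G ->
  approx g -> (forall S, G S -> approx (fun x => g x * \1_(p @^-1` S) x)) ->
  forall S, measurable S -> approx (fun x => g x * \1_(p @^-1` S) x).
Proof.
move=> mp mG GI Ag AG S; rewrite mG; move: S.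
apply: (@dynkin_induction _ _ _ _ mG GI).
- rewrite preimage_setT (_ : (fun x => _) = g)//.
  by apply/funext => x; rewrite indicE in_setT mulr1.
- exact: AG.
- move=> S mS AS; rewrite (_ : (fun x => _) =
    (fun x => g x + (-1) * (g x * \1_(p @^-1` S) x))).
    by apply: approxD => //; exact: approxZ.
  by apply/funext => x; rewrite preimage_setC !indicE in_setC; case: (_ \in _) => /=; ring.
- move=> F mF tF AF.
  pose h n x := \sum_(k < n) (g x * \1_(p @^-1` (F k)) x).
  (* By disjointness at most one [F m] contains [p x]: the partial sums at [x] are constantly 0, or
     equal [g x] as soon as [n > m]. *)
  have hE x : (forall k, ~ F k (p x)) \/ exists2 m, F m (p x) &
      forall n, h n x = g x * (m < n)%:R.
    have [[m Fm]|nF] := pselect (exists m, F m (p x)); last first.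
      by left => k Fk; apply: nF; exists k.
    right; exists m => // n; rewrite /h -mulr_sumr; congr (_ * _).
    elim: n => [|n IH]; first by rewrite big_ord0.
    rewrite big_ord_recr/= IH indicE ltnS [(m <= n)%N]leq_eqVlt.
    have [<-|mn] := eqVneq m n; first by rewrite mem_set//= ltnn add0r.
    rewrite memNset ?addr0// => Fn; move/eqP: mn; apply.
    by apply: tF => //; exists (p x).
  have h0 x : (forall k, ~ F k (p x)) -> forall n, h n x = 0.
    move=> nF n; rewrite /h big1// => k _.
    by rewrite indicE memNset ?mulr0//; exact: nF.
  apply: (@approx_lim h _ (fun x => `|g x|)).
  + by move=> n; apply: (@approx_sum n (fun k x => g x * \1_(p @^-1` F k) x)).
  + move=> n x; have [nF|[m Fm ->]] := hE x; first by rewrite h0// normr0.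
    by rewrite normrM ler_piMr// ger0_norm// lern1 leq_b1.
  + by apply: L2_norm; case: Ag.
  + move=> x; have [nF|[m Fm hm]] := hE x.
      rewrite indicE memNset; last by move=> [k _]; exact: nF.
      by rewrite mulr0; apply: cvg_near_cst; apply: nearW => n; exact: h0.
    rewrite indicE mem_set; last by exists m.
    apply: cvg_near_cst; exists m.+1 => // n /= mn.
    by rewrite hm mn.
Qed.

Lemma n2_le f g : L2 f -> L2 g -> (forall x, `|f x| <= `|g x|) -> n2 f <= n2 g.
Proof.
move=> Lf Lg fg; apply: ler_wsqrtr; apply: le_Rintegral => //.
- exact: L2_mul_integrable.
- exact: L2_mul_integrable.
- by move=> x _; rewrite -!expr2 -(real_normK (num_real (f x)))
    -(real_normK (num_real (g x))) lerXn2r ?nnegrE.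
Qed.

Lemma approx_mull f (E : R * R -> R) : approx f -> (forall k, Ck k E) ->
  (forall x, `|E x| <= 1) -> approx (fun x => f x * E x).
Proof.
move=> [Lf Af] CE E1.
have LE h : L2 h -> L2 (fun x => h x * E x).
  move=> Lh; apply: (@L2_le _ (fun x => `|h x|)); last exact: L2_norm.
    apply: measurable_funM; first exact: L2_measurable.
    by apply: continuous2_measurable; exact: Ck_continuous (CE 0%N).
  by move=> x; rewrite normrM ler_piMr.
split; first exact: LE.
move=> e e0; have [p tp fp] := Af e e0; exists (fun x => p x * E x); first exact: testMl.
have Lfp : L2 (fun x => f x - p x) by apply: L2B => //; exact: test_L2.
rewrite (_ : (fun x => _) = (fun x => (f x - p x) * E x)); last first.
  by apply/funext => x; ring.
rewrite (le_trans _ fp)//; apply: n2_le => //; first exact: LE.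
by move=> x; rewrite normrM ler_piMr.
Qed.

Lemma expinv0_cvg (u : nat -> R) : u n @[n --> \oo] --> +oo ->
  expinv 0 (u n) @[n --> \oo] --> (1 : R).
Proof.
move=> /cvgryPge uoo; apply/cvgrPdist_le => e e0.
have e1 : 0 < e^-1 by rewrite invr_gt0.
near=> n; have un : e^-1 <= u n by near: n.
have un0 : 0 < u n by exact: lt_le_trans un.
rewrite ger0_norm ?subr_ge0 ?expinv0_le1//.
rewrite /expinv un0 expr0 mul1r lerBlDr -lerBlDl.
apply: le_trans (expR_ge1Dx _); rewrite lerD2l lerN2.
by rewrite -[leRHS]invrK lef_pV2.
Unshelve. all: by end_near. Qed.

(** [expinv 0] vanishes on the left of 0 and tends to 1 at infinity, so its dilations are smooth
    approximations of an open half-line. Being bounded by 1, they respect a domination. *)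
Lemma halfline_cvg (a b : R) :
  expinv 0 (n.+1%:R * (b - a)) @[n --> \oo] --> (\1_(`]a, +oo[%classic : set R) b : R).
Proof.
rewrite indicE; have [ab|ba] := ltP a b.
  rewrite mem_set/=; last by rewrite in_itv/= ab.
  apply: expinv0_cvg; apply/cvgryPge => A; near=> n.
  rewrite -ler_pdivrMr ?subr_gt0//.
  rewrite (@le_trans _ _ n%:R) ?ler_nat//.
  by near: n; exact: nbhs_infty_ger.
rewrite memNset/=; last by rewrite in_itv/= andbT; apply/negP; rewrite -leNgt.
apply: cvg_near_cst; apply: nearW => n; rewrite expinv_le0//.
by rewrite mulr_ge0_le0// subr_le0.
Unshelve. all: by end_near. Qed.

Lemma expinv0_norm (a : R) : `|expinv 0 a| <= 1.
Proof. by rewrite ger0_norm ?expinv_ge0// expinv0_le1. Qed.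

Lemma expinv_affine_Dk k (c b : R) : Dk k (fun a : R => expinv 0 (c + b * a)).
Proof. by apply: Dk_affine; exact: expinv_smooth. Qed.

Lemma RGenOInfty_setI : setI_closed (@RGenOInfty.G R).
Proof.
move=> _ _ [a ->] [b ->]; exists (Num.max a b).
by apply/seteqP; split => x /=; rewrite !in_itv/= !andbT gt_max => /andP.
Qed.

Lemma approx_fst g (S : set (measurableTypeR R)) : approx g -> measurable S ->
  approx (fun x => g x * \1_(fst @^-1` S) x).
Proof.
move=> Ag; move: S.
apply: (@approx_dynkin _ (measurableTypeR R) fst (@RGenOInfty.G R)).
- exact: measurable_fst.
- exact: RGenOInfty.measurableE.
- exact: RGenOInfty_setI.
- exact: Ag.
move=> _ [a ->].
apply: (@approx_lim (fun n x => g x * expinv 0 (n.+1%:R * (x.1 - a))) _ (fun x => `|g x|)).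
- move=> n; apply: approx_mull => // [k|x]; last exact: expinv0_norm.
  have := Ck_fst (expinv_affine_Dk k.+1 (- (n.+1%:R * a)) n.+1%:R).
  by congr (Ck k _); apply/funext => x; congr (expinv 0 _); ring.
- by move=> n x; rewrite normrM ler_piMr// expinv0_norm.
- by apply: L2_norm; case: Ag.
- move=> x; apply: cvgM; first exact: cvg_cst.
  exact: halfline_cvg.
Qed.

Lemma approx_snd g (S : set (measurableTypeR R)) : approx g -> measurable S ->
  approx (fun x => g x * \1_(snd @^-1` S) x).
Proof.
move=> Ag; move: S.
apply: (@approx_dynkin _ (measurableTypeR R) snd (@RGenOInfty.G R)).
- exact: measurable_snd.
- exact: RGenOInfty.measurableE.
- exact: RGenOInfty_setI.
- exact: Ag.
move=> _ [a ->].
apply: (@approx_lim (fun n x => g x * expinv 0 (n.+1%:R * (x.2 - a))) _ (fun x => `|g x|)).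
- move=> n; apply: approx_mull => // [k|x]; last exact: expinv0_norm.
  have := Ck_snd (expinv_affine_Dk k.+1 (- (n.+1%:R * a)) n.+1%:R).
  by congr (Ck k _); apply/funext => x; congr (expinv 0 _); ring.
- by move=> n x; rewrite normrM ler_piMr// expinv0_norm.
- by apply: L2_norm; case: Ag.
- move=> x; apply: cvgM; first exact: cvg_cst.
  exact: halfline_cvg.
Qed.

Lemma approx_indic g S : approx g ->
   @measurable _ (measurableTypeR R * measurableTypeR R)%type S ->
  approx (fun x => g x * \1_S x).
Proof.
move=> Ag; move: S.
apply: (@approx_dynkin _ (measurableTypeR R * measurableTypeR R)%type id
  [set A `*` B | A in measurable & B in measurable]).
- exact: measurable_id.
- exact: measurable_prod_measurableType.
- move=> _ _ [A1 mA1 [A2 mA2 <-]] [B1 mB1 [B2 mB2 <-]].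
  exists (A1 `&` B1); first exact: measurableI.
  exists (A2 `&` B2); first exact: measurableI.
  by rewrite setXI.
- exact: Ag.
- move=> _ [A mA [B mB <-]].
  have := approx_snd (approx_fst Ag mA) mB.
  congr approx; apply/funext => x; rewrite -mulrA; congr (_ * _).
  by rewrite !indicE -natrM mulnb; congr (_%:R); rewrite in_setX.
Qed.

(** The simple functions below the two parts of [f] are reached by cutting the test functions [c n]
    down to their level sets. As [c n] tends to 1, domination by [|f|] concludes. *)
Lemma approx_L2 f : L2 f -> approx f.
Proof.
move=> Lf; have mf := L2_measurable Lf.
have mfp : measurable_fun setT (EFin \o f^\+).
  by apply/measurable_EFinP; exact: measurable_funrpos.
have mfn : measurable_fun setT (EFin \o f^\-).
  by apply/measurable_EFinP; exact: measurable_funrneg.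
have [||p [pnd pf]] := @approximation _ (measurableTypeR R * measurableTypeR R)%type R setT measurableT (EFin \o f^\+).
- exact: mfp.
- by move=> x _; rewrite lee_fin funrpos_ge0.
have [||q [qnd qf]] := @approximation _ (measurableTypeR R * measurableTypeR R)%type R setT measurableT (EFin \o f^\-).
- exact: mfn.
- by move=> x _; rewrite lee_fin funrneg_ge0.
pose c (n : nat) (x : R * R) := (expinv 0 (n.+1%:R + x.1) * expinv 0 (n.+1%:R - x.1)) *
  (expinv 0 (n.+1%:R + x.2) * expinv 0 (n.+1%:R - x.2)).
have tc n : test_function (c n).
  split.
    move=> k; apply: CkM; apply: CkM.
    - have := Ck_fst (expinv_affine_Dk k.+1 n.+1%:R 1).
      by congr (Ck k _); apply/funext => x; rewrite mul1r.
    - have := Ck_fst (expinv_affine_Dk k.+1 n.+1%:R (-1)).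
      by congr (Ck k _); apply/funext => x; rewrite mulN1r.
    - have := Ck_snd (expinv_affine_Dk k.+1 n.+1%:R 1).
      by congr (Ck k _); apply/funext => x; rewrite mul1r.
    - have := Ck_snd (expinv_affine_Dk k.+1 n.+1%:R (-1)).
      by congr (Ck k _); apply/funext => x; rewrite mulN1r.
  (* Beyond radius [2 * n.+1] at least one coordinate reaches [n.+1] in absolute value, and its pair
     of factors vanishes. *)
  exists (n.+1%:R + n.+1%:R) => x /lt_le_trans /(_ (euclid_le x)) nx.
  have z (a : R) : n.+1%:R <= `|a| -> expinv 0 (n.+1%:R + a) * expinv 0 (n.+1%:R - a) = 0.
    rewrite ler_normr => /orP[na|na].
      by rewrite (@expinv_le0 _ _ (_ - _)) ?mulr0// subr_le0.
    by rewrite expinv_le0 ?mul0r//; lra.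
  rewrite /c; have [n1|n1] := leP (n.+1%:R) `|x.1|; first by rewrite z// mul0r.
  by rewrite [X in _ * X]z ?mulr0//; lra.
have c1 n x : `|c n x| <= 1.
  by rewrite /c !normrM mulr_ile1 ?mulr_ge0// mulr_ile1// expinv0_norm.
have cc x : c n x @[n --> \oo] --> (1 : R).
  have e1 (a : R) : expinv 0 (n.+1%:R + a) @[n --> \oo] --> (1 : R).
    apply: expinv0_cvg; apply/cvgryPge => A; near=> n.
    rewrite -lerBlDr (@le_trans _ _ n%:R) ?ler_nat//.
    by near: n; exact: nbhs_infty_ger.
  rewrite (_ : 1 = (1 * 1) * (1 * 1) :> R); last by rewrite !mulr1.
  by apply: cvgM; apply: cvgM; exact: e1.
have psimple n (s : {nnsfun (measurableTypeR R * measurableTypeR R)%type >-> R}) :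
    approx (fun x => c n x * s x).
  pose S := finmap.enum_fset (fset_set (range s)).
  pose F i x := S`_i * (c n x * \1_(s @^-1` [set S`_i]) x).
  have -> : (fun x => c n x * s x) = (fun x => \sum_(i < size S) F i x).
    apply/funext => x; rewrite (fimfunEord s) mulr_sumr.
    by apply: eq_bigr => i _; rewrite /F mulrCA.
  apply: approx_sum => i; apply: approxZ; apply: approx_indic; first exact: test_approx.
  by rewrite -[X in measurable X]setTI; exact: measurable_funP.
have pf' x : p n x @[n --> \oo] --> f^\+ x.
  by have /fine_cvgP[_] := pf x I.
have qf' x : q n x @[n --> \oo] --> f^\- x.
  by have /fine_cvgP[_] := qf x I.
apply: (@approx_lim (fun n x => c n x * p n x + (-1) * (c n x * q n x)) _ (fun x => `|f x|)).
- move=> n; apply: approxD; first exact: (psimple n (p n)).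
  by apply: approxZ; exact: (psimple n (q n)).
- move=> n x.
  have pn : p n x <= f^\+ x.
    rewrite -(cvg_lim _ (pf' x))//; apply: nondecreasing_cvgn_le.
      by move=> a b /pnd /lefP.
    by apply/cvg_ex; exists (f^\+ x).
  have qn : q n x <= f^\- x.
    rewrite -(cvg_lim _ (qf' x))//; apply: nondecreasing_cvgn_le.
      by move=> a b /qnd /lefP.
    by apply/cvg_ex; exists (f^\- x).
  have p0 : 0 <= p n x by [].
  have q0 : 0 <= q n x by [].
  rewrite mulN1r -mulrBr normrM (le_trans (ler_piMl _ (c1 n x)))//.
  have -> : `|f x| = f^\+ x + f^\- x by rewrite -[RHS]/((f^\+ + f^\-)%R x) funrposDneg.
  rewrite ler_norml; apply/andP; split; lra.
- exact: L2_norm.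
- move=> x; rewrite [f x](_ : _ = 1 * f^\+ x + (-1) * (1 * f^\- x)).
    by apply: cvgD; [apply: cvgM|apply: cvgM; [exact: cvg_cst|apply: cvgM]].
  by rewrite !mul1r mulN1r -[RHS]/((f^\+ - f^\-)%R x) funrposBneg.
Unshelve. all: by end_near. Qed.

(** If the norm exceeded [K], a test function close to [f] would violate the hypothesis. Restricting
    the duality to smooth functions matters because weak derivatives can only be tested on those. *)
Lemma L2_dual_bound f (K : R) : L2 f -> 0 <= K ->
  (forall phi, test_function phi -> `|ip f phi| <= K * n2 phi) -> n2 f <= K.
Proof.
move=> Lf K0 H; rewrite leNgt; apply/negP => KN.
have N0 := le_lt_trans K0 KN.
(* With this [e] the error [e * (N + K)] is half of [N * (N - K)], which contradicts
   [N ^+ 2 <= K * N + e * (N + K)]. *)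
set N := n2 f in KN N0; pose e := N * (N - K) / (2 * (N + K)).
have e0 : 0 < e by rewrite divr_gt0 ?mulr_gt0// ?subr_gt0// ltr_wpDr.
have [_ /(_ e e0) [phi tphi fphi]] := approx_L2 Lf.
have Lphi := test_L2 tphi.
have Lfp : L2 (fun x => f x - phi x) by exact: L2B.
have : N ^+ 2 <= N * e + K * (N + e).
  rewrite /N n2_sqr -/N.
  rewrite -[X in ip f X](_ : (fun x => (f x - phi x) + phi x) = f); last first.
    by apply/funext => x; rewrite subrK.
  rewrite ipDr// (le_trans (ler_norm _))// (le_trans (ler_normD _ _))// lerD//.
    by rewrite (le_trans (ip_CS _ _))// ler_wpM2l ?n2_ge0.
  rewrite (le_trans (H _ tphi))// ler_wpM2l//.
  rewrite (_ : phi = (fun x => f x + (-1) * (f x - phi x))); last first.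
    by apply/funext => x; ring.
  rewrite (le_trans (n2_triangle _ _))//; first exact: L2Z.
  by rewrite lerD2l n2Z// normrN1 mul1r.
have -> : N * e + K * (N + e) = K * N + e * (N + K) by ring.
rewrite /e invfM mulrA -mulrA mulVf ?gt_eqF ?ltr_wpDr// mulr1.
have : 0 < N * (N - K) by rewrite mulr_gt0// subr_gt0.
lra.
Qed.

End density.

(** * Waves by descent *)

Section integral1.
Context {R : realType}.
Local Notation leb := (@lebesgue_measure R).

Lemma is_derive_integral d (Y : measurableType d) (mu : {measure set Y -> \bar R})
    (f f' : R -> Y -> R) (a u v : R) (G : Y -> R) : u < a < v ->
  (forall x, u < x < v -> mu.-integrable setT (EFin \o f x)) ->
  (forall x y, u < x < v -> is_derive x (1 : R) (f^~ y) (f' x y)) ->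
  (forall y, 0 <= G y) -> mu.-integrable setT (EFin \o G) ->
  (forall x y, u < x < v -> `|f' x y| <= G y) ->
  is_derive a (1 : R) (fun x => (\int[mu]_y f x y)%R) (\int[mu]_y f' a y)%R.
Proof.
move=> auv intf df G0 iG fG.
have Ia : `]u, v[%classic a by rewrite /= in_itv.
have d1 x y : u < x < v -> partial1of2 f x y = f' x y.
  by move=> xuv; rewrite partial1of2E; have := df x y xuv => /@derive_val.
have H1 x : `]u, v[%classic x -> mu.-integrable setT (EFin \o f x).
  by rewrite /= in_itv; exact: intf.
have H2 x y : `]u, v[%classic x -> setT y -> derivable (f^~ y) x 1.
  by rewrite /= in_itv => xuv _; have [] := df x y xuv.
have H3 x y : `]u, v[%classic x -> setT y -> `|partial1of2 f x y| <= G y.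
  by rewrite /= in_itv => xuv _; rewrite d1//; exact: fG.
have D := derivable_under_integral measurableT Ia H1 H2 G0 iG H3.
have E := differentiation_under_integral measurableT Ia H1 H2 G0 iG H3.
apply: DeriveDef => //; rewrite -derive1E E.
by apply: eq_Rintegral => y _; exact: d1.
Qed.

Definition boxed1 (f : R -> R) (M B : R) := [/\ measurable_fun setT f, 0 <= B,
  forall x, `|f x| <= M & forall x, B < `|x| -> f x = 0].

Lemma boxed1_restrict f M B : boxed1 f M B -> f = f \_ `[- B, B]%classic.
Proof.
move=> [_ _ _ fB]; apply/funext => x; rewrite patchE.
case: ifPn => // /negP xB; apply: fB; rewrite ltNge; apply/negP => xB'; apply: xB.
by rewrite inE/= in_itv/= -ler_norml.
Qed.

Lemma leb_itv B : 0 <= B -> leb `[- B, B]%classic = (2 * B)%:E.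
Proof.
move=> B0; rewrite lebesgue_measure_itv/= lte_fin.
have [|BB] := ltP (- B) B; first by rewrite -EFinB => _; congr (_%:E); ring.
by congr (_%:E); lra.
Qed.

Lemma boxed1_integrable_in f M B : boxed1 f M B ->
  leb.-integrable `[- B, B]%classic (EFin \o f).
Proof.
move=> [mf B0 fM fB].
apply: measurable_bounded_integrable.
- exact: measurable_itv.
- by rewrite [X in (X < _)%E]leb_itv// ltry.
- exact: measurable_funTS.
- exists M; split; first exact: num_real.
  by move=> y My x _; rewrite /= (le_trans (fM x))// ltW.
Qed.

Lemma boxed1_integrable f M B : boxed1 f M B -> leb.-integrable setT (EFin \o f).
Proof.
move=> bf; have := boxed1_integrable_in bf.
have mi : measurable (`[- B, B]%classic : set (measurableTypeR R)) by exact: measurable_itv.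
move=> /(@integrable_mkcond _ _ _ leb _ (EFin \o f) mi).1; rewrite restrict_EFin.
by rewrite -(boxed1_restrict bf).
Qed.

Lemma boxed1_integral f M B : boxed1 f M B ->
  `|(\int[leb]_x f x)%R| <= M * (2 * B).
Proof.
move=> bf; have ib := boxed1_integrable_in bf.
have mi : measurable (`[- B, B]%classic : set (measurableTypeR R)) by exact: measurable_itv.
rewrite (boxed1_restrict bf) -Rintegral_mkcond.
apply: le_trans (le_normr_Rintegral mi ib) _.
have -> : M * (2 * B) = (\int[leb]_(x in `[- B, B]%classic) M)%R.
  rewrite Rintegral_cst//; congr (_ * _).
  by rewrite [X in fine X]leb_itv//; case: bf.
have [mf B0 fM _] := bf.
apply: le_Rintegral => //.
- exact: integrable_norm ib.
- apply: measurable_bounded_integrable => //.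
    by rewrite [X in (X < _)%E]leb_itv// ltry.
  exists M; split; first exact: num_real.
  by move=> y My x _; rewrite /= ger0_norm ?(le_trans _ (fM x))// ltW.
Qed.

Lemma integral_derive_compact (F f : R -> R) (B : R) :
  (forall x, is_derive x (1 : R) F (f x)) -> continuous f ->
  (forall x, B < `|x| -> F x = 0) -> (forall x, B < `|x| -> f x = 0) ->
  (\int[leb]_x f x)%R = 0.
Proof.
move=> dF cf F0 f0; pose C := `|B| + 1.
have BC : B < C by rewrite ltr_pwDr// ler_norm.
have C0 : 0 < C by rewrite ltr_wpDl.
have -> : f = f \_ `[- C, C]%classic.
  apply/funext => x; rewrite patchE; case: ifPn => // /negP xC.
  apply: f0; rewrite ltNge; apply/negP => xB; apply: xC.
  by rewrite inE/= in_itv/= -ler_norml (le_trans xB)// ltW.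
rewrite -Rintegral_mkcond /Rintegral.
have CC : - C < C by lra.
rewrite (@continuous_FTC2 _ f F _ _ CC).
- rewrite -EFinB /= !F0 ?subrr ?normrN// ?ger0_norm//; exact: ltW.
- exact: continuous_subspaceT.
- split.
  + by move=> x _; have [] := dF x.
  + apply: cvg_at_right_filter.
    by apply/differentiable_continuous/derivable1_diffP; have [] := dF (- C).
  + apply: cvg_at_left_filter.
    by apply/differentiable_continuous/derivable1_diffP; have [] := dF C.
- by move=> x _; rewrite derive1E; have := dF x => /@derive_val.
Qed.

(** The distance to the origin as a function of one coordinate, the squares of the others being
    frozen in [c]; it serves the three variables of [rho]. *)
Definition rad (c a : R) := Num.sqrt (a ^+ 2 + c).

Lemma rad_ge0 c a : 0 <= rad c a. Proof. exact: sqrtr_ge0. Qed.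

Lemma rad_continuous c : continuous (rad c).
Proof.
move=> a; apply: continuous_comp; last exact: sqrt_continuous.
by apply: cvgD; [exact: exprn_continuous|exact: cvg_cst].
Qed.

Lemma rad_is_derive c a : 0 < rad c a ->
  is_derive a (1 : R) (rad c) (a / rad c a).
Proof.
rewrite sqrtr_gt0 => ca.
have d1 : is_derive a (1 : R) (fun a : R => a ^+ 2 + c : R) (2 * a).
  rewrite -[2 * a]addr0; apply: is_deriveD.
  apply: DeriveDef; first exact: exprn_derivable.
  by rewrite exp_derive expr1 /GRing.scale/= mulr1.
have dS := is_derive1_sqrt ca.
have := @is_derive1_comp _ _ (fun a : R => a ^+ 2 + c : R) a _ _ dS d1.
rewrite (_ : _ * _ = a / rad c a)//.
have := sqrtr_gt0 (a ^+ 2 + c); rewrite ca /rad.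
move: (Num.sqrt (a ^+ 2 + c)) => q q0; field.
by rewrite gt_eqF.
Qed.

(* The hypothesis on [g] removes the singularity of [rad] at the origin. *)
Lemma radial_is_derive (g g' : R -> R) (c a : R) : 0 <= c ->
  (forall r : R, 0 < r -> is_derive r (1 : R) g (g' r)) ->
  (forall r : R, 0 <= r < 1 -> g r = 0) ->
  is_derive a (1 : R) (fun a => g (rad c a)) (a * (g' (rad c a) / rad c a)).
Proof.
move=> c0 dg g0.
have [r1|r1] := ltP (rad c a) 1.
  have near0 : \forall b \near a, g (rad c b) = 0.
    near=> b; apply: g0; rewrite rad_ge0/=; near: b.
    exact: (cvgr_lt (rad c a) (@rad_continuous c a) _ r1).
  (* The composite vanishes near [a], so the formula has to give 0: at [rad c a = 0] by the
     convention [0^-1 = 0], otherwise because [g'] vanishes on []0, 1[]. *)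
  have -> : a * (g' (rad c a) / rad c a) = 0.
    have [->|rn0] := eqVneq (rad c a) 0; first by rewrite invr0 !mulr0.
    have rp : 0 < rad c a by rewrite lt_def rn0 rad_ge0.
    have [_ <-] := dg _ rp.
    rewrite (@near_eq_derive _ _ _ _ (fun=> 0)) ?derive_cst ?mul0r ?mulr0//.
    near=> r; apply: g0; rewrite ltW/=; last by near: r; exact: lt_nbhsr.
    by near: r; exact: lt_nbhsl.
  by apply: (@near_eq_is_derive _ _ _ (fun=> 0)); near=> b; apply/esym; near: b.
have rp : 0 < rad c a by exact: lt_le_trans r1.
have := is_derive1_comp (dg _ rp) (rad_is_derive rp).
by rewrite (_ : _ * _ = a * (g' (rad c a) / rad c a)); last by ring.
Unshelve. all: by end_near. Qed.

End integral1.

(** * Spherical waves and their integrals over the additional variable *)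

Section kernel.
Context {R : realType}.
Local Notation leb := (@lebesgue_measure R).
Implicit Types (j k : nat) (s r a c xi : R) (x : R * R).

(* [k = 1] gives spherical waves of R^3; derivatives in [s] and in space stay in
   this family. For [s > 2] the kernel vanishes for [r < 1], so the value at
   [r = 0] is irrelevant. *)
Definition K j k s r : R := bump j (s - r) * r^-1 ^+ k.

Lemma K_is_derive_s j k s r : is_derive s (1 : R) (fun s => K j k s r) (K j.+1 k s r).
Proof.
have p1 : (1 : R) = 1 \/ (1 : R) = -1 by left.
have d : is_derive s (1 : R) (fun s => bump j (- r + 1 * s)) (1 * bump j.+1 (- r + 1 * s)).
  exact: (is_derive_affine p1 (bump_is_derive j _)).
rewrite !mul1r in d.
have -> : (fun s => K j k s r) = (fun s => r^-1 ^+ k * bump j (- r + 1 * s)).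
  by apply/funext => t; rewrite /K mul1r mulrC [t - r]addrC.
by rewrite /K mulrC [s - r]addrC; exact: is_deriveZ.
Qed.

Lemma K_is_derive_r j k s r : 0 < r -> is_derive r (1 : R) (K j k s)
  (- K j.+1 k s r - k%:R * K j k.+1 s r).
Proof.
move=> r0.
have m1 : (-1 : R) = 1 \/ (-1 : R) = -1 by right.
have d1 : is_derive r (1 : R) (fun r => bump j (s + -1 * r)) (-1 * bump j.+1 (s + -1 * r)).
  exact: (is_derive_affine m1 (bump_is_derive j _)).
have dV : is_derive r (1 : R) (fun y : R => y^-1 : R) (- r^-2).
  have := @is_deriveV R id r 1 1; rewrite /GRing.scale/= mulr1; apply => //.
  by rewrite gt_eqF.
have dX := is_deriveX k dV.
have := is_deriveM d1 dX.
rewrite (_ : (_ * _)%R = K j k s); last first.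
  by apply/funext => y; rewrite [LHS]/GRing.mul/= exprfctE /K mulN1r.
rewrite (_ : _ + _ = - K j.+1 k s r - k%:R * K j k.+1 s r)//.
rewrite exprfctE /GRing.scale/= /K !mulN1r.
by case: (k) => [|m]; rewrite -exprVn ?exprS/=; ring.
Qed.

Lemma K_near0 j k s r : 2 < s -> 0 <= r < 1 -> K j k s r = 0.
Proof.
by move=> s2 /andP[r0 r1]; rewrite /K bump_out ?mul0r// ger0_norm; lra.
Qed.

Lemma K_far j k s r : s + 1 < r -> K j k s r = 0.
Proof. by move=> sr; rewrite /K bump_out ?mul0r// ler0_norm; lra. Qed.

Lemma K_bound j : exists2 C : R, 0 < C &
  forall k s r, 2 < s -> 0 <= r -> `|K j k s r| <= C.
Proof.
have [C C0 HC] := @bump_bounded R j; exists C => // k s r s2 r0.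
have [r1|r1] := ltP r 1; first by rewrite K_near0 ?r0// normr0 ltW.
rewrite normrM -[C]mulr1 ler_pM//.
rewrite normrX ger0_norm ?invr_ge0// exprn_ile1 ?invr_ge0//.
by rewrite invf_le1// (lt_le_trans _ r1).
Qed.

(** The chain rule contributes [a / r], and the factor [1 / r] raises [k] by one: a spatial
    derivative is the coordinate times members of the same family. *)
Lemma K_radial j k s c a : 2 < s -> 0 <= c ->
  is_derive a (1 : R) (fun a => K j k s (rad c a))
    (a * (- K j.+1 k.+1 s (rad c a) - k%:R * K j k.+2 s (rad c a))).
Proof.
move=> s2 c0.
have := @radial_is_derive R _ _ c a c0 (fun r hr => @K_is_derive_r j k s r hr)
  (fun r hr => @K_near0 j k s r s2 hr).
congr is_derive; congr (_ * _); rewrite mulrBl mulNr; congr (- _ - _).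
  by rewrite /K exprS; ring.
by rewrite /K !exprS; ring.
Qed.

Definition rho x xi := Num.sqrt (x.1 ^+ 2 + x.2 ^+ 2 + xi ^+ 2).

Lemma rho_rad1 x xi : rho x xi = rad (x.2 ^+ 2 + xi ^+ 2) x.1.
Proof. by rewrite /rho /rad addrA. Qed.

Lemma rho_rad2 x xi : rho x xi = rad (x.1 ^+ 2 + xi ^+ 2) x.2.
Proof. by rewrite /rho /rad addrCA addrA. Qed.

Lemma rho_rad3 x xi : rho x xi = rad (x.1 ^+ 2 + x.2 ^+ 2) xi.
Proof. by rewrite /rho /rad addrC. Qed.

Lemma rho_ge0 x xi : 0 <= rho x xi. Proof. exact: sqrtr_ge0. Qed.

Lemma rho_ge3 x xi : `|xi| <= rho x xi.
Proof. by rewrite /rho -sqrtr_sqr ler_wsqrtr// lerDr addr_ge0// sqr_ge0. Qed.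

Lemma euclid_le_rho x xi : euclid x <= rho x xi.
Proof. by rewrite /rho /euclid ler_wsqrtr// lerDl sqr_ge0. Qed.

Lemma sqr_addr_ge0 (a b : R) : 0 <= a ^+ 2 + b ^+ 2.
Proof. by rewrite addr_ge0// sqr_ge0. Qed.

Lemma K_rho_continuous j k s x : 2 < s -> continuous (fun xi => K j k s (rho x xi)).
Proof.
move=> s2 xi; have -> : (fun xi => K j k s (rho x xi)) =
    (fun xi => K j k s (rad (x.1 ^+ 2 + x.2 ^+ 2) xi)).
  by apply/funext => y; rewrite rho_rad3.
apply/differentiable_continuous/derivable1_diffP.
by have [] := K_radial j k xi s2 (sqr_addr_ge0 x.1 x.2).
Qed.

Lemma K_rho_boxed j : exists2 C : R, 0 < C &
  forall k s x, 2 < s -> boxed1 (fun xi => K j k s (rho x xi)) C (s + 1).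
Proof.
have [C C0 HC] := K_bound j; exists C => // k s x s2; split.
- by apply: continuous_measurable_fun; exact: K_rho_continuous.
- lra.
- by move=> xi; apply: HC => //; exact: rho_ge0.
- by move=> xi sxi; apply: K_far; exact: lt_le_trans (rho_ge3 _ _).
Qed.

Lemma K_rho_integrable j k s x : 2 < s ->
  leb.-integrable setT (EFin \o (fun xi => K j k s (rho x xi))).
Proof.
by move=> s2; have [C C0 H] := K_rho_boxed j; exact: boxed1_integrable (H k s x s2).
Qed.

Lemma integrable_scale d (Y : measurableType d) (mu : {measure set Y -> \bar R})
    (f : Y -> R) c : mu.-integrable setT (EFin \o f) ->
  mu.-integrable setT (EFin \o (fun y => c * f y)).
Proof.
move=> iF; rewrite (_ : _ \o _ = (fun y => (c%:E * (EFin \o f) y)%E)); first exact: integrableZl.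
by apply/funext => y /=; rewrite EFinM.
Qed.

Lemma Rintegral_lincomb d (Y : measurableType d) (mu : {measure set Y -> \bar R})
    (f g : Y -> R) a c : mu.-integrable setT (EFin \o f) -> mu.-integrable setT (EFin \o g) ->
  (\int[mu]_y (a * f y + c * g y) = a * \int[mu]_y f y + c * \int[mu]_y g y)%R.
Proof.
move=> iF ig; rewrite RintegralD//; [|exact: integrable_scale..].
by rewrite !RintegralZl.
Qed.

(** [J j 1] is the [j]-th time derivative of the descent wave; larger [k] arise from differentiation
    in space and from integration by parts in [xi]. *)
Definition J j k s x : R := (\int[leb]_xi K j k s (rho x xi))%R.

Lemma J_bound j : exists2 C : R, 0 < C &
  forall k s x, 2 < s -> `|J j k s x| <= C * (2 * (s + 1)).
Proof.
have [C C0 H] := K_rho_boxed j; exists C => // k s x s2.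
exact: boxed1_integral (H k s x s2).
Qed.

Lemma J_far j k s x : s + 1 < euclid x -> J j k s x = 0.
Proof.
move=> sx; rewrite /J; under eq_Rintegral => xi _.
  rewrite K_far; last exact: lt_le_trans (euclid_le_rho _ _).
  over.
by rewrite Rintegral_cst//= mul0r.
Qed.

Lemma itv_indic_integrable (M B : R) : 0 <= M -> 0 <= B ->
  boxed1 (fun xi => M * \1_(`[- B, B]%classic : set R) xi) M B.
Proof.
move=> M0 B0; split => //.
- apply: measurable_funM => //; apply: measurable_indic; exact: measurable_itv.
- move=> xi; rewrite indicE normrM (ger0_norm M0) ler_piMr//.
  by rewrite ger0_norm// lern1 leq_b1.
- move=> xi Bxi; rewrite indicE memNset ?mulr0//= in_itv/= -ler_norml.
  by apply/negP; rewrite -ltNge.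
Qed.

Lemma J_is_derive_s j k s x : 2 < s -> is_derive s (1 : R) (fun s => J j k s x) (J j.+1 k s x).
Proof.
move=> s2; have [C C0 HC] := K_bound j.+1.
have B0 : 0 <= s + 2 by lra.
apply: (@is_derive_integral _ _ _ leb (fun s xi => K j k s (rho x xi))
  (fun s xi => K j.+1 k s (rho x xi)) s 2 (s + 1)
  (fun xi => C * \1_(`[- (s + 2), s + 2]%classic : set R) xi)).
- by rewrite s2/=; lra.
- by move=> t /andP[t2 _]; exact: K_rho_integrable.
- by move=> t xi _; exact: K_is_derive_s.
- by move=> xi; rewrite mulr_ge0 ?(ltW C0)// indicE.
- exact: boxed1_integrable (itv_indic_integrable (ltW C0) B0).
- move=> t xi /andP[t2 ts]; rewrite indicE.
  have [xis|xis] := leP `|xi| (s + 2).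
    rewrite mem_set ?mulr1/=; last by rewrite in_itv/= -ler_norml.
    by apply: HC => //; exact: rho_ge0.
  rewrite K_far ?normr0 ?mulr_ge0 ?(ltW C0)//.
  by apply: lt_le_trans (rho_ge3 _ _); lra.
Qed.

Let J_partial_lincomb j k s x (a : R) : 2 < s ->
  (\int[leb]_xi (a * (- K j.+1 k.+1 s (rho x xi) - k%:R * K j k.+2 s (rho x xi))))%R =
  a * (- J j.+1 k.+1 s x - k%:R * J j k.+2 s x).
Proof.
move=> s2; have i1 := K_rho_integrable j.+1 k.+1 x s2.
have i2 := K_rho_integrable j k.+2 x s2.
transitivity (\int[leb]_xi ((- a) * K j.+1 k.+1 s (rho x xi) +
    (- (a * k%:R)) * K j k.+2 s (rho x xi)))%R.
  by apply: eq_Rintegral => xi _; ring.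
by rewrite Rintegral_lincomb// /J; ring.
Qed.

(** The distance [rh] is abstract so that a single domination serves both coordinates. Since
    [|xi| <= rh], the integrand is supported in [|xi| <= s + 1] whatever the point of the plane. *)
Let J_partial (rh : R -> R -> R) (c : R -> R) j k s a : 2 < s -> (forall xi, 0 <= c xi) ->
  (forall a xi, rh a xi = rad (c xi) a) -> (forall a xi, `|xi| <= rh a xi) ->
  (forall j k a, leb.-integrable setT (EFin \o (fun xi => K j k s (rh a xi)))) ->
  is_derive a (1 : R) (fun a => \int[leb]_xi K j k s (rh a xi))%R
    (\int[leb]_xi (a * (- K j.+1 k.+1 s (rh a xi) - k%:R * K j k.+2 s (rh a xi))))%R.
Proof.
move=> s2 c0 rhE rh3 irh.
have [C C0 HC] := K_bound j; have [C' C'0 HC'] := K_bound j.+1.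
have B0 : 0 <= s + 1 by lra.
pose M := (`|a| + 1) * (C' + k%:R * C).
have M0 : 0 <= M by rewrite mulr_ge0 ?addr_ge0// ?mulr_ge0// ltW.
apply: (@is_derive_integral _ _ _ leb (fun a xi => K j k s (rh a xi))
  (fun a xi => a * (- K j.+1 k.+1 s (rh a xi) - k%:R * K j k.+2 s (rh a xi)))
  a (a - 1) (a + 1)
  (fun xi => M * \1_(`[- (s + 1), s + 1]%classic : set R) xi)).
- by apply/andP; split; lra.
- by move=> t _; exact: irh.
- move=> t xi _; rewrite rhE (_ : (fun a => _) = (fun a => K j k s (rad (c xi) a))).
    exact: K_radial.
  by apply/funext => b; rewrite rhE.
- by move=> xi; rewrite mulr_ge0// indicE.
- exact: boxed1_integrable (itv_indic_integrable M0 B0).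
- move=> t xi /andP[ta1 ta2]; rewrite indicE.
  have r0 : 0 <= rh t xi by rewrite rhE; exact: rad_ge0.
  have [xis|xis] := leP `|xi| (s + 1).
    rewrite mem_set ?mulr1/=; last by rewrite in_itv/= -ler_norml.
    rewrite normrM ler_pM//.
      have : `|t| <= `|a| + `|t - a| by rewrite (le_trans _ (ler_normD _ _))// addrC subrK.
      have : `|t - a| <= 1 by rewrite ler_norml; apply/andP; split; lra.
      lra.
    rewrite (le_trans (ler_normB _ _))// normrN lerD//; first exact: HC'.
    by rewrite normrM ger0_norm// ler_wpM2l//; exact: HC.
  have rs : s + 1 < rh t xi by exact: lt_le_trans (rh3 _ _).
  by rewrite !K_far// oppr0 mulr0 subr0 mulr0 normr0 mulr_ge0.
Qed.

Lemma J_is_derive_e1 j k s x : 2 < s ->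
  is_derive x e1 (J j k s) (x.1 * (- J j.+1 k.+1 s x - k%:R * J j k.+2 s x)).
Proof.
move=> s2; apply: is_derive_e1; rewrite -J_partial_lincomb//.
apply: (J_partial (rh := fun a xi => rho (a, x.2) xi) (c := fun xi => x.2 ^+ 2 + xi ^+ 2)) => //.
- by move=> xi; exact: sqr_addr_ge0.
- by move=> a xi; rewrite rho_rad1.
- by move=> a xi; exact: rho_ge3.
- by move=> *; exact: K_rho_integrable.
Qed.

Lemma J_is_derive_e2 j k s x : 2 < s ->
  is_derive x e2 (J j k s) (x.2 * (- J j.+1 k.+1 s x - k%:R * J j k.+2 s x)).
Proof.
move=> s2; apply: is_derive_e2; rewrite -J_partial_lincomb//.
apply: (J_partial (rh := fun a xi => rho (x.1, a) xi) (c := fun xi => x.1 ^+ 2 + xi ^+ 2)) => //.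
- by move=> xi; exact: sqr_addr_ge0.
- by move=> a xi; rewrite rho_rad2.
- by move=> a xi; exact: rho_ge3.
- by move=> *; exact: K_rho_integrable.
Qed.

End kernel.

(** * Continuity and integration by parts on the plane *)

Section more_partials.
Context {R : realType}.
Implicit Types (f g : R * R -> R) (x y : R * R).

Lemma lipschitz1 (g g' : R -> R) (L : R) :
  (forall a, is_derive a (1 : R) g (g' a)) -> (forall a, `|g' a| <= L) ->
  forall a b, `|g b - g a| <= L * `|b - a|.
Proof.
move=> dg gL a b; wlog ab : a b / a < b.
  move=> H; have [ab|ba|->] := ltgtP a b; first exact: H.
    by rewrite distrC (distrC b); exact: H.
  by rewrite !subrr !normr0 mulr0.
have cg : {within `[a, b], continuous g}.
  apply: derivable_within_continuous => c _; by have [] := dg c.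
have [c _ ->] := MVT ab (fun c _ => dg c) cg.
by rewrite normrM ler_wpM2r.
Qed.

(** Partial derivatives alone do not give continuity; bounded ones make [f] Lipschitz along each
    axis, and two axis-parallel segments join any two points. *)
Lemma partials_continuous f f1 f2 (L : R) :
  (forall x, is_derive x e1 f (f1 x)) -> (forall x, is_derive x e2 f (f2 x)) ->
  (forall x, `|f1 x| <= L) -> (forall x, `|f2 x| <= L) -> continuous f.
Proof.
move=> d1 d2 L1 L2 x; apply/cvgrPdist_le => e e0.
have L0 : 0 <= L by exact: le_trans (L1 x).
pose d := e / (2 * (L + 1)).
have d0 : 0 < d by rewrite divr_gt0// mulr_gt0// ltr_wpDl.
have nx : nbhs (x : R * R) (ball (x : R * R) d) by exact: nbhsx_ballx.
near=> y; have [/= xy1 xy2] : ball (x : R * R) d y by near: y; exact: nx.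
have H1 : `|f (x.1, y.2) - f (y.1, y.2)| <= L * d.
  have := @lipschitz1 (fun a => f (a, y.2)) (fun a => f1 (a, y.2)) L
    (fun a => is_derive_slice1 (d1 (a, y.2))) (fun a => L1 _) y.1 x.1.
  by move=> /le_trans; apply; rewrite ler_wpM2l// ltW.
have H2 : `|f (x.1, x.2) - f (x.1, y.2)| <= L * d.
  have := @lipschitz1 (fun b => f (x.1, b)) (fun b => f2 (x.1, b)) L
    (fun b => is_derive_slice2 (d2 (x.1, b))) (fun b => L2 _) y.2 x.2.
  by move=> /le_trans; apply; rewrite ler_wpM2l// ltW.
have -> : f x - f y = (f (x.1, x.2) - f (x.1, y.2)) + (f (x.1, y.2) - f (y.1, y.2)).
  by case: (x) (y) => [a b] [a' b'] /=; ring.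
rewrite (le_trans (ler_normD _ _))// (le_trans (lerD H2 H1))//.
rewrite -mulr2n -mulr_natl mulrA /d mulrA ler_pdivrMr; last by rewrite mulr_gt0// ltr_wpDl.
by rewrite [leRHS]mulrC ler_wpM2r ?(ltW e0)//; lra.
Unshelve. all: by end_near. Qed.

Lemma euclid_continuous : continuous (@euclid R).
Proof.
move=> x; apply: (@continuous_comp _ _ _ (fun x : R * R => x.1 ^+ 2 + x.2 ^+ 2) Num.sqrt).
  apply: cvgD.
    apply: (@continuous_comp _ _ _ fst (fun a : R => a ^+ 2)); first exact: cvg_fst.
    exact: exprn_continuous.
  apply: (@continuous_comp _ _ _ snd (fun a : R => a ^+ 2)); first exact: cvg_snd.
  exact: exprn_continuous.
exact: sqrt_continuous.
Qed.

Lemma test_D_e1 f : test_function f -> test_function ('D_e1 f).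
Proof.
move=> [Cf [M fM]]; split; first by move=> k; have [] := Ck_inv (Cf k.+1).
exists M => x xM.
rewrite -(@derive_cst _ (R * R)%type R 0 x e1); apply: near_eq_derive.
near=> y; rewrite fM//; near: y.
exact: (cvgr_gt (euclid x) (@euclid_continuous x) _ xM).
Unshelve. all: by end_near. Qed.

Lemma test_D_e2 f : test_function f -> test_function ('D_e2 f).
Proof.
move=> [Cf [M fM]]; split; first by move=> k; have [] := Ck_inv (Cf k.+1).
exists M => x xM.
rewrite -(@derive_cst _ (R * R)%type R 0 x e2); apply: near_eq_derive.
near=> y; rewrite fM//; near: y.
exact: (cvgr_gt (euclid x) (@euclid_continuous x) _ xM).
Unshelve. all: by end_near. Qed.

Lemma slice1_continuous f (b : R) : continuous f -> continuous (fun a => f (a, b)).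
Proof.
move=> cf a; apply: (@continuous_comp _ _ _ (fun a => (a, b)) f); last exact: cf.
exact: (cvg_pair cvg_id (cvg_cst b)).
Qed.

Lemma slice2_continuous f (a : R) : continuous f -> continuous (fun b => f (a, b)).
Proof.
move=> cf b; apply: (@continuous_comp _ _ _ (fun b => (a, b)) f); last exact: cf.
exact: (cvg_pair (cvg_cst a) cvg_id).
Qed.

Lemma test_integral_D_e1 f : test_function f -> (\int[leb2 R]_x 'D_e1 f x)%R = 0.
Proof.
move=> tf; have tdf := test_D_e1 tf.
have [M [B bf]] := test_boxed tf; have [M' [B' bdf]] := test_boxed tdf.
have idf := boxed_integrable bdf.
rewrite /Rintegral -(integral21_prod_meas1 idf) integral0_eq// => b _.
rewrite /fubini_G /=.
have [_ B0 _ fB] := bf; have [_ B0' fM' fB'] := bdf.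
have cD : continuous (fun a => 'D_e1 f (a, b)).
  exact: (@slice1_continuous ('D_e1 f) b (Ck_continuous (tdf.1 0%N))).
have out (C a c : R) : C < `|a| -> ~ box C (a, c).
  move=> Ca [/=]; rewrite in_itv/= -ler_norml => + _.
  by rewrite leNgt Ca.
have H : (\int[lebesgue_measure]_a 'D_e1 f (a, b))%R = 0.
  apply: (@integral_derive_compact _ (fun a => f (a, b)) _ (Num.max B B')) => //.
  - move=> a; apply: is_derive_slice1.
    by have [d1 _ _ _] := Ck_inv (tf.1 1%N); exact: d1.
  - by move=> a; rewrite gt_max => /andP[Ba _]; apply: fB; exact: out.
  - by move=> a; rewrite gt_max => /andP[_ Ba]; apply: fB'; exact: out.
have i1 : (@lebesgue_measure R).-integrable setT (EFin \o (fun a => 'D_e1 f (a, b))).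
  apply: (@boxed1_integrable _ _ M' B'); split => //.
    by apply: continuous_measurable_fun.
  by move=> a Ba; apply: fB'; exact: out.
by rewrite -[LHS]fineK ?(integrable_fin_num _ i1)// -[fine _]/(Rintegral _ _ _) H.
Qed.

Lemma test_integral_D_e2 f : test_function f -> (\int[leb2 R]_x 'D_e2 f x)%R = 0.
Proof.
move=> tf; have tdf := test_D_e2 tf.
have [M [B bf]] := test_boxed tf; have [M' [B' bdf]] := test_boxed tdf.
have idf := boxed_integrable bdf.
rewrite /Rintegral -(integral12_prod_meas1 idf) integral0_eq// => a _.
rewrite /fubini_F /=.
have [_ B0 _ fB] := bf; have [_ B0' fM' fB'] := bdf.
have cD : continuous (fun b => 'D_e2 f (a, b)).
  exact: (@slice2_continuous ('D_e2 f) a (Ck_continuous (tdf.1 0%N))).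
have out (C b c : R) : C < `|b| -> ~ box C (c, b).
  move=> Cb [_] /=; rewrite in_itv/= -ler_norml.
  by rewrite leNgt Cb.
have H : (\int[lebesgue_measure]_b 'D_e2 f (a, b))%R = 0.
  apply: (@integral_derive_compact _ (fun b => f (a, b)) _ (Num.max B B')) => //.
  - move=> b; apply: is_derive_slice2.
    by have [_ d2 _ _] := Ck_inv (tf.1 1%N); exact: d2.
  - by move=> b; rewrite gt_max => /andP[Ba _]; apply: fB; exact: out.
  - by move=> b; rewrite gt_max => /andP[_ Ba]; apply: fB'; exact: out.
have i1 : (@lebesgue_measure R).-integrable setT (EFin \o (fun b => 'D_e2 f (a, b))).
  apply: (@boxed1_integrable _ _ M' B'); split => //.
    by apply: continuous_measurable_fun.
  by move=> b Ba; apply: fB'; exact: out.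
by rewrite -[LHS]fineK ?(integrable_fin_num _ i1)// -[fine _]/(Rintegral _ _ _) H.
Qed.

Lemma test_weak_partial_e1 f : test_function f -> weak_partial e1 f ('D_e1 f).
Proof.
move=> tf phi tphi.
have tp : test_function (fun x => f x * phi x) by apply: testMl => //; case: tphi.
have Lf := test_L2 tf; have Lp := test_L2 tphi.
have Ldf := test_L2 (test_D_e1 tf); have Ldp := test_L2 (test_D_e1 tphi).
have := test_integral_D_e1 tp.
have [df _ _ _] := Ck_inv (tf.1 1%N); have [dp _ _ _] := Ck_inv (tphi.1 1%N).
have -> : (\int[leb2 R]_x 'D_e1 (fun x => f x * phi x) x)%R =
    ip f ('D_e1 phi) + ip ('D_e1 f) phi.
  rewrite /ip -RintegralD//; [|exact: L2_mul_integrable..].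
  apply: eq_Rintegral => x _.
  have -> : 'D_e1 (fun x => f x * phi x) x = f x * 'D_e1 phi x + phi x * 'D_e1 f x.
    by have := is_deriveM (df x) (dp x) => /@derive_val.
  by rewrite [phi x * _]mulrC.
by rewrite /ip => /eqP; rewrite addr_eq0 => /eqP.
Qed.

Lemma test_weak_partial_e2 f : test_function f -> weak_partial e2 f ('D_e2 f).
Proof.
move=> tf phi tphi.
have tp : test_function (fun x => f x * phi x) by apply: testMl => //; case: tphi.
have Lf := test_L2 tf; have Lp := test_L2 tphi.
have Ldf := test_L2 (test_D_e2 tf); have Ldp := test_L2 (test_D_e2 tphi).
have := test_integral_D_e2 tp.
have [_ df _ _] := Ck_inv (tf.1 1%N); have [_ dp _ _] := Ck_inv (tphi.1 1%N).
have -> : (\int[leb2 R]_x 'D_e2 (fun x => f x * phi x) x)%R =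
    ip f ('D_e2 phi) + ip ('D_e2 f) phi.
  rewrite /ip -RintegralD//; [|exact: L2_mul_integrable..].
  apply: eq_Rintegral => x _.
  have -> : 'D_e2 (fun x => f x * phi x) x = f x * 'D_e2 phi x + phi x * 'D_e2 f x.
    by have := is_deriveM (df x) (dp x) => /@derive_val.
  by rewrite [phi x * _]mulrC.
by rewrite /ip => /eqP; rewrite addr_eq0 => /eqP.
Qed.

Lemma test_weak_grad f : test_function f -> weak_grad f ('D_e1 f) ('D_e2 f).
Proof.
move=> tf; split.
- exact/test_L2/test_D_e1.
- exact/test_L2/test_D_e2.
- exact: test_weak_partial_e1.
- exact: test_weak_partial_e2.
Qed.

Lemma test_shift f h : test_function f -> test_function (fun x => f (x + h)).
Proof.
move=> [Cf [M fM]]; split; first by move=> k; exact: Ck_shift.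
exists (M + M + (`|h.1| + `|h.2|)) => x.
move=> /lt_le_trans /(_ (euclid_le x)) xM; apply: fM; rewrite ltNge; apply/negP => xh.
have h1 : `|x.1| <= M + `|h.1|.
  rewrite -lerBlDr (le_trans _ (le_trans (abs1_le_euclid (x + h)) xh))//.
  by rewrite lerBlDr -[X in `|X|](addrK h.1) (le_trans (ler_normB _ _)).
have h2 : `|x.2| <= M + `|h.2|.
  rewrite -lerBlDr (le_trans _ (le_trans (abs2_le_euclid (x + h)) xh))//.
  by rewrite lerBlDr -[X in `|X|](addrK h.2) (le_trans (ler_normB _ _)).
lra.
Qed.

Lemma n2_shift f h : measurable_fun setT f -> n2 (fun x => f (x + h)) = n2 f.
Proof.
move=> mf; congr Num.sqrt; rewrite /ip.
by rewrite (@Rintegral_shift _ h (fun x => f x * f x))//; exact: measurable_funM.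
Qed.

End more_partials.

(** * Smoothness of the descent wave and its wave equation *)

Section kernel_test.
Context {R : realType}.
Local Notation leb := (@lebesgue_measure R).
Implicit Types (j k n : nat) (s a xi : R) (x y : R * R).

Lemma J_continuous j k s : 2 < s -> continuous (J j k s).
Proof.
move=> s2.
have [A A0 HA] := @J_bound R j.+1; have [B B0 HB] := @J_bound R j.
pose L := (s + 1) * (A * (2 * (s + 1)) + k%:R * (B * (2 * (s + 1)))).
have L0 : 0 <= L.
  by rewrite mulr_ge0 ?addr_ge0 ?mulr_ge0 ?addr_ge0//; lra.
have HL a x : `|a| <= euclid x ->
    `|a * (- J j.+1 k.+1 s x - k%:R * J j k.+2 s x)| <= L.
  move=> ax; have [xs|xs] := leP (euclid x) (s + 1); last first.
    by rewrite !J_far// oppr0 mulr0 subr0 mulr0 normr0.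
  rewrite normrM ler_pM// ?(le_trans ax)//.
  rewrite (le_trans (ler_normB _ _))// normrN lerD//; first exact: HA.
  by rewrite normrM ger0_norm// ler_wpM2l//; exact: HB.
apply: (@partials_continuous _ _ _ _ L (fun x => J_is_derive_e1 j k x s2)
  (fun x => J_is_derive_e2 j k x s2)) => x; apply: HL.
  exact: abs1_le_euclid.
exact: abs2_le_euclid.
Qed.

Lemma Dk_id n : Dk n (fun a : R => a).
Proof.
case: n => // n; exists (fun=> 1); last exact: Dk_cst.
by move=> a; exact: is_derive_id.
Qed.

Lemma J_Ck n j k s : 2 < s -> Ck n (J j k s).
Proof.
move=> s2; elim: n j k => [|n IH] j k; first by split => //; exact: J_continuous.
have CJ : Ck n (fun x => - J j.+1 k.+1 s x - k%:R * J j k.+2 s x).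
  rewrite (_ : (fun x => _) = (fun x => -1 * J j.+1 k.+1 s x + - k%:R * J j k.+2 s x)).
    by apply: CkD; apply: CkZ; exact: IH.
  by apply/funext => x; ring.
apply: (@CkS _ n (J j k s) _ _ (@J_continuous j k s s2)
  (fun x => J_is_derive_e1 j k x s2) (fun x => J_is_derive_e2 j k x s2)).
- by apply: CkM => //; exact: (@Ck_fst R n (fun a => a) (@Dk_id n.+1)).
- by apply: CkM => //; exact: (@Ck_snd R n (fun a => a) (@Dk_id n.+1)).
Qed.

Lemma J_test j k s : 2 < s -> test_function (J j k s).
Proof.
move=> s2; split; first by move=> n; exact: J_Ck.
by exists (s + 1) => x sx; exact: J_far.
Qed.

Lemma J_boxed j : exists2 C : R, 0 < C &
  forall k s, 2 < s -> boxed (J j k s) (C * (2 * (s + 1))) (s + 1).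
Proof.
have [C C0 HC] := @J_bound R j; exists C => // k s s2; split.
- by apply: continuous2_measurable; exact: J_continuous.
- lra.
- by move=> x; exact: HC.
- move=> x xs; apply: J_far; rewrite ltNge; apply/negP => exs; apply: xs.
  by split; rewrite /= in_itv/= -ler_norml (le_trans _ exs)// ?abs1_le_euclid// abs2_le_euclid.
Qed.

Lemma rho_sqr x xi : rho x xi ^+ 2 = x.1 ^+ 2 + x.2 ^+ 2 + xi ^+ 2.
Proof. by rewrite sqr_sqrtr// !addr_ge0// sqr_ge0. Qed.

(** This is [xi ^+ 2 = rho ^+ 2 - |x|^2], where the factor [rho ^+ 2] lowers [k] by two; at
    [rho = 0] every kernel vanishes because [s > 2]. *)
Lemma K_xi2 j k s x xi : 2 < s -> xi ^+ 2 * K j k.+2 s (rho x xi) =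
  1 * K j k s (rho x xi) + (- (x.1 ^+ 2 + x.2 ^+ 2)) * K j k.+2 s (rho x xi).
Proof.
move=> s2; have -> : K j k s (rho x xi) = rho x xi ^+ 2 * K j k.+2 s (rho x xi).
  have [->|r0] := eqVneq (rho x xi) 0.
    by rewrite !K_near0 ?mulr0// lexx ltr01.
  rewrite /K (exprS _ k.+1) (exprS _ k) expr2; move: (bump j _) (_ ^+ k) r0 => b q.
  by move: (rho x xi) => r r0; field.
by rewrite rho_sqr; ring.
Qed.

Lemma J_xi2 j k s x : 2 < s -> (\int[leb]_xi (xi ^+ 2 * K j k.+2 s (rho x xi)))%R =
  J j k s x - (x.1 ^+ 2 + x.2 ^+ 2) * J j k.+2 s x.
Proof.
move=> s2; transitivity (\int[leb]_xi (1 * K j k s (rho x xi) +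
    (- (x.1 ^+ 2 + x.2 ^+ 2)) * K j k.+2 s (rho x xi)))%R.
  by apply: eq_Rintegral => xi _; exact: K_xi2.
rewrite Rintegral_lincomb; [by rewrite mul1r mulNr|exact: K_rho_integrable..].
Qed.

Lemma K_xi2_integrable j k s x : 2 < s ->
  leb.-integrable setT (EFin \o (fun xi => xi ^+ 2 * K j k.+2 s (rho x xi))).
Proof.
move=> s2; rewrite (_ : _ \o _ = (EFin \o (fun xi => 1 * K j k s (rho x xi))) \+
    (EFin \o (fun xi => (- (x.1 ^+ 2 + x.2 ^+ 2)) * K j k.+2 s (rho x xi)))).
  by apply: integrableD => //; apply: integrable_scale; exact: K_rho_integrable.
by apply/funext => xi /=; rewrite K_xi2// EFinD.
Qed.

(* Integration of [d/dxi (xi K)] over the line. *)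
Lemma J_ibp j k s x : 2 < s -> let r2 := x.1 ^+ 2 + x.2 ^+ 2 in
  J j k.+1 s x = (J j.+1 k s x - r2 * J j.+1 k.+2 s x) +
    k.+1%:R * (J j k.+1 s x - r2 * J j k.+3 s x).
Proof.
move=> s2 r2.
pose F xi := xi * K j k.+1 s (rho x xi).
pose F' xi := 1 * K j k.+1 s (rho x xi) + (-1) * (1 * (xi ^+ 2 * K j.+1 k.+2 s (rho x xi)) +
   k.+1%:R * (xi ^+ 2 * K j k.+3 s (rho x xi))).
have dF xi : is_derive xi (1 : R) F (F' xi).
  have := K_radial j k.+1 xi s2 (sqr_addr_ge0 x.1 x.2); rewrite -rho_rad3 => dK.
  have := is_deriveM (is_derive_id xi (1 : R)) dK.
  rewrite (_ : (_ * _)%R = F); last first.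
    by apply/funext => z; rewrite /F rho_rad3.
  rewrite [X in is_derive _ _ _ X](_ : _ = F' xi)//.
  rewrite /F' /GRing.scale/= -rho_rad3; ring.
have far xi : s + 1 < `|xi| -> forall j k, K j k s (rho x xi) = 0.
  by move=> sxi j' k'; apply: K_far; exact: lt_le_trans (rho_ge3 _ _).
have cK j' k' : continuous (fun xi => K j' k' s (rho x xi)) by exact: K_rho_continuous.
have cF' : continuous F'.
  have c2 : continuous (fun xi : R => xi ^+ 2) by exact: exprn_continuous.
  move=> xi; apply: cvgD; first by apply: cvgM; [exact: cvg_cst|exact: cK].
  apply: cvgM; first exact: cvg_cst.
  apply: cvgD; (apply: cvgM; first exact: cvg_cst).
    by apply: cvgM; [exact: c2|exact: cK].
  by apply: cvgM; [exact: c2|exact: cK].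
have : (\int[leb]_xi F' xi)%R = 0.
  apply: (@integral_derive_compact _ F F' (s + 1)) => // xi sxi.
    by rewrite /F far// mulr0.
  by rewrite /F' !far// !(mulr0, addr0).
rewrite /F' Rintegral_lincomb; last 2 first.
- exact: K_rho_integrable.
- rewrite (_ : _ \o _ = (EFin \o (fun xi => 1 * (xi ^+ 2 * K j.+1 k.+2 s (rho x xi)))) \+
    (EFin \o (fun xi => k.+1%:R * (xi ^+ 2 * K j k.+3 s (rho x xi))))).
    by apply: integrableD => //; apply: integrable_scale; exact: K_xi2_integrable.
  by apply/funext => xi /=; rewrite EFinD.
rewrite Rintegral_lincomb; [|exact: K_xi2_integrable..].
rewrite !J_xi2// -[Rintegral _ _ _]/(J j k.+1 s x) -/r2; lra.
Qed.

Lemma is_derive_congr (V : normedModType R) (f g : V -> R) (z v : V) (l m : R) :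
  f =1 g -> l = m -> is_derive z v f l -> is_derive z v g m.
Proof. by move=> /funext -> ->. Qed.

(** The spatial derivatives give [- 2 (J 1 2 + J 0 3) + |x|^2 (J 2 3 + 3 J 1 4 + 3 J 0 5)]. The
    instances [(1, 1)] and [(0, 2)] of [J_ibp], added, identify this with [J 2 1]: they remove the
    second derivative in [xi] of the three-dimensional equation. *)
Lemma J_laplacian s x : 2 < s -> let wx x := x.1 * (- J 1 2 s x - 1%:R * J 0 3 s x) in
  let wy x := x.2 * (- J 1 2 s x - 1%:R * J 0 3 s x) in
  'D_e1 wx x + 'D_e2 wy x = J 2 1 s x.
Proof.
move=> s2 wx wy.
have d1 : is_derive x e1 wx ((- J 1 2 s x - 1%:R * J 0 3 s x) +
   x.1 * (- (x.1 * (- J 2 3 s x - 2%:R * J 1 4 s x)) -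
     1%:R * (x.1 * (- J 1 4 s x - 3%:R * J 0 5 s x)))).
  have dx : is_derive x e1 (fun x : R * R => x.1) 1.
    by apply: is_derive_e1; exact: is_derive_id.
  have dJ := is_deriveB (is_deriveN (J_is_derive_e1 1 2 x s2))
    (is_deriveZ 1%:R (J_is_derive_e1 0 3 x s2)).
  apply: is_derive_congr (is_deriveM dx dJ).
    by move=> y; rewrite /wx /wy.
  rewrite [(_ - _) x](_ : _ = - J 1 2 s x - 1%:R * J 0 3 s x)// /GRing.scale/=.
  by move: (J 2 3 s x) (J 1 4 s x) (J 0 5 s x) (J 1 2 s x) (J 0 3 s x) => *; ring.
have d2 : is_derive x e2 wy ((- J 1 2 s x - 1%:R * J 0 3 s x) +
   x.2 * (- (x.2 * (- J 2 3 s x - 2%:R * J 1 4 s x)) -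
     1%:R * (x.2 * (- J 1 4 s x - 3%:R * J 0 5 s x)))).
  have dx : is_derive x e2 (fun x : R * R => x.2) 1.
    by apply: is_derive_e2; exact: is_derive_id.
  have dJ := is_deriveB (is_deriveN (J_is_derive_e2 1 2 x s2))
    (is_deriveZ 1%:R (J_is_derive_e2 0 3 x s2)).
  apply: is_derive_congr (is_deriveM dx dJ).
    by move=> y; rewrite /wx /wy.
  rewrite [(_ - _) x](_ : _ = - J 1 2 s x - 1%:R * J 0 3 s x)// /GRing.scale/=.
  by move: (J 2 3 s x) (J 1 4 s x) (J 0 5 s x) (J 1 2 s x) (J 0 3 s x) => *; ring.
rewrite (@derive_val _ _ _ _ _ _ _ d1) (@derive_val _ _ _ _ _ _ _ d2).
have := J_ibp 1 1 x s2; have := J_ibp 0 2 x s2; rewrite /=.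
move: (J 2 3 s x) (J 1 4 s x) (J 0 5 s x) (J 1 2 s x) (J 0 3 s x) (J 2 1 s x).
by move: x.1 x.2 => *; lra.
Qed.

End kernel_test.

(** * The translated descent waves as test waves *)

Section test_wave.
Context {R : realType}.
Implicit Types (j k n : nat) (s t : R) (x y : R * R) (f v : R * R -> R).

Lemma boxed_n2 f (M B : R) : boxed f M B -> n2 f <= M * (2 * B).
Proof.
move=> bf; have [_ B0 fM _] := bf.
have M0 : 0 <= M by exact: le_trans (fM (0, 0)).
rewrite -ler_sqr ?nnegrE ?n2_ge0//; last by rewrite !mulr_ge0.
by rewrite n2_sqr exprMn; exact: boxed_ip bf.
Qed.

Lemma J_mvt j k s t x : 2 < s -> 2 < t -> exists c : R,
  [/\ 2 < c, c <= Num.max s t, `|c - t| <= `|s - t| &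
      J j k s x - J j k t x = J j.+1 k c x * (s - t)].
Proof.
move=> s2 t2.
have cJ (a b : R) : 2 < a -> {within `[a, b], continuous (fun s => J j k s x)}.
  move=> a2; apply: derivable_within_continuous => c; rewrite in_itv/= => /andP[ac _].
  by have [] := J_is_derive_s j k x (lt_le_trans a2 ac).
have dJ (a b : R) : 2 < a -> forall c, c \in `]a, b[ ->
    is_derive c (1 : R) (fun s => J j k s x) (J j.+1 k c x).
  move=> a2 c; rewrite in_itv/= => /andP[ac _].
  exact: (@J_is_derive_s _ j k c x (lt_trans a2 ac)).
have [st|ts|->] := ltgtP s t; last first.
- by exists t; split; rewrite ?maxxx ?subrr ?mulr0.
- have [c] := MVT ts (dJ t s t2) (cJ t s t2); rewrite in_itv/= => /andP[tc cs] E.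
  exists c; split => //; first exact: lt_trans tc.
    exact: ltW.
  by rewrite !ger0_norm ?subr_ge0 ?(ltW ts) ?(ltW tc)// lerD2r ltW.
- have [c] := MVT st (dJ s t s2) (cJ s t s2); rewrite in_itv/= => /andP[sc ct] E.
  exists c; split => //; first exact: lt_trans sc.
  + exact: ltW.
  + by rewrite distrC (distrC s) !ger0_norm ?subr_ge0 ?(ltW st) ?(ltW ct)// lerD2l lerN2 ltW.
  + by rewrite -opprB E; ring.
Qed.

Lemma J_lipschitz j : exists2 C : R, 0 < C &
  forall k s t (S : R) x, 2 < s <= S -> 2 < t <= S ->
    `|J j k s x - J j k t x| <= C * (S + 1) * `|s - t|.
Proof.
have [C C0 HC] := @J_bound R j.+1; exists (2 * C) => [|k s t S x]; first by rewrite mulr_gt0.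
move=> /andP[s2 sS] /andP[t2 tS].
have [c [c2 cm _ ->]] := J_mvt j k x s2 t2.
rewrite normrM ler_wpM2r// (le_trans (HC _ _ _ c2))//.
rewrite [2 * C]mulrC -mulrA ler_wpM2l ?(ltW C0)// ler_wpM2l// lerD2r.
by rewrite (le_trans cm)// ge_max sS.
Qed.

(* The time shift by 3 avoids the singular range [s <= 2] of [J]. *)
Definition Jw j k y t : R * R -> R := fun x => J j k (t + 3) (x - y).

Let t3 t : 0 <= t -> 2 < t + 3. Proof. by move=> t0; lra. Qed.

Lemma Jw_test j k y t : 0 <= t -> test_function (Jw j k y t).
Proof. by move=> t0; exact: (@test_shift _ (J j k (t + 3)) (- y) (J_test j k (t3 t0))). Qed.

Lemma Jw_diff_n2 j : exists2 C : R, 0 < C & forall k y s t (S : R), 0 <= s <= S -> 0 <= t <= S ->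
  n2 (fun x => Jw j k y s x - Jw j k y t x) <= C * (S + 4) ^+ 2 * `|s - t|.
Proof.
have [C C0 HC] := J_lipschitz j; exists (2 * C) => [|k y s t S]; first by rewrite mulr_gt0.
move=> /andP[s0 sS] /andP[t0 tS].
have -> : (fun x => Jw j k y s x - Jw j k y t x) =
    (fun x => (fun z => J j k (s + 3) z - J j k (t + 3) z) (x + (- y))) by [].
have mJ (r : R) : 0 <= r -> measurable_fun setT (J j k (r + 3)).
  by move=> r0; exact: (continuous2_measurable (@J_continuous _ _ k _ (t3 r0))).
have b : boxed (fun z => J j k (s + 3) z - J j k (t + 3) z)
    (C * (S + 4) * `|s - t|) (S + 4).
  split.
  - by apply: measurable_funB; exact: mJ.
  - by rewrite (le_trans s0)// (le_trans sS)// lerDl.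
  - move=> x; have := HC k (s + 3) (t + 3) (S + 3) x.
    rewrite t3// lerD2r t3// lerD2r => /(_ sS tS).
    have -> : s + 3 - (t + 3) = s - t by ring.
    by have -> : S + 3 + 1 = S + 4 by ring.
  - move=> x xS; have xS' : S + 4 < euclid x.
      rewrite ltNge; apply/negP => exs; apply: xS.
      by split; rewrite /= in_itv/= -ler_norml (le_trans _ exs)// ?abs1_le_euclid// abs2_le_euclid.
    by rewrite !J_far ?subrr//; lra.
rewrite (@n2_shift _ (fun z => J j k (s + 3) z - J j k (t + 3) z)); last by case: b.
by rewrite (le_trans (boxed_n2 b))//; lra.
Qed.

Lemma Jw_contL2 j k y t : 0 <= t -> contL2 future (Jw j k y) t.
Proof.
move=> t0 e e0; have [C C0 HC] := Jw_diff_n2 j.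
pose A := C * (t + 5) ^+ 2.
have A0 : 0 < A by rewrite mulr_gt0// exprn_gt0//; lra.
exists (Num.min 1 (e / A)); first by rewrite lt_min ltr01 divr_gt0.
move=> s s0; rewrite lt_min => /andP[st1 stA].
have := HC k y s t (t + 1); rewrite s0 t0 lerDl ler01.
rewrite (_ : (s <= t + 1)); last by move: st1; rewrite ltr_norml => /andP[_]; lra.
move=> /(_ isT isT); rewrite (_ : t + 1 + 4 = t + 5); last by ring.
move=> /le_trans; apply; rewrite -/A -ler_pdivlMl// mulrC; exact: ltW.
Qed.

Lemma Jw_derL2 j k y t : 0 <= t -> derL2 future (Jw j k y) (Jw j.+1 k y t) t.
Proof.
move=> t0 e e0; have [C C0 HC] := J_lipschitz j.+1.
pose A := C * (t + 5) * (2 * (t + 5)).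
have A0 : 0 < A by rewrite !mulr_gt0//; lra.
exists (Num.min 1 (e / A)); first by rewrite lt_min ltr01 divr_gt0.
move=> s s0 st; rewrite lt_min => /andP[st1 stA].
have st1' : s <= t + 1 by move: st1; rewrite ltr_norml => /andP[_]; lra.
have t2 := t3 t0; have s2 := t3 s0.
have st4 : s + 3 <= t + 4 by lra.
have tt4 : t + 3 <= t + 4 by lra.
have t5 : 0 <= t + 5 by lra.
pose g := fun z => (s - t)^-1 * (J j k (s + 3) z - J j k (t + 3) z) - J j.+1 k (t + 3) z.
have -> : (fun x => (s - t)^-1 * (Jw j k y s x - Jw j k y t x) - Jw j.+1 k y t x) =
    (fun x => g (x + (- y))) by [].
have mJ (j' : nat) (r : R) : 0 <= r -> measurable_fun setT (J j' k (r + 3)).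
  by move=> r0; exact: (continuous2_measurable (@J_continuous _ _ k _ (t3 r0))).
have b : boxed g (C * (t + 5) * `|s - t|) (t + 5).
  split.
  - apply: measurable_funB; last exact: mJ.
    by apply: measurable_funM => //; apply: measurable_funB; exact: mJ.
  - lra.
  - move=> x; have [c [c2 cm ct E]] := J_mvt j k x s2 t2.
    have st0 : s - t != 0 by rewrite subr_eq0.
    have D : s + 3 - (t + 3) = s - t by ring.
    rewrite /g E D mulrCA mulVf// mulr1.
    apply: (@le_trans _ _ (C * (t + 4 + 1) * `|c - (t + 3)|)).
      apply: HC; rewrite ?c2 ?t2//.
      by rewrite (le_trans cm)// ge_max st4.
    have -> : t + 4 + 1 = t + 5 by ring.
    rewrite ler_wpM2l//; first by rewrite mulr_ge0 ?(ltW C0).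
    by rewrite (le_trans ct)//; have -> : s + 3 - (t + 3) = s - t by ring.
  - move=> x xS; have xS' : t + 5 < euclid x.
      rewrite ltNge; apply/negP => exs; apply: xS.
      by split; rewrite /= in_itv/= -ler_norml (le_trans _ exs)// ?abs1_le_euclid// abs2_le_euclid.
    by rewrite /g !J_far ?subrr ?mulr0 ?subrr//; lra.
rewrite (@n2_shift _ g); last by case: b.
rewrite (le_trans (boxed_n2 b))// mulrAC -/A -ler_pdivlMl// mulrC; exact: ltW.
Qed.

Lemma derive_shift2 f (h e : R * R) : 'D_e (fun x => f (x + h)) = (fun x => 'D_e f (x + h)).
Proof.
apply/funext => x; rewrite /derive.
have -> // : (fun r : R => r^-1 *: (f (r *: e + x + h) - f (x + h))) =
    (fun r : R => r^-1 *: (f (r *: e + (x + h)) - f (x + h))).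
by apply/funext => r; rewrite addrA.
Qed.

Lemma Jw_laplacian y t x : 0 <= t ->
  'D_e1 ('D_e1 (Jw 0 1 y t)) x + 'D_e2 ('D_e2 (Jw 0 1 y t)) x = Jw 2 1 y t x.
Proof.
move=> t0; have t2 := t3 t0.
have E1 : 'D_e1 (Jw 0 1 y t) = (fun x => 'D_e1 (J 0 1 (t + 3)) (x + (- y))).
  exact: (@derive_shift2 (J 0 1 (t + 3)) (- y) e1).
have E2 : 'D_e2 (Jw 0 1 y t) = (fun x => 'D_e2 (J 0 1 (t + 3)) (x + (- y))).
  exact: (@derive_shift2 (J 0 1 (t + 3)) (- y) e2).
have F1 : 'D_e1 ('D_e1 (Jw 0 1 y t)) x = 'D_e1 ('D_e1 (J 0 1 (t + 3))) (x + (- y)).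
  apply: (etrans (congr1 (fun g => 'D_e1 g x) E1)).
  exact: (congr1 (fun g => g x) (@derive_shift2 ('D_e1 (J 0 1 (t + 3))) (- y) e1)).
have F2 : 'D_e2 ('D_e2 (Jw 0 1 y t)) x = 'D_e2 ('D_e2 (J 0 1 (t + 3))) (x + (- y)).
  apply: (etrans (congr1 (fun g => 'D_e2 g x) E2)).
  exact: (congr1 (fun g => g x) (@derive_shift2 ('D_e2 (J 0 1 (t + 3))) (- y) e2)).
apply: (etrans (congr2 +%R F1 F2)); apply: etrans (J_laplacian (x + (- y)) t2).
congr (_ + _).
  congr ('D_e1 _ _); apply/funext => z.
  by have := J_is_derive_e1 0 1 z t2 => /@derive_val.
congr ('D_e2 _ _); apply/funext => z.
by have := J_is_derive_e2 0 1 z t2 => /@derive_val.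
Qed.

Lemma weak_grad_div v v1 v2 f g (h : R * R -> R) : L2 v -> weak_grad v v1 v2 ->
  test_function f -> test_function g -> (forall x, 'D_e1 f x + 'D_e2 g x = h x) ->
  ip v h = - (ip f v1 + ip g v2).
Proof.
move=> Lv [Lv1 Lv2 wv1 wv2] tf tg /funext <-.
rewrite ipDr//; [|exact/test_L2/test_D_e1|exact/test_L2/test_D_e2].
by rewrite opprD (ipC f) (ipC g); congr (_ + _); [exact: wv1|exact: wv2].
Qed.

Lemma test_wave y : wave (Jw 0 1 y) (Jw 1 1 y)
  (fun t => 'D_e1 (Jw 0 1 y t)) (fun t => 'D_e2 (Jw 0 1 y t)).
Proof.
have T j t : 0 <= t -> test_function (Jw j 1 y t) by exact: Jw_test.
split.
- by move=> t t0; exact/test_L2/T.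
- by move=> t t0; exact/test_L2/T.
- by move=> t t0; exact/test_L2/test_D_e1/T.
- by move=> t t0; exact/test_L2/test_D_e2/T.
- by move=> t t0; exact/test_weak_grad/T.
- by move=> t; exact: Jw_contL2.
- by move=> t; exact: Jw_contL2.
- by move=> t; exact: Jw_derL2.
- move=> v v1 v2 Lv gv t t0; have t0' := ltW t0.
  rewrite -(@weak_grad_div v v1 v2 _ _ (Jw 2 1 y t))//; last 3 first.
  + exact/test_D_e1/T.
  + exact/test_D_e2/T.
  + by move=> x; exact: Jw_laplacian.
  rewrite (_ : (fun s => _) = (fun s => ip v (Jw 1 1 y s))); last first.
    by apply/funext => s; rewrite ipC.
  apply: (@derL2_is_derive _ future) => //.
  + exact: nbhs_future.
  + by move=> s s0; exact/test_L2/T.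
  + exact/test_L2/T.
  + exact: Jw_derL2.
Qed.

End test_wave.

(** * The potential of the descent wave *)

Section potential.
Context {R : realType}.
Local Notation leb := (@lebesgue_measure R).
Implicit Types (T r xi : R) (x : R * R).

(* The integral of [K 0 1 s r] over [3 <= s <= T]. *)
Definition kern T r : R := (step (T - r) - step (3 - r)) * r^-1.

Lemma kern_near0 T r : 2 < T -> r < 2 -> 0 <= r < T - 1 -> kern T r = 0.
Proof.
move=> T2 r2 /andP[r0 r1]; rewrite /kern !step_ge1 ?subrr ?mul0r//; lra.
Qed.

Lemma kern_far T r : 2 < T -> T + 2 < r -> kern T r = 0.
Proof.
by move=> T2 Tr; rewrite /kern !step_le0 ?subrr ?mul0r//; lra.
Qed.

Lemma kern_le1 T r : 2 < T -> 0 <= r -> `|kern T r| <= 1.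
Proof.
move=> T2 r0; have [r1|r1] := ltP r 1.
  by rewrite kern_near0 ?normr0// ?r0/=; lra.
rewrite /kern normrM mulr_ile1//; last first.
  by rewrite ger0_norm ?invr_ge0// invf_le1// (lt_le_trans _ r1).
have := @step_ge0 R (T - r); have := @step_le1 R (T - r).
have := @step_ge0 R (3 - r); have := @step_le1 R (3 - r).
move: (step _) (step _) => a b *; rewrite ler_norml; apply/andP; split; lra.
Qed.

Lemma kern_ge0 T r : 3 <= T -> 0 <= r -> 0 <= kern T r.
Proof.
move=> T3 r0; rewrite /kern mulr_ge0 ?invr_ge0// subr_ge0.
by apply: step_nd; rewrite lerD2r.
Qed.

Lemma kern_is_derive_T T r : is_derive T (1 : R) (fun T => kern T r) (K 0 1 T r).
Proof.
have p1 : (1 : R) = 1 \/ (1 : R) = -1 by left.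
have d := is_derive_affine p1 (step_is_derive (- r + 1 * T)).
rewrite !mul1r in d.
apply: is_derive_congr (is_deriveZ r^-1 (is_deriveB d (is_derive_cst (step (3 - r)) T 1))).
  move=> t; rewrite /kern mulrC -[RHS]/(r^-1 * _); congr (_ * (step _ - _)).
  by rewrite mul1r addrC.
by rewrite subr0 /K expr1 [RHS]mulrC [T - r]addrC.
Qed.

Lemma kern_rho_continuous T x : 2 < T -> continuous (fun xi => kern T (rho x xi)).
Proof.
move=> T2 xi; have -> : (fun xi => kern T (rho x xi)) =
    (fun xi => kern T (rad (x.1 ^+ 2 + x.2 ^+ 2) xi)).
  by apply/funext => y; rewrite rho_rad3.
have m1 : (-1 : R) = 1 \/ (-1 : R) = -1 by right.
pose g r := (-1 * bump 0 (T + -1 * r) - -1 * bump 0 (3 + -1 * r)) * r^-1 +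
  (step (T + -1 * r) - step (3 + -1 * r)) * (- r^-2).
have dk r : 0 < r -> is_derive r (1 : R) (kern T) (g r).
  move=> r0.
  have dV : is_derive r (1 : R) (fun y : R => y^-1 : R) (- r^-2).
    have := @is_deriveV R id r 1 1; rewrite /GRing.scale/= mulr1; apply => //.
    by rewrite gt_eqF.
  have dA := is_derive_affine m1 (step_is_derive (T + -1 * r)).
  have dB := is_derive_affine m1 (step_is_derive (3 + -1 * r)).
  apply: is_derive_congr (is_deriveM (is_deriveB dA dB) dV).
    by move=> z; rewrite -[LHS]/((step (T + -1 * z) - step (3 + -1 * z)) * z^-1) !mulN1r.
  by rewrite /GRing.scale/= /g addrC mulrC.
apply/differentiable_continuous/derivable1_diffP.
have n0 r : 0 <= r < 1 -> kern T r = 0.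
  by move=> /andP[r0 r1]; apply: kern_near0; rewrite ?r0//; lra.
by have [] := radial_is_derive xi (sqr_addr_ge0 x.1 x.2) dk n0.
Qed.

Lemma kern_boxed T x : 2 < T -> boxed1 (fun xi => kern T (rho x xi)) 1 (T + 2).
Proof.
move=> T2; split.
- by apply: continuous_measurable_fun; exact: kern_rho_continuous.
- lra.
- by move=> xi; apply: kern_le1 => //; exact: rho_ge0.
- by move=> xi Txi; apply: kern_far => //; exact: lt_le_trans (rho_ge3 _ _).
Qed.

Definition pot T x : R := (\int[leb]_xi kern T (rho x xi))%R.

Lemma pot_is_derive T x : 2 < T -> is_derive T (1 : R) (fun T => pot T x) (J 0 1 T x).
Proof.
move=> T2; have [C C0 HC] := @K_bound R 0.
have B0 : 0 <= T + 2 by lra.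
apply: (@is_derive_integral _ _ _ leb (fun T xi => kern T (rho x xi))
  (fun T xi => K 0 1 T (rho x xi)) T 2 (T + 1)
  (fun xi => C * \1_(`[- (T + 2), T + 2]%classic : set R) xi)).
- by rewrite T2/=; lra.
- by move=> t /andP[t2 _]; exact: boxed1_integrable (kern_boxed x t2).
- by move=> t xi _; exact: kern_is_derive_T.
- by move=> xi; rewrite mulr_ge0 ?(ltW C0)// indicE.
- exact: boxed1_integrable (itv_indic_integrable (ltW C0) B0).
- move=> t xi /andP[t2 ts]; rewrite indicE.
  have [xis|xis] := leP `|xi| (T + 2).
    rewrite mem_set ?mulr1/=; last by rewrite in_itv/= -ler_norml.
    by apply: HC => //; exact: rho_ge0.
  rewrite K_far ?normr0 ?mulr_ge0 ?(ltW C0)//.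
  by apply: lt_le_trans (rho_ge3 _ _); lra.
Qed.

Lemma pot_far T x : 2 < T -> T + 2 < euclid x -> pot T x = 0.
Proof.
move=> T2 Tx; rewrite /pot; under eq_Rintegral => xi _.
  rewrite kern_far//; last exact: lt_le_trans (euclid_le_rho _ _).
  over.
by rewrite Rintegral_cst//= mul0r.
Qed.

Lemma pot_even T x : 3 <= T ->
  (pot T x)%:E = (2%:E * \int[leb]_(xi in [set xi | (0 <= xi)%R]) (kern T (rho x xi))%:E)%E.
Proof.
move=> T3; have T2 : 2 < T by lra.
rewrite -ge0_symfun_integralT; last 3 first.
- by move=> xi; apply: kern_ge0 => //; exact: rho_ge0.
- exact: kern_rho_continuous.
- by move=> xi; rewrite /= /rho sqrrN.
rewrite /pot /Rintegral fineK//; apply: integrable_fin_num => //.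
exact: boxed1_integrable (kern_boxed x T2).
Qed.

(** [kern] vanishes for [rho < 2] and is at most [rho^-1] beyond, with [rho >= xi]. The majorant
    keeps the coefficient 1 of [1 / xi] at infinity, which fixes the factor 2 in front of the
    logarithm; its second term pays for the regularisation at 0. *)
Lemma kern_le T x xi : 3 <= T -> 0 <= xi ->
  kern T (rho x xi) <= (1 + xi)^-1 + 2 * (1 + xi)^-1 ^+ 2.
Proof.
move=> T3 xi0; have x1 : 0 < 1 + xi by rewrite ltr_pwDl.
have u0 : 0 <= (1 + xi)^-1 + 2 * (1 + xi)^-1 ^+ 2.
  by rewrite addr_ge0 ?mulr_ge0 ?exprn_ge0// invr_ge0 ltW.
have [r2|r2] := ltP (rho x xi) 2.
  rewrite kern_near0 ?rho_ge0//=; lra.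
have r0 : 0 < rho x xi by lra.
have rxi : xi <= rho x xi by rewrite (le_trans _ (rho_ge3 _ _))// ler_norm.
apply: (@le_trans _ _ (rho x xi)^-1).
  rewrite /kern ler_piMl ?invr_ge0 ?(ltW r0)//.
  have := @step_le1 R (T - rho x xi); have := @step_ge0 R (3 - rho x xi); lra.
rewrite -(ler_pM2l r0) divff ?gt_eqF//.
set q := (1 + xi)^-1; have q0 : 0 < q by rewrite invr_gt0.
have qx : q * (1 + xi) = 1 by rewrite mulVf// gt_eqF.
have v0 : 0 <= q + 2 * q ^+ 2 by exact: u0.
have [x2|x2] := leP xi 2.
  apply: (@le_trans _ _ (2 * (q + 2 * q ^+ 2))); last by rewrite ler_wpM2r.
  have q3 : 3^-1 <= q by rewrite lef_pV2 ?posrE//; lra.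
  have : 3^-1 * 3^-1 <= q * q by rewrite ler_pM ?invr_ge0.
  rewrite -expr2; lra.
apply: (@le_trans _ _ (xi * (q + 2 * q ^+ 2))); last by rewrite ler_wpM2r.
have q2 : q <= 2^-1 by rewrite lef_pV2 ?posrE//; lra.
have : q * q <= q * 2^-1 by rewrite ler_wpM2l// ltW.
have -> : xi * (q + 2 * q ^+ 2) = (q * (1 + xi)) * (1 + 2 * q) - q * (1 + 2 * q) by ring.
rewrite qx; lra.
Qed.

Lemma ln_shift_is_derive (c a : R) : 0 < c + a -> is_derive a (1 : R) (fun a => ln (c + a)) (c + a)^-1.
Proof.
move=> ca; have p1 : (1 : R) = 1 \/ (1 : R) = -1 by left.
have d : is_derive (c + 1 * a) (1 : R) (@ln R) (c + a)^-1.
  by rewrite mul1r; exact: is_derive1_ln.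
apply: is_derive_congr (is_derive_affine p1 d) => [z|]; first by rewrite mul1r.
by rewrite mul1r.
Qed.

Lemma integral_FTC (f F : R -> R) (a b : R) : a < b ->
  (forall z, a <= z <= b -> is_derive z (1 : R) F (f z)) -> {within `[a, b], continuous f} ->
  (\int[leb]_(z in `[a, b]) (f z)%:E = (F b - F a)%:E)%E.
Proof.
move=> ab dF cf; rewrite (@continuous_FTC2 _ f F)//.
- split.
  + by move=> z; rewrite in_itv/= => /andP[az zb]; have [] := dF z; rewrite ?(ltW az) ?(ltW zb).
  + apply: cvg_at_right_filter; apply/differentiable_continuous/derivable1_diffP.
    by have [] := dF a; rewrite ?lexx ?(ltW ab).
  + apply: cvg_at_left_filter; apply/differentiable_continuous/derivable1_diffP.
    by have [] := dF b; rewrite ?lexx ?(ltW ab).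
- move=> z; rewrite in_itv/= => /andP[az zb]; rewrite derive1E.
  have zab : a <= z <= b by rewrite !ltW.
  by have := dF z zab => /@derive_val.
Qed.

Lemma pot_le T x : 3 <= T -> pot T x <= 2 * ln (T + 3) + 4.
Proof.
move=> T3; have T2 : 2 < T by lra.
have T0 : 0 < T + 2 by lra.
have mh : measurable [set xi : measurableTypeR R | (0 <= xi)%R].
  by rewrite -set_itvcy; exact: measurable_itv.
have mI : measurable (`[0, T + 2]%classic : set (measurableTypeR R)) by exact: measurable_itv.
have mk : measurable_fun setT (fun xi => (kern T (rho x xi))%:E).
  by apply/measurable_EFinP; have [] := kern_boxed x T2.
pose u (xi : R) : R := (1 + xi)^-1 + 2 * (1 + xi)^-1 ^+ 2.
pose F (xi : R) : R := ln (1 + xi) - 2 * (1 + xi)^-1.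
have du xi : 0 <= xi -> is_derive xi (1 : R) F (u xi).
  move=> x0; have x1 : 0 < 1 + xi by rewrite ltr_pwDl.
  have p1 : (1 : R) = 1 \/ (1 : R) = -1 by left.
  have dV : is_derive (1 + 1 * xi) (1 : R) (fun y : R => y^-1 : R) (- (1 + xi)^-2).
    rewrite mul1r; have := @is_deriveV R id (1 + xi) 1 1; rewrite /GRing.scale/= mulr1; apply => //.
    by rewrite gt_eqF.
  apply: is_derive_congr (is_deriveB (ln_shift_is_derive x1)
    (is_deriveZ 2 (is_derive_affine p1 dV))) => [z|].
    by rewrite -[LHS]/(ln (1 + z) - 2 * (1 + 1 * z)^-1) mul1r.
  by rewrite /GRing.scale/= /u mul1r mulrN opprK exprVn.
have cu : {within `[0, T + 2], continuous u}.
  apply: continuous_in_subspaceT => z; rewrite inE/= ?in_itv/= => /andP[z0 _].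
  have z1 : 1 + z != 0 by rewrite gt_eqF// ltr_pwDl.
  have cV : {for z, continuous (fun a : R => (1 + a)^-1)}.
    by apply: cvgV => //; apply: cvgD; [exact: cvg_cst|exact: cvg_id].
  apply: cvgD; first exact: cV.
  apply: cvgM; first exact: cvg_cst.
  exact: (cvgM cV cV).
have mu : measurable_fun `[0, T + 2]%classic u.
  by apply: subspace_continuous_measurable_fun.
have H : (\int[leb]_(xi in [set xi | (0 <= xi)%R]) (kern T (rho x xi))%:E <= (F (T + 2) - F 0)%:E)%E.
  rewrite -(integral_FTC T0 _ cu); last by move=> z /andP[z0 _]; exact: du.
  rewrite integral_mkcond (_ : _ \_ _ = (fun xi => (kern T (rho x xi))%:E) \_ `[0, T + 2]%classic).
    rewrite -integral_mkcond; apply: ge0_le_integral => //.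
    - by move=> xi _; rewrite lee_fin kern_ge0// rho_ge0.
    - exact: measurable_funTS.
    - exact/measurable_EFinP.
    - by move=> xi; rewrite /= ?in_itv/= => /andP[xi0 _]; rewrite lee_fin kern_le.
  apply/funext => xi; rewrite !patchE.
  have [xi0|xi0] := leP 0 xi; last first.
    rewrite ifF ?ifF//; apply/negP; rewrite inE/= ?in_itv/= leNgt xi0//.
  rewrite ifT; last by rewrite inE.
  have [xT|xT] := leP xi (T + 2).
    by rewrite ifT// inE/= in_itv/= xi0.
  rewrite ifF; last by apply/negP; rewrite inE/= ?in_itv/= xi0 leNgt xT.
  by rewrite kern_far// (lt_le_trans xT)// (le_trans (ler_norm _))// rho_ge3.
have : ((pot T x)%:E <= 2%:E * (F (T + 2) - F 0)%:E)%E.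
  by rewrite pot_even// lee_pmul2l.
rewrite -EFinM lee_fin => /le_trans; apply.
rewrite /F addr0 ln1 invr1 mulr1 sub0r opprK.
have -> : 1 + (T + 2) = T + 3 by ring.
have : 0 <= (T + 3)^-1 by rewrite invr_ge0; lra.
lra.
Qed.

(** For [4 <= xi <= T - 1 - euclid x] both steps are saturated, so [kern] equals [rho^-1], which is
    at least [(euclid x + xi)^-1]. When this interval is degenerate the left-hand side is
    nonpositive. *)
Lemma pot_ge T x : 3 <= T -> 2 * ln (T - 1) - 2 * ln (4 + euclid x) <= pot T x.
Proof.
move=> T3; have T2 : 2 < T by lra.
have e0 : 0 <= euclid x by exact: sqrtr_ge0.
have T1 : 0 < T - 1 by lra.
have e4 : 0 < 4 + euclid x by lra.
have [Le|Le] := leP (T - 1 - euclid x) 4.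
  apply: (@le_trans _ _ 0).
    have : ln (T - 1) <= ln (4 + euclid x) by rewrite ler_ln ?posrE//; lra.
    lra.
  by apply: Rintegral_ge0 => xi _; rewrite kern_ge0// rho_ge0.
pose u (xi : R) : R := (euclid x + xi)^-1.
have du xi : 4 <= xi -> is_derive xi (1 : R) (fun a => ln (euclid x + a)) (u xi).
  by move=> xi4; apply: ln_shift_is_derive; lra.
have cu : {within `[4, T - 1 - euclid x], continuous u}.
  apply: continuous_in_subspaceT => z; rewrite inE/= ?in_itv/= => /andP[z4 _].
  by apply: cvgV; [rewrite gt_eqF//; lra|apply: cvgD; [exact: cvg_cst|exact: cvg_id]].
have mk : measurable_fun setT (fun xi => (kern T (rho x xi))%:E).
  by apply/measurable_EFinP; have [] := kern_boxed x T2.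
have mh : measurable [set xi : measurableTypeR R | (0 <= xi)%R].
  by rewrite -set_itvcy; exact: measurable_itv.
have H : ((ln (T - 1) - ln (4 + euclid x))%:E <=
    \int[leb]_(xi in [set xi | (0 <= xi)%R]) (kern T (rho x xi))%:E)%E.
  have Hd z : 4 <= z <= T - 1 - euclid x ->
      is_derive z (1 : R) (fun a => ln (euclid x + a)) (u z).
    by move=> /andP[z4 _]; exact: du.
  have := integral_FTC Le Hd cu.
  have -> : euclid x + (T - 1 - euclid x) = T - 1 by ring.
  rewrite (addrC (euclid x) 4) => <-.
  apply: (@le_trans _ _ (\int[leb]_(xi in `[4%R, (T - 1 - euclid x)%R]) (kern T (rho x xi))%:E)%E).
    apply: ge0_le_integral => //.
    - by move=> xi; rewrite /= ?in_itv/= => /andP[xi4 _]; rewrite lee_fin invr_ge0; lra.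
    - by apply/measurable_EFinP; apply: subspace_continuous_measurable_fun.
    - exact: measurable_funTS.
    - move=> xi; rewrite /= ?in_itv/= => /andP[xi4 xiT]; rewrite lee_fin.
      have xi0 : 0 <= xi by lra.
      have r4 : 4 <= rho x xi by rewrite (le_trans xi4)// (le_trans (ler_norm _))// rho_ge3.
      have re : rho x xi <= euclid x + xi.
        rewrite -ler_sqr ?nnegrE ?rho_ge0 ?addr_ge0// rho_sqr.
        rewrite sqrrD /euclid sqr_sqrtr; last exact: sqr_addr_ge0.
        by rewrite lerD2r lerDl mulrn_wge0// mulr_ge0// sqrtr_ge0.
      rewrite /kern (@step_le0 _ (3 - rho x xi)); last by lra.
      rewrite step_ge1; last by lra.
      by rewrite subr0 mul1r lef_pV2 ?posrE//; lra.
  apply: ge0_subset_integral => //.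
  - exact: measurable_funTS.
  - by move=> xi _; rewrite lee_fin kern_ge0// rho_ge0.
  - by move=> xi; rewrite /= ?in_itv/= => /andP[xi4 _]; lra.
rewrite -lee_fin pot_even//.
have -> : 2 * ln (T - 1) - 2 * ln (4 + euclid x) = 2 * (ln (T - 1) - ln (4 + euclid x)) by ring.
by rewrite EFinM lee_pmul2l.
Qed.

End potential.

(** * Fubini on the plane *)

Section fubini.
Context d d' (X : measurableType d) (Y : measurableType d') (R : realType).
Variables (m1 : {sigma_finite_measure set X -> \bar R}) (m2 : {sigma_finite_measure set Y -> \bar R}).
Implicit Types (F : X * Y -> R) (g : X -> R) (h : Y -> R).

(** A bound by a product of integrable functions makes every section integrable, not almost every
    one, so the inner integrals are genuine real numbers at each point. *)
Lemma fubini_dominated F g h :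
  measurable_fun setT F ->
  (forall x y, `|F (x, y)| <= g x * h y) ->
  m1.-integrable setT (EFin \o g) -> m2.-integrable setT (EFin \o h) ->
  [/\ m1.-integrable setT (EFin \o (fun x => \int[m2]_y F (x, y))%R),
      m2.-integrable setT (EFin \o (fun y => \int[m1]_x F (x, y))%R) &
  (\int[m1]_x (\int[m2]_y F (x, y)) = \int[m2]_y (\int[m1]_x F (x, y)))%R].
Proof.
move=> mF Fgh ig ih.
have mF' : measurable_fun setT (EFin \o F) by exact/measurable_EFinP.
have ix x : m2.-integrable setT (fun y => (F (x, y))%:E).
  apply: (@le_integrable _ _ _ _ _ measurableT _ (fun y => (g x * h y)%:E)).
  - exact: measurableT_comp mF' (measurable_pair1 x).
  - by move=> y _; rewrite lee_fin; apply: le_trans (Fgh x y) (ler_norm _).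
  - exact: (integrableZl measurableT (g x) ih).
have iy y : m1.-integrable setT (fun x => (F (x, y))%:E).
  apply: (@le_integrable _ _ _ _ _ measurableT _ (fun x => (g x * h y)%:E)).
  - exact: measurableT_comp mF' (measurable_pair2 y).
  - by move=> x _; rewrite lee_fin; apply: le_trans (Fgh x y) (ler_norm _).
  - exact: (integrableZr measurableT (h y) ig).
have bx x : `|(\int[m2]_y F (x, y))%R| <= g x * (\int[m2]_y h y)%R.
  apply: le_trans (le_normr_Rintegral measurableT (ix x)) _.
  rewrite -RintegralZl//; apply: le_Rintegral => //.
  - exact: (integrable_norm (ix x)).
  - exact: (integrableZl measurableT (g x) ih).
have by_ y : `|(\int[m1]_x F (x, y))%R| <= (\int[m1]_x g x)%R * h y.
  apply: le_trans (le_normr_Rintegral measurableT (iy y)) _.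
  rewrite -RintegralZr//; apply: le_Rintegral => //.
  - exact: (integrable_norm (iy y)).
  - exact: (integrableZr measurableT (h y) ig).
have iF : (m1 \x m2)%E.-integrable setT (EFin \o F).
  apply/(integrable12ltyP _ _ mF').
  apply: (@le_lt_trans _ _ (\int[m1]_x (g x * (\int[m2]_y h y)%R)%:E)%E).
    apply: ge0_le_integral => //=.
    - by move=> x _; apply: integral_ge0.
    - apply: (@measurable_fun_fubini_tonelli_F _ _ _ _ _ m2 (fun z => `|(F z)%:E|%E)).
        exact: measurableT_comp.
      by move=> z /=.
    - exact: (measurable_int _ (integrableZr measurableT (\int[m2]_y h y)%R ig)).
    - move=> x _.
      rewrite -RintegralZl// /Rintegral fineK; last first.
        exact: (integrable_fin_num _ (integrableZl measurableT (g x) ih)).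
      apply: ge0_le_integral => //=.
      + exact: (measurable_int _ (integrable_abse (ix x))).
      + exact: (measurable_int _ (integrableZl measurableT (g x) ih)).
      + by move=> y _; rewrite lee_fin.
  exact: (integrable_lty _ (integrableZr measurableT (\int[m2]_y h y)%R ig)).
have E1 : fubini_F m2 (EFin \o F) = (EFin \o (fun x => \int[m2]_y F (x, y))%R).
  apply/funext => x; rewrite /fubini_F /= /Rintegral fineK//.
  exact: (integrable_fin_num _ (ix x)).
have E2 : fubini_G m1 (EFin \o F) = (EFin \o (fun y => \int[m1]_x F (x, y))%R).
  apply/funext => y; rewrite /fubini_G /= /Rintegral fineK//.
  exact: (integrable_fin_num _ (iy y)).
split.
- by rewrite -E1; exact: (integrable_fubini_F iF).
- apply: (@le_integrable _ _ _ _ _ measurableT _ (fun y => ((\int[m1]_x g x)%R * h y)%:E)).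
  + by rewrite -E2; exact: (measurable_fubini_G iF).
  + by move=> y _; rewrite lee_fin; apply: le_trans (by_ y) (ler_norm _).
  + exact: (integrableZl measurableT _ ih).
- rewrite /Rintegral; congr fine.
  transitivity (\int[m1 \x m2]_z (F z)%:E)%E.
    rewrite -(integral12_prod_meas1 iF); apply: eq_integral => x _.
    by rewrite E1.
  rewrite -(integral21_prod_meas1 iF); apply: eq_integral => y _.
  by rewrite E2.
Qed.

End fubini.

(** * The plane as a sigma-finite factor *)

Section planar_fubini.
Context {R : realType}.
Local Notation leb := (@lebesgue_measure R).
Local Notation plane := (measurableTypeR R * measurableTypeR R)%type.

(* The library registers the product measure as sigma-finite only when it is a
   subprobability. *)
Definition planar : set plane -> \bar R := leb2 R.

HB.instance Definition _ := Measure.on planar.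

Let planar_sigma_finite : sigma_finite setT planar.
Proof.
exists (fun n => box (n%:R : R)); last first.
  move=> n; split; first exact: measurable_box.
  by rewrite [X in (X < _)%E]leb2_box// ltry.
apply/esym/seteqP; split => // x _.
exists (Num.truncn (`|x.1| + `|x.2|)).+1 => //.
have H : `|x.1| + `|x.2| <= (Num.truncn (`|x.1| + `|x.2|)).+1%:R.
  exact: ltW (Num.Theory.truncnS_gt _).
by split; rewrite /= in_itv/= -ler_norml (le_trans _ H)// ?lerDl ?lerDr.
Qed.

HB.instance Definition _ := Measure_isSigmaFinite.Build _ _ _ planar planar_sigma_finite.

Lemma fubini_plane_line (F : (R * R) * R -> R) (g : R * R -> R) (h : R -> R) :
  @measurable_fun _ _ (plane * measurableTypeR R)%type (measurableTypeR R) setT F ->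
  (forall x y, `|F (x, y)| <= g x * h y) ->
  (leb2 R).-integrable setT (EFin \o g) -> leb.-integrable setT (EFin \o h) ->
  (leb2 R).-integrable setT (EFin \o (fun x => \int[leb]_y F (x, y))%R).
Proof.
move=> mF Fgh ig ih.
by have [] := @fubini_dominated _ _ plane (measurableTypeR R) R planar leb F g h mF Fgh ig ih.
Qed.

Lemma fubini_plane (F : (R * R) * (R * R) -> R) (g h : R * R -> R) :
  @measurable_fun _ _ (plane * plane)%type (measurableTypeR R) setT F ->
  (forall x y, `|F (x, y)| <= g x * h y) ->
  (leb2 R).-integrable setT (EFin \o g) -> (leb2 R).-integrable setT (EFin \o h) ->
  [/\ (leb2 R).-integrable setT (EFin \o (fun x => \int[leb2 R]_y F (x, y))%R),
      (leb2 R).-integrable setT (EFin \o (fun y => \int[leb2 R]_x F (x, y))%R) &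
  (\int[leb2 R]_x (\int[leb2 R]_y F (x, y)) = \int[leb2 R]_y (\int[leb2 R]_x F (x, y)))%R].
Proof. exact: (@fubini_dominated _ _ plane plane R planar planar F g h). Qed.

End planar_fubini.

(** * Logarithmic growth and the lower bound *)

Section potential_pairing.
Context {R : realType}.
Local Notation leb := (@lebesgue_measure R).
Local Notation plane := (measurableTypeR R * measurableTypeR R)%type.
Implicit Types (f g : R * R -> R) (x : R * R).

Lemma box_boxed (M B : R) : 0 <= M -> 0 <= B -> boxed (fun x => M * \1_(box B) x) M B.
Proof.
move=> M0 B0; split => //.
- by apply: measurable_funM => //; apply: measurable_indic; exact: measurable_box.
- move=> x; rewrite normrM (ger0_norm M0) ler_piMr//.
  by rewrite indicE ger0_norm// lern1 leq_b1.
- by move=> x xB; rewrite indicE memNset ?mulr0.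
Qed.

Lemma notin_box (B : R) x : ~ box B x -> B < euclid x.
Proof.
move=> xB; rewrite ltNge; apply/negP => exB; apply: xB.
by split; rewrite /= in_itv/= -ler_norml (le_trans _ exB)// ?abs1_le_euclid// abs2_le_euclid.
Qed.

Lemma rho_measurable :
  @measurable_fun _ _ (plane * measurableTypeR R)%type (measurableTypeR R) setT
    (fun z => rho z.1 z.2).
Proof.
apply: (@measurableT_comp _ _ _ _ _ _ (@Num.sqrt R)).
  apply: continuous_measurable_fun; exact: sqrt_continuous.
apply: measurable_funD; [apply: measurable_funD|]; apply: measurable_funX => //.
- by apply: measurableT_comp => //; exact: measurable_fst.
- by apply: measurableT_comp => //; exact: measurable_fst.
Qed.

Lemma kern_measurable (T : R) : 2 < T ->
  @measurable_fun _ _ (plane * measurableTypeR R)%type (measurableTypeR R) setT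
    (fun z => kern T (rho z.1 z.2)).
Proof.
move=> T2.
(* As [kern] vanishes for [r < 1], replacing [r^-1] by [(Num.max r 1)^-1] changes no value and gives
   a continuous function of [r]. *)
have -> : (fun z : (R * R) * R => kern T (rho z.1 z.2)) =
   (fun r => (step (T - r) - step (3 - r)) * (Num.max r 1)^-1) \o (fun z => rho z.1 z.2).
  apply/funext => z /=; have [r1|r1] := leP 1 (rho z.1 z.2).
    by [].
  rewrite kern_near0 ?rho_ge0//=; [|lra|lra].
  by rewrite !step_ge1 ?subrr ?mul0r//; lra.
apply: measurableT_comp rho_measurable; apply: continuous_measurable_fun => r.
have cs (c : R) : (fun s => step (c - s)) @ r --> step (c - r).
  have m1 : (-1 : R) = 1 \/ (-1 : R) = -1 by right.
  have d : is_derive r (1 : R) (fun s => step (c + -1 * s)) (-1 * bump 0 (c + -1 * r)).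
    exact: (is_derive_affine m1 (step_is_derive _)).
  have -> : (fun s => step (c - s)) = (fun s => step (c + -1 * s)).
    by apply/funext => s; rewrite mulN1r.
  rewrite -[c - r]/(c + - r) -(mulN1r r).
  have [/derivable1_diffP dd _] := d.
  exact: (differentiable_continuous dd).
apply: cvgM; first by apply: cvgB; exact: cs.
apply: cvgV; first by rewrite gt_eqF// (lt_le_trans ltr01)// le_max lexx orbT.
apply: continuous_max => //; exact: cvg_cst.
Qed.

Lemma pot_boxed (T : R) : 2 < T -> boxed (pot T) (2 * (T + 2)) (T + 2).
Proof.
move=> T2; have B0 : 0 <= T + 2 by lra.
have b1 := box_boxed ler01 B0; have b2 := itv_indic_integrable ler01 B0.
have dom x xi : `|kern T (rho x xi)| <= 1 * \1_(box (T + 2)) x * (1 * \1_(`[- (T + 2), T + 2]%classic : set R) xi).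
  rewrite !mul1r !indicE.
  have [xB|/notin_box xB] := pselect (box (T + 2) x); last first.
    by rewrite kern_far ?normr0 ?mulr_ge0// (lt_le_trans xB)// euclid_le_rho.
  rewrite mem_set// mul1r; have [xis|xis] := leP `|xi| (T + 2).
    rewrite mem_set/=; last by rewrite in_itv/= -ler_norml.
    by apply: kern_le1 => //; exact: rho_ge0.
  by rewrite kern_far ?normr0// (lt_le_trans xis)// rho_ge3.
have I := @fubini_plane_line R (fun z => kern T (rho z.1 z.2)) _ _ (kern_measurable T2)
   dom (boxed_integrable b1) (boxed1_integrable b2).
split => //.
- by move/measurable_int : I => /measurable_EFinP.
- by move=> x; rewrite -[leRHS]mul1r; exact: boxed1_integral (kern_boxed x T2).
- by move=> x /notin_box xB; exact: pot_far.
Qed.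

Lemma pot_L2 (T : R) : 2 < T -> L2 (pot T).
Proof. by move=> T2; exact: boxed_L2 (pot_boxed T2). Qed.

Lemma ip_pot_is_derive g (T : R) : L2 g -> 2 < T ->
  is_derive T (1 : R) (fun T => ip g (pot T)) (ip g (J 0 1 T)).
Proof.
move=> Lg T2; have [C C0 HC] := @J_boxed R 0.
have B0 : 0 <= T + 2 by lra.
pose M := C * (2 * (T + 2)).
have M0 : 0 <= M by rewrite !mulr_ge0// ltW.
have Lb := boxed_L2 (box_boxed M0 B0).
apply: (@is_derive_integral _ _ _ (leb2 R) (fun T x => g x * pot T x)
  (fun T x => g x * J 0 1 T x) T 2 (T + 1) (fun x => `|g x * (M * \1_(box (T + 2)) x)|)).
- by rewrite T2/=; lra.
- by move=> t /andP[t2 _]; exact: L2_mul_integrable Lg (pot_L2 t2).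
- move=> t x /andP[t2 _]; have d := pot_is_derive x t2.
  exact: (@is_deriveZ _ _ _ (fun T => pot T x) (g x) t 1 _ d).
- by [].
- exact: (integrable_norm (L2_mul_integrable Lg Lb)).
- move=> t x /andP[t2 tT]; rewrite normrM [leRHS]normrM ler_wpM2l//.
  have [xB|/notin_box xB] := pselect (box (T + 2) x); last first.
    by rewrite J_far ?normr0 ?mulr_ge0//; lra.
  rewrite indicE mem_set// mulr1 (ger0_norm M0).
  have [_ _ H _] := HC 1 t t2; apply: le_trans (H x) _.
  by rewrite ler_wpM2l ?(ltW C0)//; lra.
Qed.

(** Unlike [J_bound], there is no growth in [s]: the bump forces [rho >= s - 1], and [(s - 1)^-1]
    compensates the length [2 * (s + 1)] of the support. The ratio is at most 4 precisely when
    [s >= 3]. *)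
Lemma J01_bound : exists2 C : R, 0 < C & forall s x, 3 <= s -> `|J 0 1 s x| <= C.
Proof.
have [C C0 HC] := @bump_bounded R 0; exists (4 * C) => [|s x s3]; first by rewrite mulr_gt0.
have s2 : 2 < s by lra.
have s1 : 0 < s - 1 by lra.
have b : boxed1 (fun xi => K 0 1 s (rho x xi)) (C * (s - 1)^-1) (s + 1).
  have [C' C'0 HC'] := @K_rho_boxed R 0.
  have [mK B0 _ H] := HC' 1 s x s2; split => // xi.
  have [r1|r1] := ltP (rho x xi) (s - 1).
    rewrite /K bump_out ?mul0r ?normr0 ?mulr_ge0 ?invr_ge0 ?(ltW C0) ?(ltW s1)//.
    by rewrite ger0_norm; lra.
  rewrite /K expr1 normrM ler_pM// ger0_norm ?invr_ge0 ?rho_ge0//.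
  by rewrite lef_pV2// posrE// (lt_le_trans s1).
apply: le_trans (boxed1_integral b) _.
rewrite mulrAC ler_pdivrMr//.
have -> : 4 * C * (s - 1) = C * (4 * (s - 1)) by ring.
by rewrite ler_wpM2l ?(ltW C0)//; lra.
Qed.

Lemma ip_sup f g (M : R) : (leb2 R).-integrable setT (EFin \o f) ->
  measurable_fun setT g -> (forall x, `|g x| <= M) ->
  `|ip f g| <= M * (\int[leb2 R]_x `|f x|)%R.
Proof.
move=> If mg gM.
have Inf : (leb2 R).-integrable setT (EFin \o (fun x => M * `|f x|)).
  exact: (integrableZl measurableT M (integrable_norm If)).
have Ifg : (leb2 R).-integrable setT (EFin \o (fun x => f x * g x)).
  apply: (le_integrable measurableT _ _ Inf).
  - apply/measurable_EFinP; apply: measurable_funM => //.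
    by move/measurable_int : If => /measurable_EFinP.
  - move=> x _; rewrite lee_fin (le_trans _ (ler_norm _))// normrM mulrC.
    by rewrite ler_wpM2r.
apply: le_trans (le_normr_Rintegral measurableT Ifg) _.
rewrite -RintegralZl//; last exact: (integrable_norm If).
apply: le_Rintegral => //; first exact: (integrable_norm Ifg).
by move=> x _; rewrite normrM mulrC ler_wpM2r.
Qed.

(* [pairing_is_derive] integrated in time: [pot (2 * t + 3) / 2] and
   [Jw 0 1 0 (2 * t) / 2] are primitives of [w(2t)] and [w_t(2t)]. *)
Lemma pairing_const (u ut ux uy : R -> R * R -> R) (p q : R) : wave u ut ux uy ->
  0 < p -> p <= q ->
  let D (t : R) := ip (u t) (Jw 0 1 0 t) - 2^-1 * (ip (ut 0) (pot (2 * t + 3)) + ip (u 0) (Jw 0 1 0 (2 * t))) in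
  D q = D p.
Proof.
move=> hu p0 pq D.
have dD (t : R) : 0 < t -> is_derive t (1 : R) D 0.
  move=> t0; have t20 : 0 < 2 * t by rewrite mulr_gt0.
  have Lu0 := wave_L2 hu (lexx 0); have Lut0 := wave_L2t hu (lexx 0).
  have hw := @test_wave R 0.
  have d1 := pairing_is_derive hu hw t0.
  have T2 : 2 < 2 * t + 3 by lra.
  have d2 := ip_pot_is_derive Lut0 T2.
  have d3 : is_derive (2 * t) (1 : R) (fun s => ip (u 0) (Jw 0 1 0 s)) (ip (u 0) (Jw 1 1 0 (2 * t))).
    apply: (@derL2_is_derive _ future) => //; first exact: nbhs_future.
    + by move=> s; exact: (wave_L2 hw).
    + exact: (wave_L2t hw (ltW t20)).
    + exact: (wave_derL2 hw (ltW t20)).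
  have a1 : is_derive t (1 : R) (fun s => 2 * s + 3) 2.
    have := is_deriveD (is_deriveZ (2 : R) (@is_derive_id _ _ t (1 : R))) (@is_derive_cst _ _ _ (3 : R) t (1 : R)).
    by rewrite addr0 /GRing.scale/= mulr1.
  have a2 : is_derive t (1 : R) (fun s => 2 * s) 2.
    by have := is_deriveZ (2 : R) (@is_derive_id _ _ t (1 : R)); rewrite /GRing.scale/= mulr1.
  have d2' := @is_derive1_comp _ (fun T => ip (ut 0) (pot T)) (fun s => 2 * s + 3) t _ _ d2 a1.
  have d3' := @is_derive1_comp _ (fun s => ip (u 0) (Jw 0 1 0 s)) (fun s => 2 * s) t _ _ d3 a2.
  have := is_deriveB d1 (is_deriveZ (2^-1 : R) (is_deriveD d2' d3')).
  apply: is_derive_congr.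
    by [].
  rewrite /GRing.scale/=.
  have -> : ip (ut 0) (J 0 1 (2 * t + 3)) = ip (ut 0) (Jw 0 1 0 (2 * t)).
    by congr (ip _ _); apply/funext => x; rewrite /Jw subr0.
  move: (ip _ _) (ip _ _) => a b. clear; lra.
move: pq; rewrite le_eqVlt => /predU1P[->//|pq].
have [t||t _] := @MVT _ D (fun=> 0) p q pq.
- rewrite in_itv/= => /andP[pt _]; apply: dD; exact: lt_trans pt.
- apply: derivable_within_continuous => t; rewrite in_itv/= => /andP[pt _].
  by have [] := dD t (lt_le_trans p0 pt).
- by rewrite mul0r => /subr0_eq.
Qed.
End potential_pairing.

(** * Growth of the test waves and the lower bound *)

Section log_growth.
Context {R : realType}.
Implicit Types (f g : R * R -> R) (x y : R * R).

(** An absolute time after which [ln t >= 1], so that constants are absorbed into [ln t], and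
    [t > 4], which the comparisons of logarithms below use. *)
Definition start : R := 4 + expR 1.

Lemma start_gt4 (t : R) : start <= t -> 4 < t.
Proof. by apply: lt_le_trans; rewrite ltrDl expR_gt0. Qed.

Lemma start_ln (t : R) : start <= t -> 1 <= ln t.
Proof.
move=> st; have t4 := start_gt4 st; rewrite -[1](@expRK R) ler_ln ?posrE ?expR_gt0//; last lra.
by apply: le_trans st; rewrite lerDr.
Qed.

Lemma ln_le_sub1 (a : R) : 0 < a -> ln a <= a - 1.
Proof.
move=> a0; have := expR_ge1Dx (ln a); rewrite lnK ?posrE//; lra.
Qed.

Lemma pot_log (t : R) x : start <= t -> `|pot (2 * t + 3) x| <= 8 * ln t.
Proof.
move=> st; have t4 := start_gt4 st; have l1 := start_ln st.
have T3 : 3 <= 2 * t + 3 by lra.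
rewrite ger0_norm; last first.
  by apply: Rintegral_ge0 => xi _; rewrite kern_ge0// rho_ge0.
apply: le_trans (pot_le x T3) _.
(* This comes from [2 * t + 6 <= t ^+ 2]; the bound of [pot_le] is then at most [4 * ln t + 4],
   hence at most [8 * ln t]. *)
suff : ln (2 * t + 3 + 3) <= 2 * ln t by lra.
rewrite [2 * ln t]mulr_natl -lnXn ?ler_ln ?posrE ?exprn_gt0//; [|lra..].
by rewrite expr2; nra.
Qed.

(** The bound is uniform in [t], and [x] enters through [ln (4 + euclid x) <= 3 + euclid x].
    Integrated against [u_1], the deviation is controlled by the weighted norm of [L11]. *)
Lemma pot_log_deviation (t : R) x : start <= t ->
  `|pot (2 * t + 3) x - 2 * ln t| <= 10 * (1 + euclid x).
Proof.
move=> st; have t4 := start_gt4 st.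
have T3 : 3 <= 2 * t + 3 by lra.
have t0 : 0 < t by lra.
have e0 : 0 <= euclid x by exact: sqrtr_ge0.
have u1 := pot_le x T3; have u2 := pot_ge x T3.
have l4 : ln (4 : R) <= 3 by have := @ln_le_sub1 4 (ltr0n _ 4); lra.
have u3 : ln (2 * t + 3 + 3) <= ln 4 + ln t.
  by rewrite -lnM ?posrE//; [rewrite ler_ln ?posrE//; lra].
have u4 : ln t <= ln (2 * t + 3 - 1) by rewrite ler_ln ?posrE//; lra.
have u5 : ln (4 + euclid x) <= 3 + euclid x.
  by have := @ln_le_sub1 (4 + euclid x); lra.
rewrite ler_norml; apply/andP; split; lra.
Qed.

Lemma Jw_n2_shift j k y (t : R) : 0 <= t -> n2 (Jw j k y t) = n2 (Jw j k 0 t).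
Proof.
move=> t0; have t3 : 2 < t + 3 by lra.
have mJ := continuous2_measurable (@J_continuous R j k _ t3).
exact: (etrans (@n2_shift _ (J j k (t + 3)) (- y) mJ) (esym (@n2_shift _ (J j k (t + 3)) (- 0) mJ))).
Qed.

Lemma test_wave_sup : exists2 C : R, 0 < C & forall f (t : R), 0 <= t ->
  (leb2 R).-integrable setT (EFin \o f) ->
  `|ip f (Jw 0 1 0 t)| <= C * (\int[leb2 R]_x `|f x|)%R.
Proof.
have [C C0 HC] := @J01_bound R; exists C => // f t t0 If; apply: ip_sup => //.
- exact: L2_measurable (test_L2 (Jw_test 0 1 0 t0)).
- by move=> x; apply: HC; lra.
Qed.

Let pairing_growth (a p n c L i j : R) : 0 <= c -> 1 <= L ->
  i <= 8 * L * n -> j <= c -> a - 2^-1 * (i + j) = p ->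
  a <= (`|p| + (4 * n + c) + 1) * L.
Proof.
move=> c0 L1 il jc E.
have h1 := ler_peMr c0 L1; have h2 := ler_peMr (normr_ge0 p) L1.
have h3 := ler_norm p.
have -> : (`|p| + (4 * n + c) + 1) * L = `|p| * L + 4 * (n * L) + c * L + L by ring.
have {}il : i <= 8 * (n * L) by rewrite [n * L]mulrC mulrA.
by move: (n * L) (c * L) (`|p| * L) (`|p|) il h1 h2 h3 => *; lra.
Qed.

(** The pairing of the test wave with itself is its squared norm. The potential contributes a
    multiple of [ln t], while the other terms stay bounded thanks to the sup bound on the wave. *)
Lemma test_wave_n2 : exists2 C : R, 0 < C & forall y (t : R), start <= t ->
  n2 (Jw 0 1 y t) <= C * Num.sqrt (ln t).
Proof.
have [C C0 HC] := test_wave_sup; have hw := @test_wave R 0.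
have [M0 [B0 b0]] := test_boxed (Jw_test 0 1 (0 : R * R) (lexx 0)).
have [M1 [B1 b1]] := test_boxed (Jw_test 1 1 (0 : R * R) (lexx 0)).
pose I0 := (\int[leb2 R]_x `|Jw 0 1 0 0 x|)%R.
pose I1 := (\int[leb2 R]_x `|Jw 1 1 0 0 x|)%R.
have I00 : 0 <= I0 by apply: Rintegral_ge0.
have I10 : 0 <= I1 by apply: Rintegral_ge0.
have [P HP] : exists P : R, forall t : R, 1 <= t -> ip (Jw 0 1 0 t) (Jw 0 1 0 t) -
    2^-1 * (ip (Jw 1 1 0 0) (pot (2 * t + 3)) + ip (Jw 0 1 0 0) (Jw 0 1 0 (2 * t))) = P.
  by eexists => t t1; exact: (pairing_const hw ltr01 t1).
pose A := `|P| + (4 * I1 + C * I0) + 1.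
have A0 : 0 < A.
  apply: ltr_wpDl ltr01; apply: addr_ge0; first exact: normr_ge0.
  by apply: addr_ge0; [exact: mulr_ge0|exact: mulr_ge0 (ltW C0) I00].
exists (Num.sqrt A) => [|y t st]; first by rewrite sqrtr_gt0.
have t4 := start_gt4 st; have l1 := start_ln st.
have t0 : 0 <= t by lra.
rewrite Jw_n2_shift// -sqrtrM ?(ltW A0)//; apply: ler_wsqrtr.
have t1 : 1 <= t by lra.
have := HP t t1.
have h1 : `|ip (Jw 1 1 0 0) (pot (2 * t + 3))| <= 8 * ln t * I1.
  apply: ip_sup; first exact: boxed_integrable b1.
  - by apply: L2_measurable; apply: pot_L2; lra.
  - by move=> x; exact: pot_log.
have h2 : `|ip (Jw 0 1 0 0) (Jw 0 1 0 (2 * t))| <= C * I0.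
  by apply: HC; [lra|exact: boxed_integrable b0].
move=> E; exact: (pairing_growth (mulr_ge0 (ltW C0) I00) l1
  (le_trans (ler_norm _) h1) (le_trans (ler_norm _) h2) E).
Qed.

Lemma test_wave_t_n2 : exists2 C : R, 0 < C & forall y (t : R), 1 <= t ->
  n2 (Jw 1 1 y t) <= C.
Proof.
have hw := @test_wave R 0.
have [E HE] : exists E : R, forall t : R, 0 < t -> ip (Jw 1 1 0 t) (Jw 1 1 0 t) +
    (ip ('D_e1 (Jw 0 1 0 t)) ('D_e1 (Jw 0 1 0 t)) + ip ('D_e2 (Jw 0 1 0 t)) ('D_e2 (Jw 0 1 0 t))) = E.
  by eexists => t t0; exact: (energy hw t0 ltr01).
have HE' (t : R) : 0 < t -> ip (Jw 1 1 0 t) (Jw 1 1 0 t) <= E.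
  by move=> /HE <-; rewrite lerDl; apply: addr_ge0; exact: ip_ge0.
have E0 : 0 < E + 1.
  by apply: ltr_wpDl ltr01; apply: le_trans (HE' _ ltr01); exact: ip_ge0.
exists (Num.sqrt (E + 1)) => [|y t t1]; first by rewrite sqrtr_gt0.
have t0 : 0 < t := lt_le_trans ltr01 t1.
rewrite Jw_n2_shift ?(ltW t0)//; apply: ler_wsqrtr; apply: le_trans (HE' _ t0) _.
by rewrite lerDl.
Qed.

(* The initial data of a solution are attained up to a null set only. *)
Definition initial (u ut : R -> R * R -> R) u0 u1 := forall g, L2 g ->
  ip (u 0) g = ip u0 g /\ ip (ut 0) g = ip u1 g.

(** From [t0] on, the pairing with the test wave is at least half of its leading term [|m| ln t].
    Division by the norm [D sqrt (ln t)] of the test wave leaves the constant [(2 * D)^-1]. *)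
Lemma lower_bound : exists2 C : R, 0 < C &
  forall (u ut ux uy : R -> R * R -> R) u0 u1, wave u ut ux uy -> initial u ut u0 u1 ->
  L2 u1 -> (leb2 R).-integrable setT (EFin \o u0) ->
  (leb2 R).-integrable setT (EFin \o u1) ->
  (leb2 R).-integrable setT (EFin \o (fun x => (1 + euclid x) * `|u1 x|)) ->
  exists2 t0 : R, 1 < t0 & forall t, t0 <= t ->
    C * `|(\int[leb2 R]_x u1 x)%R| * Num.sqrt (ln t) <= n2 (u t).
Proof.
have [C C0 HC] := test_wave_sup; have [D D0 HD] := test_wave_n2.
exists (2 * D)^-1; first by rewrite invr_gt0 mulr_gt0.
move=> u ut ux uy u0 u1 hu iu Lu1 I0 I1 I11.
pose m := (\int[leb2 R]_x u1 x)%R.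
have [m0|m0] := eqVneq m 0.
  exists 2 => [|t _]; first lra.
  by rewrite -/m m0 normr0 mulr0 mul0r n2_ge0.
have am : 0 < `|m| by rewrite normr_gt0.
pose N0 := (\int[leb2 R]_x `|u0 x|)%R.
pose N1 := (\int[leb2 R]_x ((1 + euclid x) * `|u1 x|))%R.
have [P HP] : exists P : R, forall t : R, 1 <= t -> ip (u t) (Jw 0 1 0 t) -
    2^-1 * (ip (ut 0) (pot (2 * t + 3)) + ip (u 0) (Jw 0 1 0 (2 * t))) = P.
  by eexists => t t1; exact: (pairing_const hu ltr01 t1).
(* [B] dominates everything except the leading term; the 5 is half of the 10 in [pot_log_deviation].
   At time [expR (2 * B / |m|)] the leading term [|m| ln t] reaches [2 * B]. *)
pose B := `|P| + (5 * N1 + C * N0).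
exists (Num.max start (expR (2 * B / `|m|))).
  by rewrite lt_max; apply/orP; left; have := @start_gt4 start (lexx _); lra.
move=> t; rewrite ge_max => /andP[st Bt].
have t4 := start_gt4 st; have l1 := start_ln st.
have t0 : 0 < t by clear -t4; lra.
have t1 : 1 <= t by clear -t4; lra.
have t20 : 0 <= 2 * t by clear -t4; lra.
have T2 : 2 < 2 * t + 3 by clear -t4; lra.
have l0 : 0 < ln t := lt_le_trans ltr01 l1.
pose s := Num.sqrt (ln t).
have s2 : s ^+ 2 = ln t by rewrite sqr_sqrtr// ltW.
have s0 : 0 < s by rewrite sqrtr_gt0.
have Bs : 2 * B <= `|m| * s ^+ 2.
  rewrite s2 [leRHS]mulrC -ler_pdivrMr//.
  by rewrite -[leLHS](@expRK R) ler_ln ?posrE ?expR_gt0.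
have LW (r : R) : 0 <= r -> L2 (Jw 0 1 0 r) by move=> r0; exact: test_L2 (Jw_test 0 1 0 r0).
have := HP t t1.
have [-> _] := iu _ (LW _ t20).
have [_ ->] := iu _ (pot_L2 T2).
rewrite -/s -/m.
have h1 : `|ip u1 (pot (2 * t + 3)) - 2 * ln t * m| <= 10 * N1.
  have Ip := L2_mul_integrable Lu1 (pot_L2 T2).
  have Im := integrableZl measurableT (2 * ln t) I1.
  rewrite /ip /m -RintegralZl// -RintegralB//.
  have Ig := integrableB measurableT Ip Im.
  apply: le_trans (le_normr_Rintegral measurableT Ig) _.
  rewrite /N1 -RintegralZl//; apply: le_Rintegral => //.
  - exact: (integrable_norm Ig).
  - exact: (integrableZl measurableT 10 I11).
  - move=> x _; rewrite [_ * u1 x]mulrC -mulrBr normrM mulrC mulrA.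
    by rewrite ler_wpM2r// pot_log_deviation.
have h2 : `|ip u0 (Jw 0 1 0 (2 * t))| <= C * N0 by exact: HC.
have h3 := ip_CS (wave_L2 hu (ltW t0)) (LW t (ltW t0)).
have h4 : n2 (u t) * n2 (Jw 0 1 0 t) <= n2 (u t) * (D * s).
  by rewrite ler_wpM2l ?n2_ge0// HD.
rewrite -(ler_pM2r (mulr_gt0 D0 s0)) => E.
have -> : (2 * D)^-1 * `|m| * s * (D * s) = 2^-1 * (`|m| * s ^+ 2).
  rewrite invfM expr2.
  have -> : 2^-1 * D^-1 * `|m| * s * (D * s) = 2^-1 * (`|m| * (s * s)) * (D^-1 * D) by ring.
  by rewrite mulVf ?mulr1// gt_eqF.
have h5 : `|m| * s ^+ 2 = `|s ^+ 2 * m| by rewrite normrM (ger0_norm (sqr_ge0 s)) mulrC.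
apply: le_trans h4; apply: le_trans h3; move: Bs h1 h2 E.
rewrite h5 -s2 /B -[2 * _ * m]mulrA.
move: (s ^+ 2 * m) (ip u1 _) (ip u0 _) (ip (u t) _) (C * N0) => a b c d e.
move=> Bs h1 h2 E.
have -> : d = a + (P + 2^-1 * (b - 2 * a) + 2^-1 * c) by lra.
have h6 : `|P + 2^-1 * (b - 2 * a) + 2^-1 * c| <= `|P| + 5 * N1 + 2^-1 * e.
  rewrite (le_trans (ler_normD _ _))// lerD//.
    rewrite (le_trans (ler_normD _ _))// lerD// normrM gtr0_norm//; lra.
  rewrite normrM gtr0_norm//; lra.
have e0 : 0 <= e by exact: le_trans h2.
have := lerB_normD a (P + 2^-1 * (b - 2 * a) + 2^-1 * c).
move: (`|_ + _ + _|) h6 => *; lra.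
Qed.

End log_growth.

(** * Averages over translates and the upper bound *)

Section mass.
Context {R : realType}.
Local Notation leb := (@lebesgue_measure R).
Local Notation plane := (measurableTypeR R * measurableTypeR R)%type.
Implicit Types (f : R * R -> R) (x : R * R).

Lemma Rintegral_gt0 d (Y : measurableType d) (mu : {measure set Y -> \bar R})
    (h : Y -> R) (A : set Y) (m : R) :
  measurable A -> (0 < mu A)%E -> 0 < m -> mu.-integrable setT (EFin \o h) ->
  (forall y, 0 <= h y) -> (forall y, A y -> m <= h y) -> 0 < (\int[mu]_y h y)%R.
Proof.
move=> mA A0 m0 ih h0 hm; rewrite -lte_fin.
have -> : (\int[mu]_y h y)%R%:E = (\int[mu]_y (h y)%:E)%E.
  by rewrite /Rintegral fineK//; exact: (integrable_fin_num _ ih).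
have mh := measurable_int _ ih.
apply: (@lt_le_trans _ _ (\int[mu]_(y in A) (m%:E))%E).
  by rewrite integral_cst// mule_gt0// lte_fin.
apply: (@le_trans _ _ (\int[mu]_(y in A) (h y)%:E)%E).
  apply: ge0_le_integral => //.
  - by move=> y _; rewrite lee_fin ltW.
  - exact: measurable_funS mh.
apply: ge0_subset_integral => //.
by move=> y _; rewrite lee_fin.
Qed.

Lemma Rintegral_line_gt0 (h : R -> R) (a : R) :
  leb.-integrable setT (EFin \o h) -> continuous h ->
  (forall y, 0 <= h y) -> 0 < h a -> 0 < (\int[leb]_y h y)%R.
Proof.
move=> ih ch h0 ha; have ha2 : 0 < h a / 2 by rewrite divr_gt0.
have /cvgrPdist_lt /(_ _ ha2) /nbhs_ballP [d /= d0 Hd] := ch a.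
apply: (@Rintegral_gt0 _ _ leb h (ball a d) (h a / 2)) => //.
- exact: measurable_ball.
- by rewrite [X in (_ < X)%E](lebesgue_measure_ball a (ltW d0)) lte_fin pmulrn_lgt0.
- by move=> y /Hd /=; rewrite ltr_norml => /andP[_ H]; lra.
Qed.

Lemma Rintegral_plane_gt0 f x :
  (leb2 R).-integrable setT (EFin \o f) -> continuous f ->
  (forall y, 0 <= f y) -> 0 < f x -> 0 < (\int[leb2 R]_y f y)%R.
Proof.
move=> ih ch h0 ha; have ha2 : 0 < f x / 2 by rewrite divr_gt0.
have /cvgrPdist_lt /(_ _ ha2) /nbhs_ballP [d /= d0 Hd] := ch x.
apply: (@Rintegral_gt0 _ plane (leb2 R) f (ball x.1 d `*` ball x.2 d) (f x / 2)) => //.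
- by apply: measurableX; exact: measurable_ball.
- rewrite [X in (_ < X)%E]product_measure1E; [|exact: measurable_ball..].
  have E (a : R) : leb (ball a d) = (d *+ 2)%:E := lebesgue_measure_ball a (ltW d0).
  by apply: mule_gt0; rewrite [X in (_ < X)%E]E lte_fin pmulrn_lgt0.
- by move=> y /Hd /=; rewrite ltr_norml => /andP[_ H]; lra.
Qed.

Let s3 : 2 < (3 : R). Proof. by lra. Qed.

(** The averaging kernel [J 1 1 3] is built on the derivative of a bump and has no evident sign.
    [J 0 2 3], of the same mass, has a nonnegative integrand, positive at [xi = 0] over a point
    [(3 - b, 0)] with [bump 0 b > 0]. *)
Lemma J02_integral_gt0 : 0 < (\int[leb2 R]_x J 0 2 3 x)%R.
Proof.
have [b /andP[b1 b2] b0] := @bump0_gt0 R.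
have [C C0 HC] := @J_boxed R 0; have [C' C'0 HC'] := @K_rho_boxed R 0.
have K0 x xi : 0 <= K 0 2 3 (rho x xi).
  by rewrite /K mulr_ge0 ?bump0_ge0// exprn_ge0// invr_ge0 rho_ge0.
apply: (@Rintegral_plane_gt0 _ (3 - b, 0)).
- exact: boxed_integrable (HC 2%N 3 s3).
- exact: J_continuous.
- by move=> y; apply: Rintegral_ge0.
apply: (@Rintegral_line_gt0 _ 0).
- exact: boxed1_integrable (HC' 2%N 3 _ s3).
- exact: K_rho_continuous.
- by [].
rewrite /rho/= !expr0n/= !addr0 sqrtr_sqr gtr0_norm; last by lra.
rewrite /K subKr mulr_gt0// exprn_gt0// invr_gt0; lra.
Qed.

(* [J 0 2 3 - J 1 1 3] is the divergence of [x * J 0 2 3 x]. *)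
Lemma J_mass : (\int[leb2 R]_x J 1 1 3 x = \int[leb2 R]_x J 0 2 3 x)%R.
Proof.
have tJ j k : test_function (@J R j k 3) by exact: J_test.
pose p x := x.1 * J 0 2 3 x; pose q x := x.2 * J 0 2 3 x.
have tp : test_function p.
  have -> : p = (fun x => J 0 2 3 x * x.1) by apply/funext => x; rewrite /p mulrC.
  exact: (testMl (tJ 0%N 2%N) (fun k => @Ck_fst R k (fun a => a) (@Dk_id R k.+1))).
have tq : test_function q.
  have -> : q = (fun x => J 0 2 3 x * x.2) by apply/funext => x; rewrite /q mulrC.
  exact: (testMl (tJ 0%N 2%N) (fun k => @Ck_snd R k (fun a => a) (@Dk_id R k.+1))).
have [Mp [Bp bp]] := test_boxed (test_D_e1 tp).
have [Mq [Bq bq]] := test_boxed (test_D_e2 tq).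
have [M1 [B1 b1]] := test_boxed (tJ 1%N 1%N).
have [M2 [B2 b2]] := test_boxed (tJ 0%N 2%N).
have E x : 'D_e1 p x + 'D_e2 q x = J 0 2 3 x - J 1 1 3 x.
  have d1 : is_derive x e1 p (J 0 2 3 x + x.1 * (x.1 * (- J 1 3 3 x - 2%:R * J 0 4 3 x))).
    have dx : is_derive x e1 (fun y : R * R => y.1) 1.
      by apply: is_derive_e1; exact: is_derive_id.
    apply: is_derive_congr (is_deriveM dx (@J_is_derive_e1 R 0 2 3 x s3)) => //.
    by rewrite /GRing.scale/= mulr1 addrC.
  have d2 : is_derive x e2 q (J 0 2 3 x + x.2 * (x.2 * (- J 1 3 3 x - 2%:R * J 0 4 3 x))).
    have dx : is_derive x e2 (fun y : R * R => y.2) 1.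
      by apply: is_derive_e2; exact: is_derive_id.
    apply: is_derive_congr (is_deriveM dx (@J_is_derive_e2 R 0 2 3 x s3)) => //.
    by rewrite /GRing.scale/= mulr1 addrC.
  rewrite (@derive_val _ _ _ _ _ _ _ d1) (@derive_val _ _ _ _ _ _ _ d2).
  have := J_ibp 0 1 x s3; cbv zeta.
  move: (J 0 2 3 x) (J 1 1 3 x) (J 1 3 3 x) (J 0 4 3 x) => a b c d H.
  have -> : a + x.1 * (x.1 * (- c - 2 * d)) + (a + x.2 * (x.2 * (- c - 2 * d))) =
    2 * a - (x.1 ^+ 2 + x.2 ^+ 2) * (c + 2 * d) by ring.
  have -> : (x.1 ^+ 2 + x.2 ^+ 2) * (c + 2 * d) =
    (x.1 ^+ 2 + x.2 ^+ 2) * c + 2 * ((x.1 ^+ 2 + x.2 ^+ 2) * d) by ring.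
  move: ((x.1 ^+ 2 + x.2 ^+ 2) * c) ((x.1 ^+ 2 + x.2 ^+ 2) * d) H => *; lra.
have : (\int[leb2 R]_x ('D_e1 p x + 'D_e2 q x))%R = 0.
  rewrite RintegralD//; [|exact: boxed_integrable bp|exact: boxed_integrable bq].
  by rewrite test_integral_D_e1// test_integral_D_e2// addr0.
under eq_Rintegral do rewrite E.
have E2 := RintegralB measurableT (boxed_integrable b2) (boxed_integrable b1).
move=> /(etrans (esym E2)).
move: (\int[leb2 R]_x J 0 2 3 x)%R (\int[leb2 R]_x J 1 1 3 x)%R => a b.
by move/subr0_eq.
Qed.

End mass.

(** * Convolutions paired with test functions, and translations *)

Section convolution.
Context {R : realType}.
Local Notation plane := (measurableTypeR R * measurableTypeR R)%type.
Implicit Types (f g k phi : R * R -> R) (x y z : R * R).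

Lemma boxP (B : R) x : box B x <-> `|x.1| <= B /\ `|x.2| <= B.
Proof.
split; first by case=> /=; rewrite !in_itv/= -!ler_norml.
by case=> h1 h2; split; rewrite /= in_itv/= -ler_norml.
Qed.

Lemma measurable_sub2 : @measurable_fun _ _ (plane * plane)%type plane setT
  (fun w => (w.1 : R * R) - w.2).
Proof.
apply/measurable_fun_pairP; split => /=; apply: measurable_funB.
- by apply: measurableT_comp; [exact: measurable_fst|exact: measurable_fst].
- by apply: measurableT_comp; [exact: measurable_fst|exact: measurable_snd].
- by apply: measurableT_comp; [exact: measurable_snd|exact: measurable_fst].
- by apply: measurableT_comp; [exact: measurable_snd|exact: measurable_snd].
Qed.

Lemma measurable_add2 : @measurable_fun _ _ (plane * plane)%type plane setT
  (fun w => (w.1 : R * R) + w.2).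
Proof.
apply/measurable_fun_pairP; split => /=; apply: measurable_funD.
- by apply: measurableT_comp; [exact: measurable_fst|exact: measurable_fst].
- by apply: measurableT_comp; [exact: measurable_fst|exact: measurable_snd].
- by apply: measurableT_comp; [exact: measurable_snd|exact: measurable_fst].
- by apply: measurableT_comp; [exact: measurable_snd|exact: measurable_snd].
Qed.

Lemma box_shift_far k phi (M M' B B' : R) x z : boxed k M B -> boxed phi M' B' ->
  ~ box (B + B') x -> phi (x + z) * k z = 0.
Proof.
move=> [_ _ _ kB] [_ _ _ pB] xBB.
have [zB|/kB ->] := pselect (box B z); last by rewrite mulr0.
rewrite pB ?mul0r// => xzB; apply: xBB.
move/boxP : zB => [z1 z2]; move/boxP : xzB => /= [xz1 xz2]; apply/boxP; split.
- have -> : x.1 = - z.1 + (x.1 + z.1) by rewrite addrC addrK.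
  by rewrite (le_trans (ler_normD _ _))// normrN lerD.
- have -> : x.2 = - z.2 + (x.2 + z.2) by rewrite addrC addrK.
  by rewrite (le_trans (ler_normD _ _))// normrN lerD.
Qed.

Lemma boxed_normM_integrable g (B : R) : 0 <= B -> L2 g ->
  (leb2 R).-integrable setT (EFin \o (fun x => `|g x * (1 * \1_(box B) x)|)).
Proof.
move=> B0 Lg.
exact: (integrable_norm (L2_mul_integrable Lg (boxed_L2 (box_boxed ler01 B0)))).
Qed.

Lemma boxed_measurable k (M B : R) : boxed k M B -> measurable_fun setT k.
Proof. by case. Qed.

Lemma boxed_shift_L2 k (M B : R) z : boxed k M B -> L2 (fun x => k (x + z)).
Proof.
move=> bk; have mk := boxed_measurable bk.
apply: (@boxed_L2 _ _ M (B + `|z.1| + `|z.2|)); split.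
- exact: measurableT_comp mk (measurable_shift2 z).
- by rewrite !addr_ge0//; case: bk.
- by move=> x; case: bk.
- move=> x xB; case: bk => _ _ _; apply => /boxP[/= h1 h2]; apply: xB; apply/boxP; split.
    have -> : x.1 = (x.1 + z.1) - z.1 by rewrite addrK.
    by rewrite (le_trans (ler_normB _ _))// -addrA lerD// lerDl.
  have -> : x.2 = (x.2 + z.2) - z.2 by rewrite addrK.
  by rewrite (le_trans (ler_normB _ _))// lerD// (le_trans h2)// lerDl.
Qed.

Section kernel.
Variables (k phi g : R * R -> R) (M M' B B' : R).
Hypotheses (bk : boxed k M B) (bphi : boxed phi M' B') (Lg : L2 g).
Hypothesis k_even : forall z, k (- z) = k z.

(** The pairing of the convolution [k * g] with [phi], expanded over translates of [k], which is the
    form delivered by the duality. It is rewritten as an integral against [g] for the L1 bound, and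
    over translates of [phi] for the L2 bound and the defect. *)
Let X := (\int[leb2 R]_y (phi y * ip g (fun x => k (x - y))))%R.

Let B0 : 0 <= B + B'.
Proof. by case: bk => _ ? _ _; case: bphi => _ ? _ _; exact: addr_ge0. Qed.

Let k_sym x y : k (x - y) = k (y - x). Proof. by rewrite -k_even opprB. Qed.

Let shiftE x : (\int[leb2 R]_y (phi y * k (x - y)) = \int[leb2 R]_z (phi (x + z) * k z))%R.
Proof.
have mk := boxed_measurable bk; have mp := boxed_measurable bphi.
under eq_Rintegral => y _ do rewrite k_sym.
have := @Rintegral_shift R x (fun y => phi y * k (y - x)).
move=> <-.
  by apply: eq_Rintegral => z _; rewrite addrK [z + x]addrC.
apply: measurable_funM => //.
exact: measurableT_comp mk (measurable_shift2 (- x)).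
Qed.

Let kb (z : R * R) : `|k z| <= M. Proof. by case: bk. Qed.
Let pb (z : R * R) : `|phi z| <= M'. Proof. by case: bphi. Qed.

(** Fubini asks for a product bound, but [g] is only in L2 here. The supports of [k] and [phi]
    confine [x] to [box (B + B')], where [g] is integrable. *)
Let dom1 x y : `|phi y * (g x * k (x - y))| <=
  `|g x * (1 * \1_(box (B + B')) x)| * (M * `|phi y|).
Proof.
have [xB|xB] := pselect (box (B + B') x); last first.
  have := box_shift_far (y - x) bk bphi xB; rewrite addrCA addrN addr0 k_sym => H.
  by rewrite mulrCA H mulr0 normr0 mulr_ge0// mulr_ge0// (le_trans _ (kb 0)).
rewrite indicE mem_set// !mulr1 !normrM mulrCA ler_wpM2l//.
by rewrite mulrC ler_wpM2r.
Qed.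

Let dom2 x z : `|g x * phi (x + z) * k z| <=
  `|g x * (1 * \1_(box (B + B')) x)| * (M' * `|k z|).
Proof.
have [xB|xB] := pselect (box (B + B') x); last first.
  rewrite -mulrA (box_shift_far z bk bphi xB) mulr0 normr0 mulr_ge0// mulr_ge0//.
  exact: le_trans (pb 0).
rewrite indicE mem_set// !mulr1 !normrM -mulrA ler_wpM2l//.
by rewrite ler_wpM2r.
Qed.

Let mg : measurable_fun setT g := L2_measurable Lg.

Let convolution_swap :
  (leb2 R).-integrable setT (EFin \o (fun x => g x * \int[leb2 R]_y (phi y * k (x - y)))%R) /\
  (leb2 R).-integrable setT (EFin \o (fun y => phi y * ip g (fun x => k (x - y)))) /\
  X = (\int[leb2 R]_x (g x * \int[leb2 R]_y (phi y * k (x - y))))%R.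
Proof.
have mk := boxed_measurable bk; have mp := boxed_measurable bphi.
have mF : @measurable_fun _ _ (plane * plane)%type (measurableTypeR R) setT
    (fun w => phi w.2 * (g w.1 * k (w.1 - w.2))).
  apply: measurable_funM; first exact: measurableT_comp mp measurable_snd.
  apply: measurable_funM; first exact: measurableT_comp mg measurable_fst.
  exact: measurableT_comp mk measurable_sub2.
have I1 := boxed_normM_integrable B0 Lg.
have I2 := integrableZl measurableT M (integrable_norm (boxed_integrable bphi)).
have bky x : boxed (fun y => phi y * k (x - y)) (M' * M) B'.
  case: (bphi) => _ B'0 _ pB; split => //.
  - apply: measurable_funM => //.
    rewrite (_ : (fun _ => _) = (fun y => k (y - x))); last by apply/funext => y; exact: k_sym.
    exact: measurableT_comp mk (measurable_shift2 (- x)).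
  - by move=> y; rewrite normrM ler_pM.
  - by move=> y /pB ->; rewrite mul0r.
have E1 y : (phi y * ip g (fun x => k (x - y)) = \int[leb2 R]_x (phi y * (g x * k (x - y))))%R.
  rewrite /ip -RintegralZl//.
  exact: L2_mul_integrable Lg (boxed_shift_L2 (- y) bk).
have E2 x : (\int[leb2 R]_y (phi y * (g x * k (x - y))) = g x * \int[leb2 R]_y (phi y * k (x - y)))%R.
  rewrite -RintegralZl//; last exact: boxed_integrable (bky x).
  by apply: eq_Rintegral => y _; rewrite mulrCA.
have [I J E] := fubini_plane mF dom1 I1 I2.
move: I J; under eq_fun => x do rewrite /= E2.
under [in X in _ -> X -> _]eq_fun => y do rewrite /= -E1.
move=> I J; split; [exact: I|split; [exact: J|]].
rewrite /X; under eq_Rintegral => y _ do rewrite E1.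
by apply: (etrans (esym E)); apply: eq_Rintegral => x _; exact: E2.
Qed.

Let kphi_boxed x : boxed (fun z => phi (x + z) * k z) (M' * M) B.
Proof.
have mk := boxed_measurable bk; have mp := boxed_measurable bphi.
case: (bk) => _ B'0 _ kB; split => //.
- apply: measurable_funM => //.
  rewrite (_ : (fun _ => _) = (fun z => phi (z + x))).
    exact: measurableT_comp mp (measurable_shift2 x).
  by apply/funext => z; rewrite addrC.
- by move=> y; rewrite normrM ler_pM.
- by move=> y /kB ->; rewrite mulr0.
Qed.

Let convolution_translate :
  (leb2 R).-integrable setT (EFin \o (fun z => k z * ip g (fun x => phi (x + z)))) /\
  X = (\int[leb2 R]_z (k z * ip g (fun x => phi (x + z))))%R.
Proof.
have mk := boxed_measurable bk; have mp := boxed_measurable bphi.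
have mF : @measurable_fun _ _ (plane * plane)%type (measurableTypeR R) setT
    (fun w => g w.1 * phi (w.1 + w.2) * k w.2).
  apply: measurable_funM; last exact: measurableT_comp mk measurable_snd.
  apply: measurable_funM; first exact: measurableT_comp mg measurable_fst.
  exact: measurableT_comp mp measurable_add2.
have I1 := boxed_normM_integrable B0 Lg.
have I2 := integrableZl measurableT M' (integrable_norm (boxed_integrable bk)).
have G z : (\int[leb2 R]_x (g x * phi (x + z) * k z) = k z * ip g (fun x => phi (x + z)))%R.
  rewrite mulrC -RintegralZr//; exact: L2_mul_integrable Lg (boxed_shift_L2 z bphi).
have H x : (\int[leb2 R]_z (g x * phi (x + z) * k z) = g x * \int[leb2 R]_y (phi y * k (x - y)))%R.
  rewrite shiftE -RintegralZl//; last exact: boxed_integrable (kphi_boxed x).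
  by apply: eq_Rintegral => z _; rewrite mulrA.
have [_ J E] := fubini_plane mF dom2 I1 I2.
move: J; under eq_fun => z do rewrite /= G.
move=> J; split; first exact: J.
rewrite convolution_swap.2.2; under eq_Rintegral => x _ do rewrite -H.
by apply: (etrans E); apply: eq_Rintegral => z _; exact: G.
Qed.

Lemma convolution_integrable :
  (leb2 R).-integrable setT (EFin \o (fun y => phi y * ip g (fun x => k (x - y)))).
Proof. by have [_ []] := convolution_swap. Qed.

(** Young's inequality [|k * g|_2 <= |g|_1 |k|_2] in dual form: Cauchy-Schwarz in [y] for each fixed
    [x]. *)
Lemma convolution_L1 : (leb2 R).-integrable setT (EFin \o g) ->
  `|X| <= (\int[leb2 R]_x `|g x|)%R * n2 k * n2 phi.
Proof.
move=> Ig; have [I [_ ->]] := convolution_swap; have mk := boxed_measurable bk.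
apply: le_trans (le_normr_Rintegral measurableT I) _.
rewrite -mulrA -RintegralZr//; last exact: (integrable_norm Ig).
apply: le_Rintegral => //.
- exact: (integrable_norm I).
- exact: (integrableZr measurableT (n2 k * n2 phi) (integrable_norm Ig)).
- move=> x _; rewrite normrM ler_wpM2l//.
  have := ip_CS (boxed_L2 bphi) (boxed_shift_L2 (- x) bk).
  rewrite (@n2_shift _ k (- x))// mulrC; apply: le_trans.
  rewrite le_eqVlt; apply/orP; left; apply/eqP; congr (`|_|).
  by apply: eq_Rintegral => y _; rewrite k_sym.
Qed.

(** The other Young inequality, with the L1 norm on the kernel: Cauchy-Schwarz for each translate of
    [phi]. *)
Lemma convolution_L2 : `|X| <= (\int[leb2 R]_z `|k z|)%R * (n2 g * n2 phi).
Proof.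
have [I ->] := convolution_translate; have Ik := boxed_integrable bk.
apply: le_trans (le_normr_Rintegral measurableT I) _.
rewrite -RintegralZr//; last exact: (integrable_norm Ik).
apply: le_Rintegral => //.
- exact: (integrable_norm I).
- exact: (integrableZr measurableT (n2 g * n2 phi) (integrable_norm Ik)).
- move=> z _; rewrite normrM ler_wpM2l//.
  rewrite -(@n2_shift _ phi z); last exact: boxed_measurable bphi.
  exact: ip_CS Lg (boxed_shift_L2 z bphi).
Qed.

(** [X] averages the pairings with translates of [phi] against [k]; undoing one translation costs at
    most [D] on the support of [k]. *)
Lemma convolution_defect (D : R) :
  (forall z, `|z.1| <= B -> `|z.2| <= B -> `|ip g (fun x => phi (x + z)) - ip g phi| <= D) ->
  `|(\int[leb2 R]_z k z)%R * ip g phi - X| <= (\int[leb2 R]_z `|k z|)%R * D.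
Proof.
move=> HD; have [I ->] := convolution_translate; have Ik := boxed_integrable bk.
have Ic := integrableZr measurableT (ip g phi) Ik.
rewrite -RintegralZr// -RintegralB//.
have J := integrableB measurableT Ic I.
apply: le_trans (le_normr_Rintegral measurableT J) _.
rewrite -RintegralZr//; last exact: (integrable_norm Ik).
apply: le_Rintegral => //.
- exact: (integrable_norm J).
- exact: (integrableZr measurableT D (integrable_norm Ik)).
- move=> z _; rewrite -mulrBr normrM.
  have [/boxP[z1 z2]|zB] := pselect (box B z).
    by rewrite distrC ler_wpM2l// HD.
  by case: bk => _ _ _ /(_ _ zB) ->; rewrite normr0 !mul0r.
Qed.

End kernel.

Lemma path_is_derive g phi dphi (h : R -> R * R) (a M B N : R) : L2 g ->
  boxed dphi M B -> (forall t, L2 (fun x => phi (x + h t))) ->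
  (forall x t, is_derive t (1 : R) (fun t => phi (x + h t)) (dphi (x + h t))) ->
  0 <= N -> (forall t, a - 1 < t < a + 1 -> `|(h t).1| <= N /\ `|(h t).2| <= N) ->
  is_derive a (1 : R) (fun t => ip g (fun x => phi (x + h t)))
    (ip g (fun x => dphi (x + h a))).
Proof.
move=> Lg bd Lp dp N0 hN.
have M0 : 0 <= M by case: bd => _ _ /(_ 0) H _; exact: le_trans H.
have B0 : 0 <= B by case: bd.
have C0 : 0 <= B + N by exact: addr_ge0.
have Lb := boxed_L2 (box_boxed M0 C0).
apply: (@is_derive_integral _ _ _ (leb2 R) (fun t x => g x * phi (x + h t))
  (fun t x => g x * dphi (x + h t)) a (a - 1) (a + 1)
  (fun x => `|g x * (M * \1_(box (B + N)) x)|)).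
- by apply/andP; split; lra.
- by move=> t _; exact: L2_mul_integrable Lg (Lp t).
- by move=> y; exact: normr_ge0.
- exact: (integrable_norm (L2_mul_integrable Lg Lb)).
- move=> t x /hN[t1 t2]; rewrite normrM [leRHS]normrM ler_wpM2l//.
  case: bd => _ _ bM bB.
  have [xC|xC] := pselect (box (B + N) x).
    by rewrite indicE mem_set// mulr1 (ger0_norm M0).
  rewrite bB ?normr0// => /boxP[/= h1 h2]; apply: xC; apply/boxP; split.
    have -> : x.1 = (x.1 + (h t).1) - (h t).1 by rewrite addrK.
    by rewrite (le_trans (ler_normB _ _))// lerD.
  have -> : x.2 = (x.2 + (h t).2) - (h t).2 by rewrite addrK.
  by rewrite (le_trans (ler_normB _ _))// lerD.
Qed.

Let near_bound (a b t : R) : a - 1 < t < a + 1 -> `|t| <= `|a| + 1 + `|b| /\ `|b| <= `|a| + 1 + `|b|.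
Proof.
move=> /andP[ta ta']; have := normr_ge0 a; have := normr_ge0 b => b0 a0; split; last lra.
have : `|t - a| <= 1 by rewrite ler_norml; apply/andP; split; lra.
have : `|t| <= `|a| + `|t - a|.
  by have -> : `|t| = `|a + (t - a)|; [rewrite addrC subrK|exact: ler_normD].
lra.
Qed.

Lemma translate_is_derive1 g g1 phi (a b : R) : test_function phi -> L2 g ->
  weak_partial e1 g g1 ->
  is_derive a (1 : R) (fun t => ip g (fun x => phi (x + (t, b))))
    (- ip g1 (fun x => phi (x + (a, b)))).
Proof.
move=> tphi Lg wg.
have [M [B bd]] := test_boxed (test_D_e1 tphi).
have -> : - ip g1 (fun x => phi (x + (a, b))) = ip g (fun x => 'D_e1 phi (x + (a, b))).
  apply: (etrans (esym (wg _ (test_shift (a, b) tphi)))).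
  apply: eq_Rintegral => x _; congr (_ * _).
  exact: (congr1 (fun h => h x) (derive_shift2 phi (a, b) e1)).
have N0 : 0 <= `|a| + 1 + `|b| by rewrite !addr_ge0.
apply: (path_is_derive Lg bd _ _ N0).
- by move=> t; exact: test_L2 (test_shift _ tphi).
- move=> x t; have [d1 _ _ _] := Ck_inv (tphi.1 1%N).
  have p1 : (1 : R) = 1 \/ (1 : R) = -1 by left.
  have d := is_derive_slice1 (d1 (x.1 + 1 * t, x.2 + b)).
  have := is_derive_affine p1 d.
  by rewrite !mul1r; apply: is_derive_congr => // s; rewrite mul1r.
- by move=> t; exact: near_bound.
Qed.

Lemma translate_is_derive2 g g2 phi (a b : R) : test_function phi -> L2 g ->
  weak_partial e2 g g2 ->
  is_derive b (1 : R) (fun t => ip g (fun x => phi (x + (a, t))))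
    (- ip g2 (fun x => phi (x + (a, b)))).
Proof.
move=> tphi Lg wg.
have [M [B bd]] := test_boxed (test_D_e2 tphi).
have -> : - ip g2 (fun x => phi (x + (a, b))) = ip g (fun x => 'D_e2 phi (x + (a, b))).
  apply: (etrans (esym (wg _ (test_shift (a, b) tphi)))).
  apply: eq_Rintegral => x _; congr (_ * _).
  exact: (congr1 (fun h => h x) (derive_shift2 phi (a, b) e2)).
have N0 : 0 <= `|b| + 1 + `|a| by rewrite !addr_ge0.
apply: (path_is_derive Lg bd _ _ N0).
- by move=> t; exact: test_L2 (test_shift _ tphi).
- move=> x t; have [_ d2 _ _] := Ck_inv (tphi.1 1%N).
  have p1 : (1 : R) = 1 \/ (1 : R) = -1 by left.
  have d := is_derive_slice2 (d2 (x.1 + a, x.2 + 1 * t)).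
  have := is_derive_affine p1 d.
  by rewrite !mul1r; apply: is_derive_congr => // s; rewrite mul1r.
- by move=> t /(near_bound a)[].
Qed.

(** Along each axis, the derivative of the pairing with a translate of [phi] is minus the pairing
    with the weak partial of [g]. Cauchy-Schwarz then bounds it by a multiple of [n2 phi]: no
    derivative of [phi] survives, as the dual characterisation of the norm requires. *)
Lemma translate_defect g g1 g2 phi z : test_function phi -> L2 g -> weak_grad g g1 g2 ->
  `|ip g (fun x => phi (x + z)) - ip g phi| <= (`|z.1| * n2 g1 + `|z.2| * n2 g2) * n2 phi.
Proof.
move=> tphi Lg [Lg1 Lg2 w1 w2].
have mp := L2_measurable (test_L2 tphi).
have H1 := @lipschitz1 R _ _ (n2 g1 * n2 phi)
  (fun a => translate_is_derive1 a 0 tphi Lg w1) _ 0 z.1.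
have H2 := @lipschitz1 R _ _ (n2 g2 * n2 phi)
  (fun a => translate_is_derive2 z.1 a tphi Lg w2) _ 0 z.2.
have CS f y : L2 f -> `|- ip f (fun x => phi (x + y))| <= n2 f * n2 phi.
  move=> Lf; rewrite normrN -(@n2_shift _ phi y mp).
  exact: ip_CS Lf (test_L2 (test_shift y tphi)).
have {}H1 := H1 (fun a => CS _ _ Lg1); have {}H2 := H2 (fun a => CS _ _ Lg2).
rewrite !subr0 in H1 H2.
have E0 : (fun x => phi (x + (0, 0))) = phi by apply/funext => x; rewrite (_ : (0, 0) = 0)// addr0.
have Ez : (fun x => phi (x + (z.1, z.2))) = (fun x => phi (x + z)) by case: (z).
rewrite -Ez -{2}E0.
have -> : ip g (fun x => phi (x + (z.1, z.2))) - ip g (fun x => phi (x + (0, 0))) =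
  (ip g (fun x => phi (x + (z.1, z.2))) - ip g (fun x => phi (x + (z.1, 0)))) +
  (ip g (fun x => phi (x + (z.1, 0))) - ip g (fun x => phi (x + (0, 0)))).
  by rewrite addrA subrK.
rewrite (le_trans (ler_normD _ _))// mulrDl addrC.
apply: lerD; [apply: le_trans H1 _|apply: le_trans H2 _]; rewrite le_eqVlt; apply/orP; left; apply/eqP; ring.
Qed.

End convolution.

(** * The upper bound by averaging over translates *)

Section upper_bound.
Context {R : realType}.
(** [k1] and [k0] are [w_t(0)] and [w(0)] for the test wave centred at the origin, time 0 being
    [s = 3]. *)
Local Notation k1 := (@J R 1 1 3).
Local Notation k0 := (@J R 0 1 3).
Implicit Types (g phi : R * R -> R) (x y z : R * R) (t : R).

Lemma J_even j k (s : R) z : J j k s (- z) = J j k s z.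
Proof. by apply: eq_Rintegral => xi _; rewrite /rho /= !sqrrN. Qed.

Let duality_growth (c C1 C2 n0 n1 s p a X1 X2 X3 d1 d3 : R) : 0 < c ->
  0 <= C1 -> 0 <= C2 -> 0 <= n0 -> 0 <= n1 -> 0 <= s -> 0 <= p ->
  `|c * a - (X1 + X2 - X3)| <= d1 * p -> `|X1| <= n1 * (C1 * s) * p ->
  `|X2| <= n0 * (C2 * s) * p -> `|X3| <= d3 * p ->
  `|a| <= (c^-1 * (C1 + C2) * (n0 + n1) * s + c^-1 * (d1 + d3)) * p.
Proof.
move=> c0 C10 C20 n00 n10 s0 p0 h h1 h2 h3.
have -> : `|a| = c^-1 * `|c * a|.
  by rewrite normrM gtr0_norm// mulKf// gt_eqF.
have -> : (c^-1 * (C1 + C2) * (n0 + n1) * s + c^-1 * (d1 + d3)) * p =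
    c^-1 * (d1 * p + n1 * (C1 * s) * p + n0 * (C2 * s) * p + d3 * p +
      (n1 * (C2 * s) * p + n0 * (C1 * s) * p)) by ring.
rewrite ler_wpM2l ?invr_ge0 ?(ltW c0)//.
apply: (@le_trans _ _ (d1 * p + n1 * (C1 * s) * p + n0 * (C2 * s) * p + d3 * p)); last first.
  by rewrite lerDl !addr_ge0 ?mulr_ge0.
have -> : c * a = c * a - (X1 + X2 - X3) + X1 + X2 - X3 by ring.
apply: le_trans (ler_normB _ _) (lerD _ h3).
apply: le_trans (ler_normD _ _) (lerD _ h2).
exact: le_trans (ler_normD _ _) (lerD h h1).
Qed.

Let s3 : 2 < (3 : R). Proof. by lra. Qed.

(** [c] is the mass of [k1], positive by [J_mass]; it depends on the kernel alone, as it must since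
    [c^-1] enters the final constant. [D] carries the half-side of the support of [k1], the largest
    translation along either axis. *)
Lemma averaging_defect : exists c D : R, [/\ 0 < c, 0 <= D &
  forall g gx gy phi, test_function phi -> L2 g -> weak_grad g gx gy ->
  `|c * ip g phi - (\int[leb2 R]_y (phi y * ip g (fun x => k1 (x - y))))%R| <=
    D * (n2 gx + n2 gy) * n2 phi].
Proof.
have [M [B bk]] := test_boxed (@J_test R 1 1 3 s3).
have B0 : 0 <= B by case: bk.
exists (\int[leb2 R]_x k1 x)%R, ((\int[leb2 R]_x `|k1 x|)%R * B); split.
- by rewrite J_mass; exact: J02_integral_gt0.
- by rewrite mulr_ge0//; apply: Rintegral_ge0.
move=> g gx gy phi tphi Lg wg; have [M' [B' bphi]] := test_boxed tphi.
rewrite -!mulrA; apply: (convolution_defect bk bphi Lg (J_even 1 1 3)) => z z1 z2.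
apply: le_trans (translate_defect z tphi Lg wg) _.
by rewrite mulrA ler_wpM2r ?n2_ge0// mulrDr lerD// ler_wpM2r// n2_ge0.
Qed.

Lemma averaging_bounded : exists2 D : R, 0 <= D &
  forall g phi, test_function phi -> L2 g ->
  `|(\int[leb2 R]_y (phi y * ip g (fun x => k0 (x - y))))%R| <= D * (n2 g * n2 phi).
Proof.
have [M [B bk]] := test_boxed (@J_test R 0 1 3 s3).
exists (\int[leb2 R]_x `|k0 x|)%R; first by apply: Rintegral_ge0.
move=> g phi tphi Lg; have [M' [B' bphi]] := test_boxed tphi.
exact: convolution_L2 bk bphi Lg (J_even 0 1 3).
Qed.

Lemma test_wave_convolution j t g phi (C : R) : 0 <= t -> test_function phi -> L2 g ->
  (leb2 R).-integrable setT (EFin \o g) -> n2 (Jw j 1 0 t) <= C ->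
  `|(\int[leb2 R]_y (phi y * ip g (Jw j 1 y t)))%R| <= (\int[leb2 R]_x `|g x|)%R * C * n2 phi.
Proof.
move=> t0 tphi Lg Ig nC; have t3 : 2 < t + 3 by lra.
have [M' [B' bphi]] := test_boxed tphi.
have [M [B b]] := test_boxed (@J_test R j 1 _ t3).
apply: le_trans (convolution_L1 b bphi Lg (J_even j 1 (t + 3)) Ig) _.
have g0 : 0 <= (\int[leb2 R]_x `|g x|)%R by apply: Rintegral_ge0.
have E : n2 (Jw j 1 0 t) = n2 (J j 1 (t + 3)) := n2_shift (- 0) (boxed_measurable b).
rewrite E in nC; exact: (ler_wpM2r (n2_ge0 phi) (ler_wpM2l g0 nC)).
Qed.

Lemma test_wave_convolution_integrable j t g phi : 0 <= t -> test_function phi -> L2 g ->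
  (leb2 R).-integrable setT (EFin \o (fun y => phi y * ip g (Jw j 1 y t))).
Proof.
move=> t0 tphi Lg; have t3 : 2 < t + 3 by lra.
have [M' [B' bphi]] := test_boxed tphi.
have [M [B b]] := test_boxed (@J_test R j 1 _ t3).
exact: convolution_integrable b bphi Lg (J_even j 1 (t + 3)).
Qed.

(** [A] is fixed before the solution, whereas [D] is a multiple of the square root of its energy and
    is left to be absorbed at large times. *)
Lemma upper_bound : exists2 A : R, 0 < A &
  forall (u ut ux uy : R -> R * R -> R) (u0 u1 : R * R -> R),
  wave u ut ux uy -> initial u ut u0 u1 ->
  L2 u0 -> L2 u1 -> (leb2 R).-integrable setT (EFin \o u0) ->
  (leb2 R).-integrable setT (EFin \o u1) ->
  exists2 D : R, 0 <= D & forall t, start <= t ->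
    n2 (u t) <= A * ((\int[leb2 R]_x `|u0 x|)%R + (\int[leb2 R]_x `|u1 x|)%R) * Num.sqrt (ln t) + D.
Proof.
have [C1 C10 HC1] := @test_wave_n2 R; have [C2 C20 HC2] := @test_wave_t_n2 R.
have [c [N [c0 N0 HN]]] := averaging_defect; have [N' N'0 HN'] := averaging_bounded.
exists (c^-1 * (C1 + C2)) => [|u ut ux uy u0 u1 hu iu Lu0 Lu1 I0 I1].
  by rewrite mulr_gt0 ?invr_gt0 ?addr_gt0.
have [E HE] : exists E : R, forall t, 0 < t -> ip (ut t) (ut t) +
    (ip (ux t) (ux t) + ip (uy t) (uy t)) = E.
  by eexists => t t0; exact: (energy hu t0 ltr01).
have E1 t : 0 < t -> n2 (ut t) <= Num.sqrt E.
  by move=> /HE <-; apply: ler_wsqrtr; rewrite lerDl addr_ge0//; exact: ip_ge0.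
have E2 t : 0 < t -> n2 (ux t) <= Num.sqrt E.
  by move=> /HE <-; apply: ler_wsqrtr; rewrite addrCA lerDl addr_ge0//; exact: ip_ge0.
have E3 t : 0 < t -> n2 (uy t) <= Num.sqrt E.
  by move=> /HE <-; apply: ler_wsqrtr; rewrite addrA lerDr addr_ge0//; exact: ip_ge0.
have e0 : 0 <= Num.sqrt E := sqrtr_ge0 E.
have n00 : 0 <= (\int[leb2 R]_x `|u0 x|)%R by apply: Rintegral_ge0.
have n10 : 0 <= (\int[leb2 R]_x `|u1 x|)%R by apply: Rintegral_ge0.
exists (c^-1 * (N * (Num.sqrt E + Num.sqrt E) + N' * Num.sqrt E)) => [|t st].
  by rewrite mulr_ge0 ?invr_ge0 ?(ltW c0)// addr_ge0 ?mulr_ge0 ?addr_ge0.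
have t4 := start_gt4 st; have l1 := start_ln st.
have t0 : 0 < t by clear -t4; lra.
have t1 : 1 <= t by clear -t4; lra.
have tt0 : 0 <= t <= t by rewrite lexx (ltW t0).
have s1 : 1 <= Num.sqrt (ln t) by rewrite -[1](@sqrtr1 R); apply: ler_wsqrtr.
have s0 : 0 <= Num.sqrt (ln t) := sqrtr_ge0 _.
have Lu := wave_L2 hu (ltW t0); have Lut := wave_L2t hu (ltW t0).
apply: L2_dual_bound => //.
  apply: addr_ge0; apply: mulr_ge0 => //.
  - by apply: mulr_ge0; [apply: mulr_ge0; rewrite ?invr_ge0 ?addr_ge0 ?(ltW c0) ?(ltW C10) ?(ltW C20)|exact: addr_ge0].
  - by rewrite invr_ge0 ltW.
  - by apply: addr_ge0; apply: mulr_ge0 => //; exact: addr_ge0.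
move=> phi tphi; have p0 := n2_ge0 phi.
have d1 := HN _ _ _ _ tphi Lu (wave_wgrad hu (ltW t0)).
have {}d1 := le_trans d1 (ler_wpM2r p0 (ler_wpM2l N0 (lerD (E2 t t0) (E3 t t0)))).
have b1 := test_wave_convolution (ltW t0) tphi Lu1 I1 (HC1 0 t st).
(* [w_t(t)] is bounded in L2 by energy conservation; the factor [Num.sqrt (ln t) >= 1] puts its
   bound on the same scale as that of [w(t)]. *)
have b2 := test_wave_convolution (ltW t0) tphi Lu0 I0
  (le_trans (HC2 0 t t1) (ler_peMr (ltW C20) s1)).
have b3 := HN' _ _ tphi Lut; rewrite mulrA in b3.
have {}b3 := le_trans b3 (ler_wpM2r p0 (ler_wpM2l N'0 (E1 t t0))).
have j1 := test_wave_convolution_integrable 0 (ltW t0) tphi Lu1.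
have j2 := test_wave_convolution_integrable 1 (ltW t0) tphi Lu0.
have j3 := test_wave_convolution_integrable 0 (lexx 0) tphi Lut.
have dual : (\int[leb2 R]_y (phi y * ip (u t) (fun x => k1 (x - y))))%R =
    (\int[leb2 R]_y (phi y * ip u1 (Jw 0 1 y t)))%R +
    (\int[leb2 R]_y (phi y * ip u0 (Jw 1 1 y t)))%R -
    (\int[leb2 R]_y (phi y * ip (ut t) (fun x => k0 (x - y))))%R.
  have W j y : Jw j 1 y 0 = (fun x => J j 1 3 (x - y)) by rewrite /Jw add0r.
  under [in X in _ - X]eq_Rintegral => y _ do rewrite -W.
  rewrite -(RintegralD measurableT j1 j2).
  apply: etrans (RintegralB measurableT (integrableD measurableT j1 j2) j3).
  apply: eq_Rintegral => y _; rewrite -mulrDr -mulrBr; congr (_ * _); rewrite -W.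
  have := duality hu (test_wave y) tt0; rewrite subrr.
  have L j : L2 (Jw j 1 y t) by exact: test_L2 (Jw_test j 1 y (ltW t0)).
  have [_ ->] := iu _ (L 0%N); have [-> _] := iu _ (L 1%N).
  by move=> <-; rewrite addrC addKr.
rewrite dual in d1.
exact: duality_growth c0 (ltW C10) (ltW C20) n00 n10 s0 p0 d1 b1 b2 b3.
Qed.

End upper_bound.

(** * Vanishing data and the two estimates *)

Section conclusion.
Context {R : realType}.
Implicit Types (f g : R * R -> R).

Lemma L1_integrable f : L1 f -> (leb2 R).-integrable setT (EFin \o f).
Proof. by move=> h; apply/Lfun1_integrable. Qed.

Lemma norm1E f : L1 f -> norm1 f = (\int[leb2 R]_x `|f x|)%R%:E.
Proof.
move=> /L1_integrable/integrable_norm h; rewrite /norm1 Lnorm1 /Rintegral fineK//.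
exact: (integrable_fin_num _ h).
Qed.

Lemma ae_ip f g h : L2 f -> L2 g -> L2 h -> f = g %[ae leb2 R] -> ip f h = ip g h.
Proof.
move=> Lf Lg Lh fg; rewrite /ip /Rintegral; congr fine.
apply: ae_eq_integral => //.
- exact: (measurable_int _ (L2_mul_integrable Lf Lh)).
- exact: (measurable_int _ (L2_mul_integrable Lg Lh)).
- by apply: negligibleS fg => x /= H fgx; apply: H => _; rewrite fgx.
Qed.

(** Pairing [u] with itself, the derivative of its squared norm is [(u_1, u(2t)) + (u_0, u_t(2t))],
    which is 0. This settles the case [I02 = 0], in which no multiple of [I02] can absorb a
    constant. *)
Lemma zero_data (u ut ux uy : R -> R * R -> R) (u0 u1 : R * R -> R) :
  wave u ut ux uy -> initial u ut u0 u1 -> L2 u0 -> L2 u1 ->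
  n2 u0 = 0 -> n2 u1 = 0 -> forall t : R, 0 <= t -> n2 (u t) = 0.
Proof.
move=> hu iu Lu0 Lu1 z0 z1.
have ip0 f g : L2 f -> L2 g -> n2 f = 0 -> ip f g = 0.
  move=> Lf Lg zf; have := ip_CS Lf Lg; rewrite zf mul0r.
  by rewrite normr_le0 => /eqP.
have i0 g : L2 g -> ip (u 0) g = 0 by move=> Lg; have [-> _] := iu g Lg; exact: ip0.
have i1 g : L2 g -> ip (ut 0) g = 0 by move=> Lg; have [_ ->] := iu g Lg; exact: ip0.
move=> t t0; apply/eqP; rewrite sqrtr_eq0 le_eqVlt; apply/orP; left; apply/eqP.
rewrite -(i0 (u 0) (wave_L2 hu (lexx 0))).
apply: (@derive0_cst _ (fun s => ip (u s) (u s)) 0 t) => // s /andP[s0 st].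
  have s20 : 0 <= 2 * s by rewrite mulr_ge0// ltW.
  have := pairing_is_derive hu hu s0.
  by rewrite i1 ?i0 ?addr0//; [exact: (wave_L2t hu)|exact: (wave_L2 hu)].
move=> e e0.
have [d d0 H] := @contL2_ip _ future u u s s0 (fun r => wave_L2 hu (t := r))
  (fun r => wave_L2 hu (t := r)) (wave_contL2 hu s0) (wave_contL2 hu s0) e e0.
by exists d => // r /andP[r0 _] rs; exact: H.
Qed.

End conclusion.

Theorem theorem1p2 (R : realType) :
  exists C1 C2 : R, [/\ 0 < C1, 0 < C2 &
    forall (u0 u1 : R * R -> R) (u : R -> R * R -> R),
      H1 u0 -> L2 u1 -> weak_wave_solution u0 u1 u ->
      (L1 u0 -> L1 u1 ->
        exists2 t0 : R, 1 < t0 & forall t, t0 <= t ->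
          (norm2 (u t) <= C1%:E * I02 u0 u1 * (Num.sqrt (ln t))%:E)%E) /\
      (L1 u0 -> L11 u1 ->
        exists2 t0 : R, 1 < t0 & forall t, t0 <= t ->
          ((C2 * `|(\int[leb2 R]_x u1 x)%R| * Num.sqrt (ln t))%:E
             <= norm2 (u t))%E)].
Proof.
have [A A0 HA] := @upper_bound R; have [C C0 HC] := @lower_bound R.
(* The additional 1 pays for the constant [D], which is at most [I * Num.sqrt (ln t)] for large
   [t]. *)
exists (A + 1), C; split => //; first by rewrite addr_gt0.
move=> u0 u1 u [Lu0 _] Lu1 [ut [ux [uy sol]]].
have hu := wave_of_solution sol.
have iu : initial u ut u0 u1.
  move=> g Lg; split; apply: ae_ip => //.
  - exact: (wave_L2 hu (lexx 0)).
  - exact: (wave_init0 sol).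
  - exact: (wave_L2t hu (lexx 0)).
  - exact: (wave_init1 sol).
have s1 : 1 < @start R by have := @start_gt4 R start (lexx _); lra.
have nu t : start <= t -> norm2 (u t) = (n2 (u t))%:E.
  by move=> /start_gt4 t4; apply: norm2E; apply: (wave_L2 hu); lra.
split=> [Iu0 Iu1|Iu0 [Iu1 I11]].
  have [D D0 HD] := HA _ _ _ _ _ _ hu iu Lu0 Lu1 (L1_integrable Iu0) (L1_integrable Iu1).
  rewrite /I02 !norm2E// !norm1E// -!EFinD.
  have a0 := n2_ge0 u0; have a1 := n2_ge0 u1.
  have b0 : 0 <= (\int[leb2 R]_x `|u0 x|)%R by apply: Rintegral_ge0.
  have b1 : 0 <= (\int[leb2 R]_x `|u1 x|)%R by apply: Rintegral_ge0.
  move: (\int[leb2 R]_x `|u0 x|)%R (\int[leb2 R]_x `|u1 x|)%R b0 b1 HD => n0 n1 b0 b1 HD.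
  set I := n2 u0 + n0 + n2 u1 + n1.
  have I0 : 0 <= I by rewrite !addr_ge0.
  have [Iz|Ipos] : I = 0 \/ 0 < I.
    by move: I0; rewrite le_eqVlt => /predU1P[<-|]; [left|right].
    exists start => // t st; rewrite nu//.
    have z0 : n2 u0 = 0 by move: Iz a0 a1 b0 b1; rewrite /I; lra.
    have z1 : n2 u1 = 0 by move: Iz a0 a1 b0 b1; rewrite /I; lra.
    have t0 : 0 <= t by have := start_gt4 st; lra.
    by rewrite (zero_data hu iu Lu0 Lu1 z0 z1 t0) Iz mule0 mul0e.
  (* From this time on [Num.sqrt (ln t) >= D / I]. *)
  exists (Num.max start (expR ((D / I) ^+ 2))); first by rewrite lt_max s1.
  move=> t; rewrite ge_max => /andP[st Dt]; rewrite nu// -!EFinM lee_fin.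
  have t4 := start_gt4 st; have t0 : 0 < t by clear -t4; lra.
  have s0 : 0 <= Num.sqrt (ln t) := sqrtr_ge0 _.
  have DI : D <= I * Num.sqrt (ln t).
    rewrite mulrC -ler_pdivrMr// -[leLHS]ger0_norm; last by rewrite divr_ge0// ltW.
    rewrite -sqrtr_sqr; apply: ler_wsqrtr.
    by rewrite -[leLHS](@expRK R) ler_ln ?posrE ?expR_gt0.
  apply: le_trans (HD t st) _.
  rewrite mulrDl mul1r [leRHS]mulrDl; apply: lerD DI.
  rewrite ler_wpM2r// ler_wpM2l ?(ltW A0)// /I.
  by move: a0 a1; clear; lra.
have Iu1' := L1_integrable Iu1.
have Jint : (leb2 R).-integrable setT (EFin \o (fun x => (1 + euclid x) * `|u1 x|)).
  apply/integrableP; split.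
    apply/measurable_EFinP; apply: measurable_funM.
      by apply: measurable_funD => //; exact: (continuous2_measurable euclid_continuous).
    by apply: measurableT_comp => //; exact: L2_measurable.
  apply: le_lt_trans I11; rewrite le_eqVlt; apply/orP; left; apply/eqP.
  apply: eq_integral => x _; congr (_%:E); rewrite ger0_norm// mulr_ge0// addr_ge0//.
  exact: sqrtr_ge0.
have [t0 t01 Ht] := HC _ _ _ _ _ _ hu iu Lu1 (L1_integrable Iu0) Iu1' Jint.
exists (Num.max start t0); first by rewrite lt_max s1.
by move=> t; rewrite ge_max => /andP[st tt0]; rewrite nu// lee_fin; exact: Ht.
Qed.
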